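(* For every virtually polycyclic group $\Gamma$, there exist a connected and simply connected nilpotent Lie group $N$ and a translation-like NIL-affine crystallographic action $\rho: \Gamma \to \mathrm{Aff}(N)$.
   Context: A group $\Gamma$ is virtually polycyclic if it has a subnormal series $1=\Gamma_0 \triangleleft \Gamma_1 \triangleleft \dots \triangleleft \Gamma_k=\Gamma$ in which every quotient $\Gamma_{i+1}/\Gamma_i$ is finite or infinite cyclic. For a connected and simply connected nilpotent Lie group $N$, $\mathrm{Aff}(N) = N \rtimes \mathrm{Aut}(N)$ acts on $N$ by $(x,\delta)\cdot n = x\,\delta(n)$; $N \le \mathrm{Aff}(N)$ denotes the subgroup of left translations. A NIL-affine action of $\Gamma$ is a group morphism $\rho:\Gamma \to \mathrm{Aff}(N)$. An action of a (discrete) group is crystallographic if it is properly discontinuous and cocompact. $\mathrm{Aff}(N)$ is regarded as a real algebraic group (group of real points of a linear algebraic $\mathbb{R}$-group; $N$ with its unipotent algebraic structure, $\mathrm{Aut}(N) \cong \mathrm{Aut}(\mathrm{Lie}(N))$). $\overline{\rho(\Gamma)}$ denotes the real Zariski closure of $\rho(\Gamma)$ in $\mathrm{Aff}(N)$, and $U(G)$ denotes the unipotent radical of a real algebraic group $G$ (the set of unipotent elements of the maximal closed normal solvable subgroup of $G$; for virtually solvable $G$, such as $\overline{\rho(\Gamma)}$, it is the set of all unipotent elements of $G$). A NIL-affine action $\rho: \Gamma \to \mathrm{Aff}(N)$ of a virtually polycyclic group is translation-like if $U(\overline{\rho(\Gamma)})$ acts by left translations on $N$, i.e. $U(\overline{\rho(\Gamma)})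 \le N$. *)

(* Defs.v *)
From HB Require Import structures.
From mathcomp Require Import all_boot all_order all_algebra.
From mathcomp Require Import generic_quotient.
From mathcomp Require Import all_classical all_reals all_analysis.
Import numFieldNormedType.Exports.

Set Implicit Arguments.
Unset Strict Implicit.
Unset Printing Implicit Defensive.

Import Order.TTheory GRing.Theory Num.Theory.
Local Open Scope classical_set_scope.

Section abstract_groups.
Local Open Scope group_scope.
Variable G : groupType.
Implicit Types H K S : set G.

Definition subgroup H : Prop :=
  [/\ H 1, forall x y, H x -> H y -> H (x * y) & forall x, H x -> H x^-1].

Definition normal_in H K : Prop :=
  [/\ subgroup H, subgroup K, H `<=` K
    & forall h k, H h -> K k -> H (h ^ k)].

Definition coset_set H x : set G := [set x * h | h in H].

(* The underlying set of K / H. *)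
Definition quotient_set K H : set (set G) := coset_set H @` K.

Definition cyclic_quotient K H : Prop :=
  exists2 a, K a & forall x, K x -> exists m : nat,
    coset_set H x = coset_set H (a ^+ m) \/
    coset_set H x = coset_set H (a ^- m).

Definition solvable S : Prop :=
  exists (k : nat) (D : nat -> set G),
    [/\ D 0%N = [set 1], D k = S, forall i, (i <= k)%N -> subgroup (D i)
      & forall i, (i < k)%N -> D i `<=` D i.+1 /\
          forall x y, D i.+1 x -> D i.+1 y -> D i [~ x, y] ].

End abstract_groups.

Definition virtually_polycyclic (G : groupType) : Prop :=
  exists (k : nat) (D : nat -> set G),
    [/\ D 0%N = [set 1%g], D k = [set: G]
      & forall i, (i < k)%N -> normal_in (D i) (D i.+1) /\
          (finite_set (quotient_set (D i.+1) (D i)) \/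
           (infinite_set (quotient_set (D i.+1) (D i)) /\
            cyclic_quotient (D i.+1) (D i)))].

(* Existence of a central series. *)
Definition nilpotent_group (G : groupType) : Prop :=
  exists (k : nat) (Z : nat -> set G),
    [/\ Z 0%N = [set 1%g], Z k = [set: G],
        forall i, (i <= k)%N -> subgroup (Z i)
      & forall i, (i < k)%N -> Z i `<=` Z i.+1 /\
          forall x y, Z i.+1 x -> Z i [~ x, y]%g].

Section holomorph.
Local Open Scope group_scope.
Variable G : groupType.

Record automorphism := Automorphism {
  aut_fun :> G -> G;
  aut_inv : G -> G;
  aut_funM : {morph aut_fun : x y / x * y};
  aut_funK : cancel aut_fun aut_inv;
  aut_invK : cancel aut_inv aut_fun }.

Lemma aut_eq (f g : automorphism) : aut_fun f = aut_fun g -> f = g.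
Proof.
case: f g => [f f' fM fK f'K] [g g' gM gK g'K] /= fg; subst g.
have e : f' = g' by apply/funext => x; rewrite -{1}(g'K x) fK.
by subst g'; congr Automorphism; apply: Prop_irrelevance.
Qed.

Definition aut_id : automorphism :=
  @Automorphism id id (fun _ _ => erefl) (fun _ => erefl) (fun _ => erefl).

Program Definition aut_comp (f g : automorphism) : automorphism :=
  @Automorphism (f \o g) (aut_inv g \o aut_inv f) _ _ _.
Next Obligation. by move=> f g x y; rewrite /= !aut_funM. Qed.
Next Obligation. by move=> f g x; rewrite /= !aut_funK. Qed.
Next Obligation. by move=> f g x; rewrite /= !aut_invK. Qed.

Lemma aut_invM (f : automorphism) : {morph aut_inv f : x y / x * y}.
Proof.
by move=> x y; rewrite -{1}(aut_invK f x) -{1}(aut_invK f y) -aut_funM aut_funK.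
Qed.

Definition aut_converse (f : automorphism) : automorphism :=
  Automorphism (aut_invM f) (aut_invK f) (aut_funK f).

(* The semidirect product of G with its group of abstract automorphisms. *)
Record holomorph := Holomorph { hol_trans : G; hol_lin : automorphism }.

Definition hol_mul (p q : holomorph) : holomorph :=
  Holomorph (hol_trans p * hol_lin p (hol_trans q))
            (aut_comp (hol_lin p) (hol_lin q)).

Definition hol_one : holomorph := Holomorph 1 aut_id.

Definition hol_inv (p : holomorph) : holomorph :=
  let d := aut_converse (hol_lin p) in Holomorph (d (hol_trans p)^-1) d.

HB.instance Definition _ := gen_eqMixin holomorph.
HB.instance Definition _ := gen_choiceMixin holomorph.

Let aut1 (f : automorphism) : f 1 = 1.
Proof. by apply: (mulgI (f 1)); rewrite -aut_funM !mulg1. Qed.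

Let hol_mulA : associative hol_mul.
Proof.
move=> p q r; congr Holomorph; last exact: aut_eq.
by rewrite /= aut_funM mulgA.
Qed.

Let hol_mul1 : left_id hol_one hol_mul.
Proof. by case=> x f; congr Holomorph; [exact: mul1g | exact: aut_eq]. Qed.

Let hol_mulr1 : right_id hol_one hol_mul.
Proof.
by case=> x f; congr Holomorph; [rewrite /= aut1 mulg1 | exact: aut_eq].
Qed.

Let hol_mulV : left_inverse hol_one hol_inv hol_mul.
Proof.
case=> x f; congr Holomorph.
  by rewrite /= -(aut_funM (aut_converse f)) mulVg (aut1 (aut_converse f)).
by apply: aut_eq; apply/funext => y /=; rewrite aut_funK.
Qed.

Let hol_mulrV : right_inverse hol_one hol_inv hol_mul.
Proof.
case=> x f; congr Holomorph; first by rewrite /= aut_invK mulgV.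
by apply: aut_eq; apply/funext => y /=; rewrite aut_invK.
Qed.

HB.instance Definition _ :=
  isGroup.Build holomorph hol_mulA hol_mul1 hol_mulr1 hol_mulV hol_mulrV.

Definition hol_act (p : holomorph) (x : G) : G := hol_trans p * hol_lin p x.

Definition left_translations : set holomorph :=
  [set p | forall x, hol_lin p x = x].

End holomorph.

(* No compatibility between the group law and the topology is required here;
   it is part of the definition of a Lie group below. *)
#[short(type="groupTopologicalType")]
HB.structure Definition GroupTopological := {G of Group G & Topological G}.

Section smooth_maps.
Local Open Scope ring_scope.
Variables (R : realType) (V W : normedModType R).

(* For open U and finite-dimensional V and W, this is membership in C^k(U). *)
Fixpoint Ck_on (k : nat) (U : set V) (f : V -> W) : Prop :=
  match k with
  | 0 => forall x, U x -> {for x, continuous f}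
  | k'.+1 => (forall x, U x -> differentiable f x) /\
             forall v, Ck_on k' U ('D_v f)
  end.

Definition smooth_on (U : set V) (f : V -> W) : Prop := forall k, Ck_on k U f.

End smooth_maps.

Section charts.
Variables (R : realType) (n : nat) (M : topologicalType).

Record chart := Chart {
  chart_dom : set M;
  chart_map :> M -> 'rV[R]_n;
  chart_inv : 'rV[R]_n -> M;
  chart_dom_open : open chart_dom;
  chart_cod_open : open (chart_map @` chart_dom);
  chart_mapK : {in chart_dom, cancel chart_map chart_inv};
  chart_map_continuous : {in chart_dom, continuous chart_map};
  chart_inv_continuous : {in chart_map @` chart_dom, continuous chart_inv} }.

Definition chart_cod (c : chart) : set 'rV[R]_n := c @` chart_dom c.

Definition smooth_atlas (A : set chart) : Prop :=
  (forall x, exists2 c, A c & chart_dom c x) /\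
  forall c c', A c -> A c' ->
    smooth_on [set v | chart_cod c v /\ chart_dom c' (chart_inv c v)]
              (c' \o chart_inv c).

End charts.

Section lie_groups.
Local Open Scope group_scope.
Variables (R : realType) (n : nat).

Record lieGroup := LieGroup {
  lie_sort :> groupTopologicalType;
  lie_atlas : set (chart R n lie_sort);
  lie_hausdorff : hausdorff_space lie_sort;
  lie_second_countable : @second_countable lie_sort;
  lie_atlasP : smooth_atlas lie_atlas;
  lie_mul_continuous : continuous (fun z : lie_sort * lie_sort => z.1 * z.2);
  lie_inv_continuous : continuous (fun x : lie_sort => x^-1);
  lie_mul_smooth : forall a b c,
    lie_atlas a -> lie_atlas b -> lie_atlas c ->
    smooth_on [set z : 'rV[R]_n * 'rV[R]_n | [/\ chart_cod a z.1,
                 chart_cod b z.2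
               & chart_dom c (chart_inv a z.1 * chart_inv b z.2)]]
              (fun z => c (chart_inv a z.1 * chart_inv b z.2));
  lie_inv_smooth : forall a b, lie_atlas a -> lie_atlas b ->
    smooth_on [set v | chart_cod a v /\ chart_dom b (chart_inv a v)^-1]
              (fun v => b (chart_inv a v)^-1) }.

Definition smooth_map (N : lieGroup) (f : N -> N) : Prop :=
  continuous f /\
  forall a b, lie_atlas a -> lie_atlas b ->
    smooth_on [set v | chart_cod a v /\ chart_dom b (f (chart_inv a v))]
              (b \o f \o chart_inv a).

End lie_groups.

Section simply_connected.
Local Open Scope ring_scope.
Variables (R : realType) (T : topologicalType).

Let I : set R := `[0, 1].

Definition path_connected : Prop :=
  forall x y : T, exists g : R -> T,
    [/\ {within I, continuous g}, g 0 = x & g 1 = y].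

Definition simply_connected : Prop :=
  path_connected /\
  forall g : R -> T, {within I, continuous g} -> g 0 = g 1 ->
    exists H : R * R -> T,
      [/\ {within I `*` I, continuous H},
          forall s, I s -> H (0, s) = g s,
          forall s, I s -> H (1, s) = g 0
        & forall t, I t -> H (t, 0) = g 0 /\ H (t, 1) = g 0].

End simply_connected.

Section affine_group.
Local Open Scope ring_scope.
Variables (R : realType) (n : nat) (N : lieGroup R n).

Definition Aff : set (holomorph N) :=
  [set p | smooth_map (hol_lin p) /\ smooth_map (aut_inv (hol_lin p))].

Definition identity_chart (c : chart R n N) : Prop :=
  lie_atlas c /\ chart_dom c 1%g.

(* g is the one-parameter subgroup t |-> exp (t v), where Lie(N) = T_1 N is
   identified with 'rV[R]_n by the chart c. *)
Definition one_parameter (c : chart R n N) (v : 'rV[R]_n) (g : R -> N) : Prop :=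
  [/\ forall s t, g (s + t) = (g s * g t)%g,
      continuous g & is_derive (0 : R) (1 : R) (c \o g) v].

Definition lie_log (c : chart R n N) (x : N) : 'rV[R]_n :=
  xget 0 [set v | exists2 g, one_parameter c v g & g 1 = x].

(* Matrix of the differential at 1, acting on row vectors. *)
Definition lie_differential (c : chart R n N) (f : N -> N) : 'M[R]_n :=
  'J (c \o f \o chart_inv c) (c 1%g).

(* The coordinate ring of Aff(N) = N x Aut(N), where N has its unipotent
   structure, i.e. the one that makes exp : Lie(N) -> N an isomorphism of
   varieties, and Aut(N) = Aut(Lie(N)) is a closed subgroup of GL(Lie(N)).
   Two identity charts differ on Lie(N) by a linear change of coordinates,
   hence any one of them generates the same ring. *)
Inductive regular : (holomorph N -> R) -> Prop :=
| regular_const (a : R) : regular (fun _ => a)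
| regular_trans c i : identity_chart c ->
    regular (fun p => lie_log c (hol_trans p) 0 i)
| regular_lin c i j : identity_chart c ->
    regular (fun p => lie_differential c (hol_lin p) i j)
| regular_invdet c : identity_chart c ->
    regular (fun p => (\det (lie_differential c (hol_lin p)))^-1)
| regular_add f g : regular f -> regular g -> regular (fun p => f p + g p)
| regular_mul f g : regular f -> regular g -> regular (fun p => f p * g p).

Definition zariski_closure (S : set (holomorph N)) : set (holomorph N) :=
  [set p | Aff p /\
     forall f, regular f -> (forall q, S q -> f q = 0) -> f p = 0].

Definition zariski_closed (S : set (holomorph N)) : Prop :=
  zariski_closure S = S.

(* Right translation by p is a locally unipotent operator on the coordinate
   ring. *)
Definition unipotent (p : holomorph N) : Prop :=
  Aff p /\ forall f, regular f -> exists k : nat, forall q, Aff q ->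
    iter k (fun (h : holomorph N -> R) q => h (q * p)%g - h q) f q = 0.

(* The maximal closed normal solvable subgroup of G, i.e. the union of all
   closed normal solvable subgroups. *)
Definition solvable_radical (G : set (holomorph N)) : set (holomorph N) :=
  \bigcup_(S in [set S | [/\ zariski_closed S, normal_in S G & solvable S]]) S.

Definition unipotent_radical (G : set (holomorph N)) : set (holomorph N) :=
  solvable_radical G `&` unipotent.

End affine_group.

Section actions.
Variables (R : realType) (n : nat) (N : lieGroup R n) (Gamma : groupType).
Variable rho : Gamma -> holomorph N.

Definition nil_affine : Prop :=
  {morph rho : g h / (g * h)%g} /\ range rho `<=` @Aff R n N.

Definition hol_orbit (x : N) : set N := [set hol_act (rho g) x | g in setT].

Definition same_orbit : rel N := fun x y => `[< hol_orbit x = hol_orbit y >].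

Let same_orbit_equiv : equiv_class_of same_orbit.
Proof.
split=> [x | x y | y x z]; first exact/asboolP.
  by apply/asboolP/asboolP.
by move=> /asboolP xy /asboolP yz; apply/asboolP; rewrite xy.
Qed.

Definition same_orbit_rel : equiv_rel N := EquivRelPack same_orbit_equiv.

Definition orbit_space : topologicalType :=
  quotient_topology {eq_quot same_orbit_rel}%qT.

Definition cocompact : Prop := compact [set: orbit_space].

Definition properly_discontinuous : Prop :=
  forall K : set N, compact K ->
    finite_set [set g | (hol_act (rho g) @` K) `&` K !=set0].

Definition crystallographic : Prop := properly_discontinuous /\ cocompact.

Definition translation_like : Prop :=
  unipotent_radical (zariski_closure (range rho)) `<=` @left_translations N.

End actions.

(* Main.v *)
(* A virtually polycyclic group G has a finite-index normal subgroup Delta and a chain of normal subgroups of G from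
   Delta down to 1 whose sections are free abelian and on which Delta acts diagonalizably over C: starting from any
   infinite quotient, take a free abelian normal section and cut it down by a Lie-Kolchin argument.

   Along this chain one builds nilpotent groups N with a polynomial law on R^n, together with an affine action of G by
   linear automorphisms and translations, trivial on the current subgroup K and with Delta acting diagonalizably. The
   invariant that drives the construction is that G / K has no cohomology in degrees 1 and 2, and only constants in
   degree 0, with coefficients in polynomial functions on N twisted by semisimple representations. For one step with
   section K / K' = Z^k, the vanishing of H^2 extends the projection K -> Z^k to a crossed homomorphism of G into
   polynomial maps N -> R^k, the vanishing of H^1 makes its variation a coboundary of some psi(x, y), and the H^0
   statement turns the coboundary of psi into a polynomial 2-cocycle on N. The corresponding central extension of N by
   R^k carries the next action, on which K acts by translations of Z^k; a finite difference computation on these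
   translations gives back the cohomological invariant. Properness and cocompactness pass through each step.

   Since Delta acts diagonalizably, the linear part P of an element of the Zariski closure has a diagonalizable power.
   If the element is unipotent, so is P, hence P = 1: the element is a translation. *)
Require Import Defs.
From HB Require Import structures.
From mathcomp Require Import all_boot all_order all_algebra.
From mathcomp Require Import separable complex.
From mathcomp Require Import all_classical all_reals all_analysis.
From mathcomp Require Import zify ring.
Import numFieldNormedType.Exports.

Set Implicit Arguments.
Unset Strict Implicit.
Unset Printing Implicit Defensive.
Import Order.TTheory GRing.Theory Num.Theory.
Local Open Scope classical_set_scope.

(** * Subgroups, congruences and finite index in abstract groups *)

Section GroupTheory.
Local Open Scope group_scope.
Variable G : groupType.
Implicit Types H K L N : set G.

(** Everything rests on one computation: for a lattice vector v and a scalar a, the operator sending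
    g to a g(x - v) - g(x) maps the polynomials onto themselves. For a different from 1 it is a
    nonzero scalar plus a nilpotent operator; for a = 1 it is a finite difference, inverted with
    binomial coefficients. Its cokernel is the H^1 of an infinite cyclic group, so the cohomology of
    Z^k is killed one generator at a time. Here a is the scalar by which a lattice element acts on
    the coefficients. Such scalars exist only if Delta acts diagonalizably, the same property that
    later turns unipotent elements into translations. The obstacle is that a free abelian section
    usually carries a non-semisimple action. A common eigenvector of a finite-index subgroup is not
    rational, but the linear relations expressing semisimplicity on it are, so some nonzero integer
    vector satisfies them too. The vectors satisfying them form the required invariant sublattice.
    All of G acts at every stage: passing from Delta to G only costs averages over a finite
    quotient. *)

Definition gs := (@invgM G, @invgK G, @invg1 G, @mulgA G, @mulgVK G, @mulgK G,
  @mulVg G, @mulgV G, @mul1g G, @mulg1 G).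

Definition normalizes K N := forall g x, K g -> N x -> N (g * x * g^-1).

(** A finite colouring of K whose colour classes lie in left cosets of H. This makes sense for
    arbitrary sets, turns intersections into pairs of colourings, and avoids forming the set of
    cosets. *)
Definition finite_index H K := exists (T : finType) (f : G -> T),
  forall g h, K g -> K h -> f g = f h -> H (g^-1 * h).

Definition finitely_generated H := exists s : seq G,
  (forall x, x \in s -> H x) /\
  forall L, subgroup L -> (forall x, x \in s -> L x) -> H `<=` L.

Lemma subgroup1 H : subgroup H -> H 1. Proof. by case. Qed.
Lemma subgroupM H x y : subgroup H -> H x -> H y -> H (x * y).
Proof. by case=> _ h _; exact: h. Qed.
Lemma subgroupV H x : subgroup H -> H x -> H x^-1.
Proof. by case=> _ _ h; exact: h. Qed.
Lemma subgroupVr H x : subgroup H -> H x^-1 -> H x.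
Proof. by move=> sH /(subgroupV sH); rewrite invgK. Qed.
Lemma subgroupX H x n : subgroup H -> H x -> H (x ^+ n).
Proof.
move=> sH Hx; elim: n => [|n IH]; first exact: subgroup1.
by rewrite expgS; exact: subgroupM.
Qed.
Lemma subgroupMl H x y : subgroup H -> H x -> H (x * y) -> H y.
Proof. by move=> sH Hx Hxy; rewrite -(mulKg x y); apply: subgroupM (subgroupV _ _) Hxy. Qed.
Lemma subgroupMr H x y : subgroup H -> H y -> H (x * y) -> H x.
Proof. by move=> sH Hy Hxy; rewrite -(mulgK y x); apply: subgroupM Hxy (subgroupV _ _). Qed.
Lemma subgroup_comm H x y : subgroup H -> H x -> H y -> H [~ x, y].
Proof.
move=> sH Hx Hy; rewrite /commg /conjg.
by apply: subgroupM (subgroupV _ _) (subgroupM _ (subgroupV _ _) (subgroupM _ _ _)).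
Qed.

Lemma subgroupI H K : subgroup H -> subgroup K -> subgroup (H `&` K).
Proof.
move=> sH sK; split; first by split; exact: subgroup1.
  by move=> x y [? ?] [? ?]; split; exact: subgroupM.
by move=> x [? ?]; split; exact: subgroupV.
Qed.

Lemma subgroupT : subgroup [set: G]. Proof. by []. Qed.

Lemma subgroup_set1 : subgroup [set (1 : G)].
Proof. by split=> // [x y -> ->|x ->]; rewrite /= ?mulg1 ?invg1. Qed.

Lemma subgroup_conj H g : subgroup H -> subgroup [set x | H (g * x * g^-1)].
Proof.
move=> sH; split=> /=; first by rewrite mulg1 mulgV; exact: subgroup1.
  move=> x y Hx Hy; have := subgroupM sH Hx Hy; by rewrite !gs.
by move=> x /(subgroupV sH); rewrite !gs.
Qed.

Lemma normalizesI K N L : normalizes K N -> normalizes K L -> normalizes K (N `&` L).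
Proof. by move=> h h' g x Kg [? ?]; split; [exact: h | exact: h']. Qed.

Lemma normalizesV K N g x : subgroup K -> normalizes K N -> K g -> N x -> N (g^-1 * x * g).
Proof. by move=> sK nKN Kg Nx; have := nKN _ _ (subgroupV sK Kg) Nx; rewrite invgK. Qed.

Lemma normalizes_sub K K' N : K' `<=` K -> normalizes K N -> normalizes K' N.
Proof. by move=> KK nKN g x /KK; exact: nKN. Qed.

Lemma normal_inP H K : normal_in H K -> normalizes K H.
Proof.
case=> sH sK HK n g x Kg Hx.
by have := n _ _ Hx (subgroupV sK Kg); rewrite /conjg invgK mulgA.
Qed.

Lemma normal_subgroupM H K : subgroup H -> subgroup K -> normalizes K H ->
  subgroup [set z | exists x y, [/\ H x, K y & z = x * y]].
Proof.
move=> sH sK n; split=> /=.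
- by exists 1, 1; rewrite mulg1; split=> //; exact: subgroup1.
- move=> _ _ [x [y [Hx Ky ->]]] [x' [y' [Hx' Ky' ->]]].
  exists (x * (y * x' * y^-1)), (y * y'); split; last by rewrite !gs.
    by apply: subgroupM => //; exact: n.
  exact: subgroupM.
move=> _ [x [y [Hx Ky ->]]]; exists (y^-1 * x^-1 * y), y^-1; split; last by rewrite !gs.
  by apply: normalizesV n _ _ => //; exact: subgroupV.
exact: subgroupV.
Qed.

(** Congruence modulo N is written [N (x^-1 * y)] throughout, so that quotient groups are never
    formed. *)
Lemma congM K N x x' y y' : subgroup K -> subgroup N -> normalizes K N -> K y ->
  N (x^-1 * x') -> N (y^-1 * y') -> N ((x * y)^-1 * (x' * y')).
Proof.
move=> sK sN n Ky Nx Ny.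
have := subgroupM sN (normalizesV sK n Ky Nx) Ny.
by rewrite !gs.
Qed.

Lemma congV K N x x' : subgroup K -> subgroup N -> normalizes K N -> K x ->
  N (x^-1 * x') -> N (x^-1^-1 * x'^-1).
Proof.
move=> sK sN n Kx Nx.
by have := n _ _ Kx (subgroupV sN Nx); rewrite !gs.
Qed.

Lemma cong_refl N x : subgroup N -> N (x^-1 * x).
Proof. by rewrite mulVg; exact: subgroup1. Qed.

Lemma cong_sym N x y : subgroup N -> N (x^-1 * y) -> N (y^-1 * x).
Proof. by move=> sN /(subgroupV sN); rewrite !gs. Qed.

Lemma cong_trans N y x z : subgroup N -> N (x^-1 * y) -> N (y^-1 * z) -> N (x^-1 * z).
Proof. by move=> sN h /(subgroupM sN h); rewrite !gs. Qed.

Lemma cong_in N x y : subgroup N -> N (x^-1 * y) -> N y -> N x.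
Proof. by move=> sN h Ny; apply: subgroupVr (subgroupMr sN Ny h). Qed.

Lemma cong_in' N x y : subgroup N -> N (x^-1 * y) -> N x -> N y.
Proof. by move=> sN h Nx; apply: subgroupMl h => //; apply: subgroupV. Qed.

Definition zpow (x : G) (m : int) : G :=
  match m with Posz n => x ^+ n | Negz n => x ^- n.+1 end.

Lemma zpow_succ x (m : int) : zpow x (m + 1)%R = zpow x m * x.
Proof.
case: m => n; first by rewrite -PoszD addn1 /= expgSr.
case: n => [|n]; first by rewrite /= expg1 mulVg.
have -> : (Negz n.+1 + 1)%R = Negz n by lia.
by rewrite /= [x ^+ n.+2]expgS invgM mulgVK.
Qed.

Lemma zpowD x (m n : int) : zpow x (m + n)%R = zpow x m * zpow x n.
Proof.
have e : forall n : nat, zpow x (m + n)%R = zpow x m * zpow x n.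
  elim=> [|k IH]; first by rewrite addr0 mulg1.
  by rewrite -addn1 PoszD addrA !zpow_succ IH mulgA.
have e' : forall (n : nat) m, zpow x (m - n%:Z)%R = zpow x m * x ^- n.
  elim=> [|k IH] m'; first by rewrite subr0 invg1 mulg1.
  have -> : (m' - k.+1%:Z = (m' - 1) - k%:Z)%R by lia.
  rewrite IH [x ^+ k.+1]expgSr invgM mulgA; congr (_ * _).
  by rewrite -[in RHS](subrK 1%R m') zpow_succ mulgK.
case: n => [|n]; first exact: e.
by rewrite NegzE e'.
Qed.

Lemma zpow1 x : zpow x 1 = x. Proof. by rewrite /= expg1. Qed.

Lemma zpowN x m : zpow x (- m)%R = (zpow x m)^-1.
Proof. by apply: (mulIg (zpow x m)); rewrite -zpowD addNr mulVg. Qed.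

Lemma subgroup_zpow H x m : subgroup H -> H x -> H (zpow x m).
Proof.
move=> sH Hx; case: m => n; first exact: (subgroupX n sH Hx).
exact: (subgroupV sH (subgroupX n.+1 sH Hx)).
Qed.

Lemma congX K N x x' n : subgroup K -> subgroup N -> normalizes K N -> K x -> K x' ->
  N (x^-1 * x') -> N ((x ^+ n)^-1 * x' ^+ n).
Proof.
move=> sK sN nKN Kx Kx' h; elim: n => [|n IH]; first exact: cong_refl.
by rewrite !expgS; apply: congM nKN _ h IH => //; exact: subgroupX.
Qed.

Lemma cong_zpow K N x x' m : subgroup K -> subgroup N -> normalizes K N -> K x -> K x' ->
  N (x^-1 * x') -> N ((zpow x m)^-1 * zpow x' m).
Proof.
move=> sK sN nKN Kx Kx' h; case: m => n; first exact: (congX n sK sN nKN Kx Kx' h).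
exact: (congV sK sN nKN (subgroupX n.+1 sK Kx) (congX n.+1 sK sN nKN Kx Kx' h)).
Qed.

Lemma zpowM x m n : zpow (zpow x m) n = zpow x (m * n)%R.
Proof.
have e : forall n : nat, zpow (zpow x m) n = zpow x (m * n)%R.
  elim=> [|k IH]; first by rewrite mulr0.
  by rewrite -addn1 PoszD zpowD IH mulrDr mulr1 zpowD zpow1.
by case: n => n; rewrite ?NegzE ?zpowN ?mulrN ?zpowN e.
Qed.

Lemma finite_index_refl H : subgroup H -> finite_index H H.
Proof. by move=> sH; exists bool, (fun=> true) => g h Hg Hh _; exact: subgroupM (subgroupV _ _) _. Qed.

Lemma finite_indexS H H' K K' : H `<=` H' -> K' `<=` K -> finite_index H K -> finite_index H' K'.
Proof. by move=> HH KK [T [f h]]; exists T, f => g x /KK ? /KK ? ?; apply/HH/h. Qed.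

Lemma finite_indexI H H' K : finite_index H K -> finite_index H' K -> finite_index (H `&` H') K.
Proof.
move=> [T [f h]] [T' [f' h']]; exists (T * T')%type, (fun x => (f x, f' x)) => x y Kx Ky [e e'].
by split; [exact: h | exact: h'].
Qed.

Lemma finite_index_trans H K L : subgroup K -> K `<=` L -> subgroup L ->
  finite_index H K -> finite_index K L -> finite_index H L.
Proof.
move=> sK KL sL [T [f h]] [T' [f' h']].
pose r t := xget 1 [set y | L y /\ f' y = t].
have rP x : L x -> K ((r (f' x))^-1 * x).
  move=> Lx; have [Lr er] : L (r (f' x)) /\ f' (r (f' x)) = f' x.
    by apply: (@xgetPex _ 1 [set y | L y /\ f' y = f' x]); exists x.
  exact: h'.
exists (T' * T)%type, (fun x => (f' x, f ((r (f' x))^-1 * x))) => x y Lx Ly [e e1].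
have := h _ _ (rP x Lx) (rP y Ly) e1; by rewrite -e !gs.
Qed.

Lemma finite_index_reps H K : finite_index H K -> exists s : seq G,
  (forall x, x \in s -> K x) /\ forall g, K g -> exists2 x, x \in s & H (x^-1 * g).
Proof.
move=> [T [f h]]; pose D t := [set y | K y /\ f y = t].
pose s := [seq xget 1 (D t) | t <- enum T & `[< exists y, D t y >]].
exists s; split=> [x|g Kg].
  move=> /mapP [t]; rewrite mem_filter => /andP [/asboolP [y Dy] _] ->.
  by case: (@xgetPex _ 1 (D t)); first by exists y.
have [Kx ex] : D (f g) (xget 1 (D (f g))) by apply: xgetPex; exists g.
exists (xget 1 (D (f g))); last exact: h.
by apply: map_f; rewrite mem_filter mem_enum andbT; apply/asboolP; exists g.
Qed.

Lemma finite_index_of_reps H K (s : seq G) : subgroup H ->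
  (forall g, K g -> exists2 x, x \in s & H (x^-1 * g)) -> finite_index H K.
Proof.
move=> sH h.
pose P g := [pred x | `[< H (x^-1 * g) >]].
have lt g : find (P g) s < (size s).+1 by rewrite ltnS find_size.
exists 'I_(size s).+1, (fun g => Ordinal (lt g)) => x y Kx Ky [e].
have p g : K g -> H ((nth 1 s (find (P g) s))^-1 * g).
  move=> Kg; have hs : has (P g) s.
    by have [z zs Hz] := h _ Kg; apply/hasP; exists z => //; exact/asboolP.
  by apply/asboolP; exact: (nth_find 1 hs).
have := p _ Kx; rewrite e => /(cong_sym sH) px.
exact: cong_trans px (p _ Ky).
Qed.

Lemma finite_index_core H K : subgroup H -> subgroup K -> H `<=` K -> finite_index H K ->
  exists C, [/\ subgroup C, C `<=` H, normalizes K C & finite_index C K].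
Proof.
move=> sH sK HK fi; exists [set x | forall g, K g -> H (g * x * g^-1)]; split.
- split=> /=.
  + by move=> g Kg; rewrite mulg1 mulgV; exact: subgroup1.
  + by move=> x y Hx Hy g Kg; have := subgroupM sH (Hx g Kg) (Hy g Kg); rewrite !gs.
  + by move=> x Hx g Kg; have := subgroupV sH (Hx g Kg); rewrite !gs.
- by move=> x /(_ 1 (subgroup1 sK)); rewrite !gs.
- by move=> g x Kg Cx k Kk; have := Cx _ (subgroupM sK Kk Kg); rewrite !gs.
have [s [sKs hs]] := finite_index_reps fi.
have [T [f hf]] := fi.
(* The colour of x records its action on the finite set K / H. If x and y move every representative
   z to the same coset, then x^-1 y lies in all conjugates of H. *)
exists {ffun 'I_(size s) -> T}, (fun g => [ffun i : 'I_(size s) => f (g * nth 1 s i)]) => x y Kx Ky /ffunP e k Kk /=.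
have [z zs Hz] := hs _ (subgroupV sK Kk).
have zi : index z s < size s by rewrite index_mem.
have := e (Ordinal zi); rewrite !ffunE /= nth_index // => {}e.
have Kz := sKs _ zs.
have := hf _ _ (subgroupM sK Kx Kz) (subgroupM sK Ky Kz) e => h.
have := subgroupM sH (subgroupM sH (subgroupV sH Hz) h) Hz; by rewrite !gs.
Qed.

Definition cyclic_mod H K := exists2 a, K a &
  forall x, K x -> exists m : int, H ((zpow a m)^-1 * x).

Inductive vpoly : set G -> Prop :=
| vpoly1 : vpoly [set 1]
| vpolyS H K : vpoly H -> subgroup H -> subgroup K -> H `<=` K -> normalizes K H ->
    finite_index H K \/ cyclic_mod H K -> vpoly K.

(** To the generators of the intersection with the smaller group one adds, for a finite quotient,
    one element of H in each coset that meets H; for a cyclic quotient, one element of H of least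
    positive exponent. *)
Lemma vpoly_fg K : vpoly K -> forall H, subgroup H -> finitely_generated (H `&` K).
Proof.
elim=> [|{}K L vK IH sK sL KL n hKL] H sH.
  exists [::]; split=> // M sM _ x [_ ->]; exact: subgroup1.
have [s [sHK sgen]] := IH H sH.
have gen' M : subgroup M -> (forall x, x \in s -> M x) -> forall x, H x -> K x -> M x.
  by move=> sM h x Hx Kx; exact: (sgen M sM h).
case: hKL => [/finite_index_reps [r [rL hr]]|[a La ha]].
  (* The elements of H in the coset of t. If there are none, [xget] returns 1, which does no harm as
     a generator. *)
  pose D t := [set y | [/\ H y, L y & K (t^-1 * y)]].
  pose s' := [seq xget 1 (D t) | t <- r].
  have D's t : (exists y, D t y) -> D t (xget 1 (D t)) by move=> [y Dy]; apply: xgetPex; exists y.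
  have s'P x : x \in s' -> (H `&` L) x.
    move=> /mapP [t tr ->]; have [[y Dy]|/forallNP nD] := pselect (exists y, D t y).
      by have [] := D's t (ex_intro _ y Dy).
    rewrite xgetPN //; split; exact: subgroup1.
  exists (s ++ s'); split=> [x|M sM hM x [Hx Lx]].
    by rewrite mem_cat => /orP [/sHK [Hx /KL]|/s'P].
  have [t tr Kt] := hr _ Lx.
  have [Hy Ly Ky] := D's t (ex_intro _ x (And3 Hx Lx Kt)).
  set y := xget _ _ in Hy Ly Ky.
  have My : M y by apply: hM; rewrite mem_cat; apply/orP; right; apply: map_f.
  rewrite -(mulVKg y x); apply: subgroupM => //; apply: gen' => //.
  - by move=> z zs; apply: hM; rewrite mem_cat zs.
  - exact: subgroupM (subgroupV _ _) _.
  - exact: cong_trans (cong_sym _ Ky) Kt.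
(* The positive exponents n for which a^n is congruent to an element of H. If there are none, H
   meets L only inside K; otherwise Euclidean division by the least one applies. *)
pose P n := (0 < n) && `[< exists y, [/\ H y, L y & K ((zpow a n)^-1 * y)] >].
have [exP|nP] := pselect (exists n, P n); last first.
  exists s; split=> [x /sHK [? /KL]//|M sM hM x [Hx Lx]]; apply: gen' => //.
  have [[m|m] hm] := ha _ Lx.
    case: m hm => [|m] hm; first by have := hm; rewrite /= invg1 mul1g.
    by case: nP; exists m.+1; apply/andP; split=> //; apply/asboolP; exists x.
  case: nP; exists m.+1; apply/andP; split=> //; apply/asboolP; exists x^-1.
  split; [exact: subgroupV | exact: subgroupV |].
  have := congV sL sK n (subgroup_zpow (Negz m) sL La) hm.
  by rewrite -zpowN NegzE opprK.
case: (ex_minnP exP) => m /andP [m0 /asboolP [y [Hy Ly Ky]]] mmin.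
exists (y :: s); split=> [x|M sM hM x [Hx Lx]].
  by rewrite inE => /orP [/eqP ->|/sHK [Hx /KL]].
have My : M y by apply: hM; rewrite mem_head.
have [k hk] := ha _ Lx.
pose q := (k %/ m%:Z)%Z; pose j := (k %% m%:Z)%Z.
have j0 : (0 <= j)%R by rewrite modz_ge0 //; lia.
have jm : (j < m%:Z)%R by rewrite ltz_pmod.
have Hz : H ((zpow y q)^-1 * x) by apply: subgroupM (subgroupV _ (subgroup_zpow _ _ _)) _.
have Lz : L ((zpow y q)^-1 * x) by apply: subgroupM (subgroupV _ (subgroup_zpow _ _ _)) _.
have cj : K ((zpow a j)^-1 * ((zpow y q)^-1 * x)).
  have -> : zpow a j = (zpow (zpow a m) q)^-1 * zpow a k.
    by rewrite zpowM -zpowN -zpowD; congr zpow; rewrite /j [X in (_ + X)%R](divz_eq k m) mulrC addKr.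
  have Lam : L (zpow a m) by exact: subgroup_zpow.
  apply: (congM sL sK n (subgroup_zpow k sL La) _ hk).
  apply: (congV sL sK n (subgroup_zpow q sL Lam)).
  exact: (cong_zpow q sL sK n Lam Ly Ky).
rewrite -(mulVKg (zpow y q) x); apply: subgroupM => //; first exact: subgroup_zpow.
apply: gen' => // [z zs|]; first by apply: hM; rewrite in_cons zs orbT.
case: j j0 jm cj => [[|j]|j] // _ jm cj; first by move: cj; rewrite /= invg1 mul1g.
suff : m <= j.+1 by lia.
by apply: mmin; apply/andP; split=> //; apply/asboolP; exists ((zpow y q)^-1 * x).
Qed.
End GroupTheory.

(** * Virtually polycyclic groups *)

Section Solvable.
Local Open Scope group_scope.
Variable G : groupType.
Implicit Types H K L N : set G.

Lemma cong_comm K N x x' y y' : subgroup K -> subgroup N -> normalizes K N ->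
  K x -> K y -> K x' -> K y' ->
  N (x^-1 * x') -> N (y^-1 * y') -> N ([~ x, y]^-1 * [~ x', y']).
Proof.
move=> sK sN n Kx Ky Kx' Ky' hx hy.
have V z z' : K z -> K z' -> N (z^-1 * z') -> N (z^-1^-1 * z'^-1).
  by move=> Kz Kz' h; exact: (congV sK sN n Kz h).
have Kxy := subgroupM sK Kx Ky.
rewrite /commg /conjg.
apply: (congM sK sN n (subgroupM sK (subgroupV sK Ky) Kxy) (V _ _ Kx Kx' hx)).
apply: (congM sK sN n Kxy (V _ _ Ky Ky' hy)).
exact: (congM sK sN n Ky hx hy).
Qed.

Definition derived H : set G := [set x | forall L, subgroup L ->
  (forall y z, H y -> H z -> L [~ y, z]) -> L x].

Lemma derived_subgroup H : subgroup (derived H).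
Proof.
split=> /=.
- by move=> L sL _; exact: subgroup1.
- by move=> x y hx hy L sL hL; apply: subgroupM (hx _ _ _) (hy _ _ _).
- by move=> x hx L sL hL; apply: subgroupV (hx _ _ _).
Qed.

Lemma derived_comm H x y : H x -> H y -> derived H [~ x, y].
Proof. by move=> Hx Hy L sL hL; exact: hL. Qed.

Lemma derived_sub H L : subgroup L -> (forall y z, H y -> H z -> L [~ y, z]) -> derived H `<=` L.
Proof. by move=> sL h x; apply. Qed.

Lemma derivedS H H' : H `<=` H' -> derived H `<=` derived H'.
Proof.
move=> HH; apply: derived_sub => [|y z /HH Hy /HH Hz]; first exact: derived_subgroup.
exact: derived_comm.
Qed.

Lemma derived_subset H : subgroup H -> derived H `<=` H.
Proof. by move=> sH; apply: derived_sub => // y z Hy Hz; exact: subgroup_comm. Qed.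

Lemma derived_conj H H' g : (forall x, H x -> H' (g * x * g^-1)) ->
  forall x, derived H x -> derived H' (g * x * g^-1).
Proof.
move=> h x; apply: (@derived_sub H [set z | derived H' (g * z * g^-1)]).
  exact: subgroup_conj (derived_subgroup _).
move=> y z Hy Hz /=; have := derived_comm (h _ Hy) (h _ Hz).
by rewrite /commg /conjg !gs.
Qed.

Lemma iter_derived_conj n H H' g : (forall x, H x -> H' (g * x * g^-1)) ->
  forall x, iter n derived H x -> iter n derived H' (g * x * g^-1).
Proof. by move=> h; elim: n => //= n IH; exact: derived_conj. Qed.

Lemma iter_derivedS n H H' : H `<=` H' -> iter n derived H `<=` iter n derived H'.
Proof. by move=> HH; elim: n => //= n IH; exact: derivedS. Qed.

Lemma iter_derived_subgroup n H : subgroup H -> subgroup (iter n derived H).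
Proof. by case: n => //= n _; exact: derived_subgroup. Qed.

Lemma iter_derived_subset n H : subgroup H -> iter n derived H `<=` H.
Proof.
move=> sH; elim: n => //= n IH; apply: subset_trans IH.
by apply: derived_subset; exact: iter_derived_subgroup.
Qed.

Lemma iter_derived_normal n K H : normalizes K H -> normalizes K (iter n derived H).
Proof. by move=> h g x Kg; apply: iter_derived_conj => y; exact: h. Qed.

Definition derived_solvable H := exists n, iter n derived H `<=` [set 1].

Lemma derived_solvableS H H' : H `<=` H' -> derived_solvable H' -> derived_solvable H.
Proof. by move=> HH [n h]; exists n; apply: subset_trans h; exact: iter_derivedS. Qed.

Lemma derived_solvable_conj H H' g : (forall x, H' x -> H (g * x * g^-1)) ->
  derived_solvable H -> derived_solvable H'.
Proof.
move=> h [n hn]; exists n => x /(iter_derived_conj h) /hn /= e.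
by apply: (mulgI g); apply: (mulIg g^-1); rewrite e mulg1 mulgV.
Qed.

Definition setmulg H K : set G := [set z | exists x y, [/\ H x, K y & z = x * y]].

(** Commutators can be computed modulo N, so the i-th derived group of N X lies in N X^(i). After m
    steps X has disappeared, and n further steps kill N. *)
Lemma solvable_setmulg N X : subgroup N -> subgroup X -> normalizes X N ->
  derived_solvable N -> derived_solvable X -> derived_solvable (setmulg N X).
Proof.
move=> sN sX nXN [n hn] [m hm].
have nXn i : normalizes (iter i derived X) N.
  by apply: normalizes_sub nXN; exact: iter_derived_subset.
have sM i : subgroup (setmulg N (iter i derived X)).
  by apply: normal_subgroupM => //; exact: iter_derived_subgroup.
have key i : iter i derived (setmulg N X) `<=` setmulg N (iter i derived X).
  elim: i => //= i IH; apply: subset_trans (derivedS IH) _.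
  apply: derived_sub => [|_ _ [a [x [Na Xx ->]]] [b [y [Nb Xy ->]]]]; first exact: (sM i.+1).
  have sMi := sM i; have sXi := iter_derived_subgroup i sX.
  have nMN : normalizes (setmulg N (iter i derived X)) N.
    move=> _ z [u [v [Nu Xv ->]]] Nz.
    have := subgroupM sN (subgroupM sN Nu (nXn i _ _ Xv Nz)) (subgroupV sN Nu).
    by rewrite !gs.
  have inM c z : N c -> iter i derived X z -> setmulg N (iter i derived X) (c * z) by exists c, z.
  have in1 z : iter i derived X z -> setmulg N (iter i derived X) z.
    by move=> hz; rewrite -[z]mul1g; apply: inM => //; exact: subgroup1.
  have c1 c z : N c -> iter i derived X z -> N (z^-1 * (c * z)).
    by move=> Nc hz; have := normalizesV sXi (nXn i) hz Nc; rewrite mulgA.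
  have h := cong_comm sMi sN nMN (in1 _ Xx) (in1 _ Xy) (inM _ _ Na Xx) (inM _ _ Nb Xy) (c1 _ _ Na Xx) (c1 _ _ Nb Xy).
  have Xc : iter i.+1 derived X [~ x, y] by exact: derived_comm.
  exists ([~ x, y] * ([~ x, y]^-1 * [~ a * x, b * y]) * [~ x, y]^-1), [~ x, y].
  split; [exact: (nXn i.+1 _ _ Xc h) | exact: Xc | by rewrite [in RHS]mulgVK mulVKg].
exists (n + m)%N; rewrite iterD.
apply: subset_trans hn; apply: iter_derivedS => z /key [a [x [Na /hm /= -> ->]]].
by rewrite mulg1.
Qed.

(** A solvable normal subgroup of one term of a subnormal series need not be normal in the next
    term. The union of all of them is, being normalised by whatever normalises K. *)
Definition radical K : set G := [set x | exists S,
  [/\ subgroup S, S `<=` K, normalizes K S, derived_solvable S & S x]].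

Lemma normal_solvable_join K S S' : subgroup K -> subgroup S -> S `<=` K -> normalizes K S -> derived_solvable S ->
  subgroup S' -> S' `<=` K -> normalizes K S' -> derived_solvable S' ->
  exists T, [/\ subgroup T, T `<=` K, normalizes K T, derived_solvable T & S `|` S' `<=` T].
Proof.
move=> sK sS SK nS slS sS' SK' nS' slS'; exists (setmulg S S'); split.
- by apply: normal_subgroupM => //; apply: normalizes_sub nS.
- by move=> _ [x [y [/SK Kx /SK' Ky ->]]]; exact: subgroupM.
- move=> g _ Kg [x [y [Sx Sy ->]]]; exists (g * x * g^-1), (g * y * g^-1).
  by split; [exact: nS|exact: nS'|rewrite !gs].
- by apply: solvable_setmulg => //; apply: normalizes_sub nS.
move=> x [Sx|Sx]; [exists x, 1|exists 1, x]; rewrite ?mulg1 ?mul1g; split=> //; exact: subgroup1.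
Qed.

Lemma radical_subgroup K : subgroup K -> subgroup (radical K).
Proof.
move=> sK; split.
- exists [set 1]; split=> //; first exact: subgroup_set1.
  + by move=> _ ->; exact: subgroup1.
  + by move=> g _ _ ->; rewrite /= mulg1 mulgV.
  + by exists 0%N.
- move=> x y [S [sS SK nS slS Sx]] [S' [sS' SK' nS' slS' Sy]].
  have [T [sT TK nT slT h]] := normal_solvable_join sK sS SK nS slS sS' SK' nS' slS'.
  by exists T; split=> //; apply: subgroupM => //; apply: h; [left|right].
- by move=> x [S [sS SK nS slS Sx]]; exists S; split=> //; exact: subgroupV.
Qed.

Lemma radical_sub K : radical K `<=` K. Proof. by move=> x [S [_ SK _ _ /SK]]. Qed.

Lemma radical_normal L K : subgroup L -> normalizes L K -> normalizes L (radical K).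
Proof.
move=> sL nLK g x Lg [S [sS SK nS slS Sx]].
have e y : g^-1 * y * g = g^-1 * y * g^-1^-1 by rewrite invgK.
exists [set y | S (g^-1 * y * g)]; split.
- have := subgroup_conj g^-1 sS; by under eq_set do rewrite -e.
- move=> y /= /SK Ky; have := nLK _ _ Lg Ky; by rewrite !gs.
- move=> h y Kh /= Sy; have Kh' := normalizesV sL nLK Lg Kh.
  have := nS _ _ Kh' Sy; by rewrite !gs.
- by apply: derived_solvable_conj slS => y /=; rewrite e; apply.
- by rewrite /= !gs.
Qed.

Lemma radical_max K S : subgroup S -> S `<=` K -> normalizes K S -> derived_solvable S -> S `<=` radical K.
Proof. by move=> sS SK nS slS x Sx; exists S. Qed.

(** A union of solvable normal subgroups may have unbounded derived length. Finite index of S makes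
    it the join of S with finitely many of them. *)
Lemma radical_solvable K S : subgroup K -> subgroup S -> S `<=` K -> normalizes K S -> derived_solvable S ->
  finite_index S K -> derived_solvable (radical K).
Proof.
move=> sK sS SK nS slS fi.
have [r [rR hr]] := finite_index_reps (finite_indexS (@subset_refl _ S) (@radical_sub K) fi).
have [T [[sT TK nT slT ST] rT]] : exists T, [/\ subgroup T, T `<=` K, normalizes K T, derived_solvable T &
    S `<=` T] /\ (forall x, x \in r -> T x).
  elim: r rR {hr} => [_|x r IH rR]; first by exists S; split=> //; split.
  have [z zr|T [[sT TK nT slT ST] rT]] := IH; first by apply: rR; rewrite in_cons zr orbT.
  have [S' [sS' SK' nS' slS' Sx]] := rR x (mem_head _ _).
  have [U [sU UK nU slU h]] := normal_solvable_join sK sT TK nT slT sS' SK' nS' slS'.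
  exists U; split; first by split=> // z /ST Tz; apply: (h); left.
  by move=> z; rewrite in_cons => /orP [/eqP ->|/rT Tz]; apply: h; [right|left].
apply: derived_solvableS slT => z /hr [x /rT Tx Sz].
by rewrite -(mulVKg x z); apply: subgroupM (ST _ Sz).
Qed.

(** Induction along the series, with the radical of the previous term as solvable subgroup. When the
    quotient is cyclic, generated by a, the product of this radical with the powers of a is still
    solvable and of finite index; its core restores normality. *)
Lemma vpoly_solvable K : vpoly K -> exists S,
  [/\ subgroup S, S `<=` K, normalizes K S, derived_solvable S & finite_index S K].
Proof.
elim=> [|{}H {}K vH [S [sS SH nS slS fi]] sH sK HK n hHK].
  exists [set 1]; split=> //; first exact: subgroup_set1.
  - by move=> g _ _ ->; rewrite /= mulg1 mulgV.
  - by exists 0%N.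
  - by apply: finite_index_refl; exact: subgroup_set1.
have sR := radical_subgroup sH.
have nR : normalizes K (radical H) by exact: radical_normal.
have slR := radical_solvable sH sS SH nS slS fi.
have fiR : finite_index (radical H) H.
  by apply: finite_indexS fi => //; exact: radical_max.
have RK : radical H `<=` K by move=> x /radical_sub /HK.
case: hHK => [fHK|[a Ka ha]].
  exists (radical H); split=> //; exact: finite_index_trans fiR fHK.
pose A : set G := [set z | exists m, z = zpow a m].
have sA : subgroup A.
  split; first by exists 0%R.
    by move=> _ _ [m ->] [k ->]; exists (m + k)%R; rewrite zpowD.
  by move=> _ [m ->]; exists (- m)%R; rewrite zpowN.
have AK : A `<=` K by move=> _ [m ->]; exact: subgroup_zpow.
have nAR := normalizes_sub AK nR.
have sS0 : subgroup (setmulg (radical H) A) by exact: normal_subgroupM.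
have slS0 : derived_solvable (setmulg (radical H) A).
  apply: solvable_setmulg => //; exists 1%N => /=.
  apply: derived_sub => [|_ _ [m ->] [k ->]]; first exact: subgroup_set1.
  by apply/eqP/commgP; rewrite /commute -!zpowD addrC.
have S0K : setmulg (radical H) A `<=` K.
  by move=> _ [x [y [/RK Kx /AK Ky ->]]]; exact: subgroupM.
have fS0 : finite_index (setmulg (radical H) A) K.
  have [T [f hf]] := fiR.
  (* The exponent of x modulo H. As x a^(- e x) lies in H, it can be coloured by its coset modulo
     the radical. *)
  pose e x := xget 0%R [set m : int | H ((zpow a m)^-1 * x)].
  have eP x : K x -> H ((zpow a (e x))^-1 * x).
    by move=> /ha [m hm]; apply: (@xgetPex _ 0%R [set m : int | H ((zpow a m)^-1 * x)]); exists m.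
  have eP' x : K x -> H (x * (zpow a (e x))^-1).
    move=> Kx; have := n _ _ (subgroup_zpow (e x) sK Ka) (eP x Kx); by rewrite !gs.
  exists T, (fun x => f (x * (zpow a (e x))^-1)) => x y Kx Ky h.
  have := hf _ _ (eP' x Kx) (eP' y Ky) h => hr.
  have Ax m : setmulg (radical H) A (zpow a m).
    by exists 1, (zpow a m); rewrite mul1g; split=> //; [exact: subgroup1|exists m].
  have Rx z : radical H z -> setmulg (radical H) A z.
    by exists z, 1; rewrite mulg1; split=> //; exists 0%R.
  have := subgroupM sS0 (subgroupM sS0 (subgroupV sS0 (Ax (e x))) (Rx _ hr)) (Ax (e y)); by rewrite !gs.
have [C [sC CS nC fC]] := finite_index_core sS0 sK S0K fS0.
exists C; split=> //; first exact: subset_trans S0K.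
exact: derived_solvableS slS0.
Qed.
End Solvable.

Section AbelianSections.
Local Open Scope group_scope.
Variable G : groupType.
Implicit Types B C H K L N Y : set G.

Lemma subgroup_zpows x : subgroup [set z : G | exists m, z = zpow x m].
Proof.
split; first by exists 0%R.
  by move=> _ _ [m ->] [k ->]; exists (m + k)%R; rewrite zpowD.
by move=> _ [m ->]; exists (- m)%R; rewrite zpowN.
Qed.

(** By the pigeonhole principle two of the first #|T| + 1 powers of b have the same colour, so b^i
    lies in K for some 0 < i <= #|T|. Every such i divides the factorial of #|T|, whence a common
    exponent. *)
Lemma finite_index_exponent K B : finite_index K B -> subgroup B ->
  exists2 m, 0 < m & forall b, B b -> K (b ^+ m) \/ exists2 i, (0 < i)%N & (i %| m)%N /\ K (b ^+ i).
Proof.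
move=> [T [f hf]] sB; exists (factorial #|T|); first exact: fact_gt0.
move=> b Bb; right.
have /injectivePn [i [j ij e]] : ~~ injectiveb (fun i : 'I_#|T|.+1 => f (b ^+ i)).
  by apply/negP => /injectiveP /leq_card; rewrite card_ord ltnn.
wlog lt : i j ij e / i < j.
  move=> hw; have := ij; rewrite -val_eqE neq_ltn => /orP [|] lt; first exact: (hw i j).
  by apply: (hw j i) => //; rewrite eq_sym.
exists (j - i)%N; first by rewrite subn_gt0.
split; first by apply: dvdn_fact; rewrite subn_gt0 lt /=; case: (j) => k /= hk; lia.
have := hf _ _ (subgroupX i sB Bb) (subgroupX j sB Bb) e.
by rewrite -{1}(subnKC (ltnW lt)) expgnDr mulKg.
Qed.

Lemma finite_index_expg K B : subgroup K -> finite_index K B -> subgroup B ->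
  exists2 m, (0 < m)%N & forall b, B b -> K (b ^+ m).
Proof.
move=> sK fi sB; have [m m0 h] := finite_index_exponent fi sB.
exists m => // b /h [//|[i _ [/dvdnP [q ->] Ki]]].
by rewrite mulnC expgnA; exact: subgroupX.
Qed.

(** A finitely generated abelian group of exponent m is finite: each new generator x contributes at
    most the m classes of x^i, i < m. *)
Lemma finite_index_fg_exponent C Y m : subgroup C -> subgroup Y -> Y `<=` C ->
  (forall x y, C x -> C y -> Y [~ x, y]) -> (0 < m)%N -> (forall x, C x -> Y (x ^+ m)) ->
  finitely_generated C -> finite_index Y C.
Proof.
move=> sC sY YC ab m0 hm [s [sC' gen]].
have nD D : subgroup D -> Y `<=` D -> D `<=` C -> normalizes C D.
  move=> sD YD DC g x Cg Dx.
  have : D (x * [~ x, g^-1]) by apply: subgroupM => //; apply/YD/ab; [exact: DC|exact: subgroupV].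
  by rewrite /commg /conjg !gs.
have [D [sD YD DC sDs fi]] : exists D, [/\ subgroup D, Y `<=` D, D `<=` C,
    (forall x, x \in s -> D x) & finite_index Y D].
  elim: s sC' {gen} => [_|x s IH h].
    by exists Y; split=> //; exact: finite_index_refl.
  have [z zs|D [sD YD DC sDs fi]] := IH; first by apply: h; rewrite in_cons zs orbT.
  have Cx : C x by apply: h; exact: mem_head.
  pose A := [set z : G | exists m, z = zpow x m].
  have sA : subgroup A by exact: subgroup_zpows.
  have AC : A `<=` C by move=> _ [k ->]; exact: subgroup_zpow.
  have nCD := nD D sD YD DC.
  have sDA : subgroup (setmulg D A).
    by apply: normal_subgroupM => //; exact: normalizes_sub nCD.
  have DDA : D `<=` setmulg D A.
    by move=> z Dz; exists z, 1; rewrite mulg1; split=> //; exact: subgroup1.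
  exists (setmulg D A); split=> //.
  - exact: subset_trans DDA.
  - by move=> _ [y [z [/DC Cy /AC Cz ->]]]; exact: subgroupM.
  - move=> z; rewrite in_cons => /orP [/eqP ->|/sDs Dz]; last exact: DDA.
    by exists 1, x; rewrite mul1g; split=> //; [exact: subgroup1|exists 1%R; rewrite zpow1].
  apply: finite_index_trans fi _ => //.
  apply: (@finite_index_of_reps _ _ _ [seq x ^+ i | i <- iota 0 m]) => // _ [d [_ [Dd [j ->] ->]]].
  have j0 : (0 <= (j %% m%:Z)%Z)%R by rewrite modz_ge0 //; lia.
  have jm : ((j %% m%:Z)%Z < m%:Z)%R by rewrite ltz_pmod.
  exists (zpow x (j %% m%:Z)%Z).
    case: (_ %% _)%Z j0 jm => // i _ jm; apply: map_f; rewrite mem_iota add0n; lia.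
  have Cj := subgroup_zpow (j %% m%:Z)%Z sC Cx.
  have := normalizesV sC nCD Cj Dd.
  have Dq : D (zpow (zpow x m) (j %/ m%:Z)%Z) by apply: subgroup_zpow => //; apply/YD/hm.
  move=> /(subgroupM sD) /(_ Dq).
  rewrite zpowM -[X in D X -> _]mulgA -zpowD addrC [(m%:Z * _)%R]mulrC -divz_eq.
  by rewrite -!mulgA.
apply: finite_indexS fi => //; exact: gen.
Qed.

Section Mod.
Variable K : set G.
Hypotheses (sK : subgroup K) (nK : normalizes [set: G] K).

Lemma normJ g x : K x -> K (g * x * g^-1). Proof. exact: nK. Qed.
Lemma normJV g x : K x -> K (g^-1 * x * g).
Proof. by move=> /(normJ g^-1); rewrite invgK. Qed.

Lemma comm_mem x y : K x -> K [~ x, y].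
Proof.
by move=> Kx; apply: (subgroupM sK (subgroupV sK Kx)); rewrite /conjg mulgA; exact: normJV.
Qed.

Lemma centralizer_subgroup B : subgroup [set x | forall y, B y -> K [~ x, y]].
Proof.
split=> /=.
- by move=> y _; rewrite comm1g; exact: subgroup1.
- move=> x z hx hz y By.
  have -> : [~ x * z, y] = z^-1 * [~ x, y] * z * [~ z, y] by rewrite /commg /conjg !gs.
  by apply: subgroupM (hz _ By) => //; apply: normJV; exact: hx.
- move=> x hx y By; have -> : [~ x^-1, y] = x * [~ x, y]^-1 * x^-1.
    by rewrite /commg /conjg !gs.
  by apply: normJ; apply: subgroupV => //; exact: hx.
Qed.

Lemma comm_sym x y : K [~ x, y] -> K [~ y, x].
Proof. by move=> /(subgroupV sK); rewrite invgR. Qed.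

Lemma centralizer_normal B : normalizes [set: G] B ->
  normalizes [set: G] [set x | forall y, B y -> K [~ x, y]].
Proof.
move=> nB g x _ hx y By.
have By' : B (g^-1 * y * g) by have := nB g^-1 y I By; rewrite invgK.
by have := normJ g (hx _ By'); rewrite /commg /conjg !gs.
Qed.

Lemma congKM x x' y y' : K (x^-1 * x') -> K (y^-1 * y') -> K ((x * y)^-1 * (x' * y')).
Proof. exact: (congM (@subgroupT G) sK nK). Qed.

Lemma congKX x x' n : K (x^-1 * x') -> K ((x ^+ n)^-1 * x' ^+ n).
Proof. by move=> h; exact: (congX n (@subgroupT G) sK nK I I h). Qed.

Lemma cong_commute x y : K [~ x, y] -> K ((y * x)^-1 * (x * y)).
Proof. by rewrite /commg /conjg !gs. Qed.

Lemma comm_expgl x y n : K [~ x, y] -> K [~ x ^+ n, y].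
Proof.
move=> c.
have h : [set z | forall t, [set y] t -> K [~ z, t]] x by move=> _ ->.
exact: (subgroupX n (centralizer_subgroup [set y]) h y erefl).
Qed.

Lemma cong_expgM x y n : K [~ x, y] -> K (((x * y) ^+ n)^-1 * (x ^+ n * y ^+ n)).
Proof.
move=> c; elim: n => [|n IH]; first by rewrite !expg0 !gs; exact: subgroup1.
have e1 : K ((y ^+ n * x)^-1 * (x * y ^+ n)).
  by apply/cong_commute/comm_sym/comm_expgl/comm_sym.
have e2 : K ((x ^+ n * y ^+ n * (x * y))^-1 * (x ^+ n * (x * y ^+ n * y))).
  by have := congKM (cong_refl (x ^+ n) sK) (congKM e1 (cong_refl y sK)); rewrite !mulgA.
have := cong_trans sK (congKM IH (cong_refl (x * y) sK)) e2.
by rewrite !expgSr !mulgA.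
Qed.

Lemma comm_expg x y n : K [~ x, [~ x, y]] -> K (([~ x, y] ^+ n)^-1 * [~ x ^+ n, y]).
Proof.
move=> c; elim: n => [|n IH]; first by rewrite !expg0 comm1g !gs; exact: subgroup1.
have -> : [~ x ^+ n.+1, y] = (x ^+ n)^-1 * [~ x, y] * x ^+ n * [~ x ^+ n, y].
  by rewrite expgS /commg /conjg !gs.
rewrite expgS; apply: (congKM _ IH).
have /comm_sym := comm_expgl n c.
by rewrite {1}/commg /conjg !gs.
Qed.
End Mod.

Hypothesis fg : forall H, subgroup H -> finitely_generated H.

(** Let T j be K times the j-th derived group of S, and take j with T j / K infinite and T j.+1 / K
    finite, so that T j / K is finite-by-abelian. Passing to a centralizer C, to the centre Y of C
    and finally to q-th powers in Y, all modulo K, gives a torsion-free abelian section. Each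
    passage is canonical, so normality in G is preserved, and none makes the section finite. *)
Lemma torsion_free_abelian_section K : subgroup K -> normalizes [set: G] K ->
  (exists S, [/\ subgroup S, normalizes [set: G] S, derived_solvable S & finite_index S [set: G]]) ->
  ~ finite_index K [set: G] ->
  exists A, [/\ subgroup A, normalizes [set: G] A & K `<=` A] /\
    [/\ forall x y, A x -> A y -> K [~ x, y],
       forall x n, A x -> (0 < n)%N -> K (x ^+ n) -> K x & ~ finite_index K A].
Proof.
move=> sK nK [S [sS nS [c hc] fS]] nfK.
pose T j := setmulg K (iter j (@derived G) S).
have sD j : subgroup (iter j (@derived G) S) by exact: iter_derived_subgroup.
have nKD j : normalizes (iter j (@derived G) S) K by exact: normalizes_sub nK.
have sT j : subgroup (T j) by exact: normal_subgroupM.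
have KT j : K `<=` T j.
  by move=> x Kx; exists x, 1; rewrite mulg1; split=> //; exact: subgroup1.
have nT j : normalizes [set: G] (T j).
  move=> g _ _ [x [y [Kx Dy ->]]]; exists (g * x * g^-1), (g * y * g^-1); split.
  - exact: nK.
  - exact: (iter_derived_normal nS).
  - by rewrite !gs.
have TT j : forall x y, T j x -> T j y -> T j.+1 [~ x, y].
  move=> _ _ [a [x [Ka Dx ->]]] [b [y [Kb Dy ->]]].
  have cx z d : K z -> K (d^-1 * (z * d)) by move=> Kz; rewrite mulgA; exact: normJV.
  have h := cong_comm (@subgroupT G) sK nK I I I I (cx a x Ka) (cx b y Kb).
  exists ([~ x, y] * ([~ x, y]^-1 * [~ a * x, b * y]) * [~ x, y]^-1), [~ x, y]; split.
  - exact: nK.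
  - exact: (derived_comm Dx Dy).
  - by rewrite [in RHS]mulgVK mulVKg.
have nf0 : ~ finite_index K (T 0%N).
  move=> f0; apply: nfK; apply: finite_index_trans f0 _ => //.
  apply: finite_indexS fS => // x Sx.
  by exists 1, x; rewrite mul1g; split=> //; exact: subgroup1.
have fc : finite_index K (T c).
  apply: finite_indexS (finite_index_refl sK) => // _ [x [y [Kx /hc -> ->]]].
  by rewrite mulg1.
have [j [nfj fj]] : exists j, ~ finite_index K (T j) /\ finite_index K (T j.+1).
  elim: c fc {hc} => [//|c IH] fc.
  by have [/IH|] := pselect (finite_index K (T c)); last by exists c.
pose B := T j.+1.
(* The centralizer in T j of the finite group B / K has finite index. Modulo K it is nilpotent of
   class 2 with finite commutator subgroup. *)
pose C := T j `&` [set x | forall y, B y -> K [~ x, y]].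
have sC : subgroup C by apply: subgroupI => //; exact: centralizer_subgroup.
have nC : normalizes [set: G] C by apply: normalizesI => //; apply: centralizer_normal => //; exact: nT.
have KC : K `<=` C.
  move=> x Kx; split; first exact: KT.
  move=> y _; rewrite /commg; apply: subgroupM (subgroupV _ _) _ => //.
  by rewrite /conjg mulgA; exact: normJV.
have fC : finite_index C (T j).
  have [s [sB hs]] := finite_index_reps fj.
  have [U [f hf]] := fj.
  exists {ffun 'I_(size s) -> U}, (fun g => [ffun i : 'I_(size s) => f (g * nth 1 s i * g^-1)]).
  move=> x y Tx Ty /ffunP e; split; first exact: (subgroupM (sT j) (subgroupV (sT j) Tx) Ty).
  move=> z Bz; have [t ts Kt] := hs _ Bz.
  have ti : index t s < size s by rewrite index_mem.
  have := e (Ordinal ti); rewrite !ffunE /= nth_index // => {}e.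
  have Bt := sB _ ts.
  have hB g : B (g * t * g^-1) by exact: nT.
  have k1 := hf _ _ (hB x) (hB y) e.
  have cV : subgroup [set u | forall v, [set x^-1 * y] v -> K [~ u, v]] by exact: centralizer_subgroup.
  have h1 : K [~ t, x^-1 * y].
    have cV' : subgroup [set u | forall v, [set t] v -> K [~ u, v]] by exact: centralizer_subgroup.
    apply: comm_sym => //; rewrite -[x^-1 * y]invgK; apply: (subgroupV cV') => // v ->.
    apply: comm_sym => //.
    by have := normJV nK x k1; rewrite /commg /conjg !gs.
  apply: comm_sym => //; rewrite -(mulVKg t z); apply: (subgroupM cV) => // v ->; first exact: h1.
  exact: comm_mem.
have BCK x y : C x -> C y -> K [~ x, [~ x, y]].
  by move=> [Tx cx] [Ty _]; apply: cx; exact: TT.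
pose Y := C `&` [set x | forall y, C y -> K [~ x, y]].
have sY : subgroup Y by apply: subgroupI => //; exact: centralizer_subgroup.
have nY : normalizes [set: G] Y by apply: normalizesI => //; exact: centralizer_normal nC.
have YY x y : Y x -> Y y -> K [~ x, y] by move=> [_ h] [Cy _]; exact: h.
have KY : K `<=` Y.
  move=> x Kx; split; first exact: KC.
  move=> y _; rewrite /commg; apply: subgroupM (subgroupV _ _) _ => //.
  by rewrite /conjg mulgA; exact: normJV.
(* Class 2 gives that [x^m, y] is congruent to [x, y]^m, which lies in K when m is an exponent of B
   / K. So m-th powers are central modulo K. *)
have fY : finite_index Y C.
  have [m m0 hm] := finite_index_expg sK fj (sT _).
  apply: (@finite_index_fg_exponent C Y m) => //; last exact: fg.
  - by move=> x [].
  - move=> x y Cx Cy; split; first exact: subgroup_comm.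
    move=> z [Tz cz]; apply: comm_sym => //; apply: cz.
    by case: Cx => ? _; case: Cy => ? _; exact: TT.
  - move=> x Cx; split; first exact: subgroupX.
    move=> y Cy; apply: (cong_in' sK (comm_expg sK nK m (BCK x y Cx Cy))).
    by apply: hm; case: Cx => ? _; case: Cy => ? _; exact: TT.
have nfY : ~ finite_index K Y.
  move=> f; apply: nfj; apply: (@finite_index_trans _ K C) => //; first by move=> x [].
  by apply: finite_index_trans f fY => // x [].
pose Tor := Y `&` [set x | exists2 n, (0 < n)%N & K (x ^+ n)].
have sTor : subgroup Tor.
  split.
  - by split; [exact: subgroup1|exists 1%N => //; exact: subgroup1].
  - move=> x y [Yx [n n0 Kn]] [Yy [p p0 Kp]]; split; first exact: subgroupM.
    exists (n * p)%N; first by rewrite muln_gt0 n0.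
    apply: (cong_in sK (cong_expgM sK nK (n * p) (YY _ _ Yx Yy))).
    apply: subgroupM => //; first by rewrite expgnA; exact: subgroupX.
    by rewrite mulnC expgnA; exact: subgroupX.
  - move=> x [Yx [n n0 Kn]]; split; first exact: subgroupV.
    by exists n => //; rewrite expVgn; exact: subgroupV.
have [q q0 hq] : exists2 q, (0 < q)%N & forall x, Tor x -> K (x ^+ q).
  have [s [sTs gen]] := fg sTor.
  have [q q0 hs] : exists2 q, (0 < q)%N & forall x, x \in s -> K (x ^+ q).
    elim: s sTs {gen} => [_|x s IH h]; first by exists 1%N.
    have [z zs|q q0 hs] := IH; first by apply: h; rewrite in_cons zs orbT.
    have [_ [n n0 Kn]] := h x (mem_head _ _).
    exists (n * q)%N; first by rewrite muln_gt0 n0.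
    move=> z; rewrite in_cons => /orP [/eqP ->|/hs Kz]; first by rewrite expgnA; exact: subgroupX.
    by rewrite mulnC expgnA; exact: subgroupX.
  exists q => // x Tx; suff [] : (Y `&` [set x | K (x ^+ q)]) x by [].
  apply: gen Tx; last by move=> z zs; split; [by have [] := sTs _ zs|exact: hs].
  split.
  - by split; [exact: subgroup1|rewrite /= expg1n; exact: subgroup1].
  - move=> y z [Yy Ky] [Yz Kz]; split; first exact: subgroupM.
    by apply: (cong_in sK (cong_expgM sK nK q (YY _ _ Yy Yz))); exact: subgroupM.
  - move=> y [Yy Ky]; split; first exact: subgroupV.
    by rewrite /= expVgn; exact: subgroupV.
(* The q-th powers of Y modulo K. If u^q is torsion then so is u, and q kills all torsion of Y / K;
   hence no torsion is left. *)
pose A := Y `&` [set y | exists2 u, Y u & K (y^-1 * u ^+ q)].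
have sA : subgroup A.
  split.
  - by split; [exact: subgroup1|exists 1; rewrite ?expg1n ?mulg1 ?invg1; exact: subgroup1].
  - move=> x y [Yx [u Yu Ku]] [Yy [v Yv Kv]]; split; first exact: subgroupM.
    exists (u * v); first exact: subgroupM.
    apply: cong_trans (congKM sK nK Ku Kv) _ => //.
    by apply: cong_sym => //; apply: cong_expgM => //; exact: YY.
  - move=> x [Yx [u Yu Ku]]; split; first exact: subgroupV.
    by exists u^-1; [exact: subgroupV|rewrite expVgn; exact: (congV (@subgroupT G) sK nK I Ku)].
have KA : K `<=` A.
  move=> x Kx; split; first exact: KY.
  by exists 1; [exact: subgroup1|rewrite expg1n mulg1; exact: subgroupV].
exists A; split; split=> //.
- move=> g x _ [Yx [u Yu Ku]]; split; first exact: nY.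
  exists (g * u * g^-1); first exact: nY.
  have := nK g _ I Ku.
  have -> : (g * u * g^-1) ^+ q = g * u ^+ q * g^-1.
    elim: (q) => [|n IH]; first by rewrite mulg1 mulgV.
    by rewrite !expgS IH !gs.
  by rewrite !gs.
- by move=> x y [Yx _] [Yy _]; exact: YY.
- move=> x n [Yx [u Yu Ku]] n0 Kn; apply: (cong_in sK Ku); apply: hq; split=> //.
  exists (q * n)%N; first by rewrite muln_gt0 q0.
  by rewrite expgnA; apply: (cong_in' sK (congKX sK nK n Ku)).
move=> fA; apply: nfY; apply: (@finite_index_trans _ K A) => //; first by move=> x [].
apply: (@finite_index_fg_exponent Y A q) => //; first by move=> x [].
- by move=> x y Yx Yy; exact/KA/YY.
- move=> x Yx; split; first exact: subgroupX.
  by exists x => //; exact: cong_refl.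
- exact: fg.
Qed.
End AbelianSections.

Section FreeAbelianSections.
Local Open Scope group_scope.
Variable G : groupType.
Variables (K A : set G).
Hypotheses (sK : subgroup K) (nK : normalizes [set: G] K) (sA : subgroup A) (KA : K `<=` A).
Hypothesis abA : forall x y, A x -> A y -> K [~ x, y].

(** A homomorphism from Z^k to A / K, given by representatives in A. *)
Definition lattice_map k (w : 'rV[int]_k -> G) :=
  (forall v, A (w v)) /\ forall u v, K ((w u * w v)^-1 * w (u + v)%R).

Definition lattice_image k (w : 'rV[int]_k -> G) : set G :=
  [set a | A a /\ exists v, K ((w v)^-1 * a)].

Lemma lattice_map0 k (w : 'rV[int]_k -> G) : lattice_map w -> K (w 0%R).
Proof.
move=> [_ h]; have := h 0%R 0%R.
by rewrite addr0 !gs => /(subgroupV sK); rewrite invgK.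
Qed.

Lemma lattice_mapN k (w : 'rV[int]_k -> G) v : lattice_map w -> K ((w v)^-1^-1 * w (- v)%R).
Proof.
move=> hw; have [_ h] := hw; have := h v (- v)%R; rewrite addrN => h1.
have h0 := lattice_map0 hw.
have h2 : K (w v * w (- v)%R) by apply: cong_in sK h1 h0.
by rewrite invgK.
Qed.

Lemma lattice_mapZ k (w : 'rV[int]_k -> G) v (n : int) : lattice_map w ->
  K ((zpow (w v) n)^-1 * w (n *: v)%R).
Proof.
move=> hw; have [_ h] := hw.
have nat_case (p : nat) : K ((zpow (w v) p)^-1 * w (p%:Z *: v)%R).
  elim: p => [|p IH]; first by rewrite scale0r /= expg0 !gs; exact: lattice_map0.
  rewrite -addn1 PoszD zpow_succ scalerDl scale1r.
  exact: cong_trans (congKM sK nK IH (cong_refl _ sK)) (h _ _).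
case: n => p; first exact: nat_case.
rewrite NegzE zpowN scaleNr.
apply: cong_trans (lattice_mapN _ hw) => //.
exact: (congV (@subgroupT G) sK nK I (nat_case p.+1)).
Qed.

Lemma lattice_image_subgroup k (w : 'rV[int]_k -> G) : lattice_map w -> subgroup (lattice_image w).
Proof.
move=> hw; have [_ h] := hw; split.
- split; first exact: subgroup1.
  by exists 0%R; rewrite mulg1; apply: subgroupV => //; exact: lattice_map0.
- move=> x y [Ax [u hu]] [Ay [v hv]]; split; first exact: subgroupM.
  exists (u + v)%R; apply: cong_trans (congKM sK nK hu hv) => //.
  exact: cong_sym (h _ _).
- move=> x [Ax [u hu]]; split; first exact: subgroupV.
  exists (- u)%R; apply: cong_trans (congV (@subgroupT G) sK nK I hu) => //.
  by apply: cong_sym => //; exact: lattice_mapN.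
Qed.

Lemma lattice_map_exists : finitely_generated A ->
  exists k (w : 'rV[int]_k -> G), lattice_map w /\ A `<=` lattice_image w.
Proof.
move=> [s [sA' gen]].
suff [k [w [hw hs]]] : exists k (w : 'rV[int]_k -> G), lattice_map w /\
    forall x, x \in s -> lattice_image w x.
  by exists k, w; split=> //; apply: gen => //; exact: lattice_image_subgroup.
elim: s sA' {gen} => [_|x s IH h].
  exists 0%N, (fun=> 1); split=> //; split=> [v|u v]; first exact: subgroup1.
  by rewrite !gs; exact: subgroup1.
have [z zs|k [w [hw hs]]] := IH; first by apply: h; rewrite in_cons zs orbT.
have Ax : A x by apply: h; exact: mem_head.
have [Aw hw2] := hw.
pose w' (v : 'rV[int]_(1 + k)) := zpow x (v 0%R 0%R) * w (rsubmx v).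
have Aw' v : A (w' v) by apply: subgroupM (Aw _) => //; exact: subgroup_zpow.
have hw' : lattice_map w'.
  split=> // u v; rewrite /w' !linearD /= mxE zpowD.
  set p := zpow x _; set q := zpow x _.
  have Ap : A p by exact: subgroup_zpow.
  have Aq : A q by exact: subgroup_zpow.
  have e1 : K ((w (rsubmx u) * q)^-1 * (q * w (rsubmx u))).
    by apply: cong_commute; exact: abA.
  have e2 := congKM sK nK (cong_refl p sK) (congKM sK nK e1 (hw2 (rsubmx u) (rsubmx v))).
  have e3 : K ((p * w (rsubmx u) * (q * w (rsubmx v)))^-1 *
    (p * (q * (w (rsubmx u) * w (rsubmx v))))).
    have := congKM sK nK (cong_refl p sK) (congKM sK nK e1 (cong_refl (w (rsubmx v)) sK)).
    by rewrite !mulgA.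
  apply: cong_trans e3 _ => //.
  have := congKM sK nK (cong_refl (p * q) sK) (hw2 (rsubmx u) (rsubmx v)).
  by rewrite !mulgA.
exists (1 + k)%N, w'; split=> // z; rewrite in_cons => /orP [/eqP ->|zs].
  split=> //; exists (row_mx (const_mx 1%R) 0%R).
  rewrite /w' row_mxKr.
  have -> : (row_mx (const_mx 1) 0 : 'rV[int]_(1 + k))%R 0%R 0%R = 1%R.
    by rewrite (_ : 0%R = lshift k ord0 :> 'I_(1 + k)); [rewrite row_mxEl mxE | exact: val_inj].
  by rewrite zpow1 !gs; apply: subgroupV => //; exact: lattice_map0.
have [Az [v hv]] := hs _ zs; split=> //; exists (row_mx 0%R v).
rewrite /w' row_mxKr.
have -> : (row_mx 0 v : 'rV[int]_(1 + k))%R 0%R 0%R = 0%R.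
  by rewrite (_ : 0%R = lshift k ord0 :> 'I_(1 + k)); [rewrite row_mxEl mxE | exact: val_inj].
by rewrite /= expg0 mul1g.
Qed.

(** Take a surjection from Z^k onto A / K with k minimal. By the Smith normal form a nonzero kernel
    vector is a multiple c of a member of a basis of Z^k. Without torsion that member is itself in
    the kernel, and dropping its coordinate contradicts minimality. So the surjection is injective,
    and e is its inverse. *)
Lemma free_abelian_section : finitely_generated A ->
  (forall x n, A x -> (0 < n)%N -> K (x ^+ n) -> K x) ->
  exists k (e : G -> 'rV[int]_k),
    [/\ forall x y, A x -> A y -> e (x * y) = (e x + e y)%R,
        forall x, A x -> (e x = 0%R <-> K x) & forall v, exists2 a, A a & e a = v].
Proof.
move=> fgA tf.
pose P k := `[< exists w : 'rV[int]_k -> G, lattice_map w /\ A `<=` lattice_image w >].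
have exP : exists k, P k.
  by have [k [w h]] := lattice_map_exists fgA; exists k; apply/asboolP; exists w.
case: (ex_minnP exP) => k /asboolP [w [hw Aw]] kmin.
have [Aw1 hw2] := hw.
have inj v : K (w v) -> v = 0%R.
  move=> Kv; apply: contrapT => /eqP v0.
  case: k => [|k] in w hw Aw Aw1 hw2 kmin v Kv v0 *; first by rewrite thinmx0 eqxx in v0.
  have [L uL [R' uR [d _ ev]]] := int_Smith_normal_form v.
  pose dl : 'rV[int]_k.+1 := delta_mx 0%R 0%R.
  pose c := (L 0 0 * d`_0)%R.
  have ev' : v = ((c *: dl) *m R')%R.
    rewrite ev; congr (_ *m _)%R; apply/rowP => j; rewrite !mxE big_ord1 !mxE eq_sym /=.
    have -> : (j == 0%R) = (j == 0%N :> nat) by [].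
    by case: (_ == _); rewrite ?mulr1n ?mulr0n ?mulr1 ?mulr0.
  have c0 : c != 0%R by apply: contra_neq v0 => c0; rewrite ev' c0 scale0r mul0mx.
  pose w1 u := w (u *m R')%R.
  have hw1 : lattice_map w1 by split=> [u|u u']; [exact: Aw1|rewrite /w1 mulmxDl; exact: hw2].
  have Kd : K (w1 dl).
    have h1 : K (zpow (w1 dl) c).
      by apply: cong_in sK (lattice_mapZ dl c hw1) _; rewrite /w1 -ev'.
    have Kn n : (0 < n)%N -> K (w1 dl ^+ n) -> K (w1 dl) by apply: tf; case: hw1.
    case: (c) c0 h1 => [[|n]|n] // _; first exact: Kn.
    by move=> /(subgroupV sK); rewrite /= invgK; exact: Kn.
  suff : P k by move=> /kmin; rewrite ltnn.
  apply/asboolP; exists (fun u : 'rV[int]_k => w1 (row_mx (0%R : 'rV_1) u : 'rV_(1 + k))).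
  split.
    split=> [u|u u']; first exact: Aw1.
    have -> : row_mx 0%R (u + u')%R = (row_mx 0 u + row_mx 0 u' : 'rV[int]_(1 + k))%R.
      by rewrite add_row_mx addr0.
    by case: hw1 => _; apply.
  move=> a Aa; split=> //; have [_ [u hu]] := Aw a Aa.
  have uE : u = ((u *m invmx R') *m R')%R by rewrite mulmxKV.
  set t := (u *m invmx R')%R in uE.
  exists (rsubmx (t : 'rV_(1 + k))).
  have tE : t = (t 0 0 *: dl + row_mx (0 : 'rV_1) (rsubmx (t : 'rV_(1 + k))))%R.
    apply/rowP => j; rewrite [RHS]mxE [X in (X + _)%R]mxE [dl _ _]mxE eqxx /=.
    have [[i ->]|[i ->]] : (exists i : 'I_1, j = lshift k i :> 'I_(1 + k)) \/
      (exists i, j = rshift 1 i :> 'I_(1 + k)).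
      by case: (splitP (j : 'I_(1 + k))) => i ij; [left|right]; exists i; exact: val_inj.
      rewrite (row_mxEl (0 : 'rV_1)%R) (ord1 i) [X in (_ + X)%R]mxE addr0.
      by rewrite (_ : lshift k 0%R = 0%R) ?eqxx ?mulr1 //; apply: val_inj.
    by rewrite (row_mxEr (0 : 'rV_1)%R) !mxE mulr0 add0r.
  apply: cong_trans hu => //; rewrite uE -/(w1 t) {2}tE.
  have [_ h] := hw1.
  apply: cong_trans (h _ _) => //.
  have hz := lattice_mapZ dl (t 0 0)%R hw1.
  have Kz : K (w1 (t 0 0 *: dl)%R).
    by apply: cong_in' sK hz _; exact: subgroup_zpow.
  by rewrite mulgA; exact: normJV.
pose e a := xget 0%R [set v | K ((w v)^-1 * a)].
have eP a : A a -> K ((w (e a))^-1 * a).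
  move=> /Aw [_ [v hv]].
  by apply: (@xgetPex _ 0%R [set v | K ((w v)^-1 * a)]); exists v.
have uniq u v : K ((w u)^-1 * w v) -> u = v.
  move=> h; apply/eqP; rewrite -subr_eq0; apply/eqP/inj.
  have h1 := hw2 u (- v)%R.
  apply: cong_in' sK h1 _.
  have h2 := congKM sK nK h (lattice_mapN v hw).
  apply: cong_in sK _ _; last exact: (lattice_map0 hw).
  have h3 := congKM sK nK h (cong_refl (w (- v)%R) sK).
  apply: cong_trans h3 _ => //.
  by have := hw2 v (- v)%R; rewrite subrr.
exists k, e; split.
- move=> x y Ax Ay; apply: uniq.
  apply: cong_trans (eP _ _) _ => //; first exact: subgroupM.
  apply: cong_sym => //.
  have h := congKM sK nK (eP _ Ax) (eP _ Ay).
  by apply: cong_trans h => //; apply: cong_sym => //; exact: hw2.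
- move=> x Ax; split=> [e0|Kx].
    by apply: cong_in' sK (eP _ Ax) _; rewrite e0; exact: lattice_map0.
  by apply: inj; apply: cong_in sK (eP _ Ax) Kx.
- move=> v; exists (w v) => //; apply: uniq; exact: eP.
Qed.
End FreeAbelianSections.

Section Span.
Variable F : fieldType.
Local Open Scope ring_scope.

Lemma span_exists n (S : set 'rV[F]_n) : exists s : seq 'rV[F]_n,
  (forall v, v \in s -> S v) /\ forall v, S v -> exists c : 'I_(size s) -> F,
    v = \sum_i c i *: nth 0 s i.
Proof.
pose B m (f : 'I_m -> 'rV[F]_n) : 'M[F]_(m, n) := \matrix_i f i.
pose P r := `[< exists m (f : 'I_m -> 'rV[F]_n), (forall i, S (f i)) /\ \rank (B m f) = r >].
have exP : exists r, P r.
  exists 0%N; apply/asboolP; exists 0%N, (fun=> 0); split; first by case.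
  by apply/eqP; rewrite -leqn0; exact: rank_leq_row.
have bd r : P r -> (r <= n)%N by move=> /asboolP [m [f [_ <-]]]; exact: rank_leq_col.
case: (ex_maxnP exP bd) => r /asboolP [m [f [fS rf]]] rmax.
exists [seq f i | i <- enum 'I_m]; split; first by move=> v /mapP [i _ ->].
move=> v Sv.
have vB : (v <= B m f)%MS.
  apply: contrapT => nv.
  pose f' (i : 'I_m.+1) := if unlift ord0 i is Some j then f j else v.
  have : P (\rank (B m.+1 f')).
    by apply/asboolP; exists m.+1, f'; split=> // i; rewrite /f'; case: unliftP.
  move=> /rmax; rewrite leqNgt => /negP; apply.
  rewrite -rf; apply: rank_ltmx; rewrite ltmxE; apply/andP; split.
    apply/row_subP => i; rewrite rowK.
    have -> : f i = row (lift ord0 i) (B m.+1 f') by rewrite rowK /f' liftK.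
    exact: row_sub.
  apply/negP => h; apply: nv; apply: submx_trans h.
  have -> : v = row ord0 (B m.+1 f') by rewrite rowK /f' unlift_none.
  exact: row_sub.
have /submxP [D ->] := vB.
have sz : size [seq f i | i <- enum 'I_m] = m by rewrite size_map size_enum_ord.
exists (fun i => D 0 (cast_ord sz i)).
rewrite mulmx_sum_row (reindex (cast_ord sz)) /=; last first.
  by exists (cast_ord (esym sz)) => i _; rewrite ?cast_ordK ?cast_ordKV.
apply: eq_bigr => i _; congr (_ *: _); rewrite rowK.
have im : (i < m)%N by rewrite -[X in (_ < X)%N]sz ltn_ord.
rewrite (nth_map (cast_ord sz i)) ?size_enum_ord //.
by congr f; apply: val_inj; rewrite /= nth_enum_ord.
Qed.

End Span.

(** * Semisimple sections *)

Section LieKolchin.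
Variables (F : closedFieldType) (G : groupType) (k : nat).
Local Open Scope ring_scope.
Implicit Types (H Q Z : set G) (phi : G -> 'M[F]_k).

(* Row vectors are acted on from the right, whence the reversed product. *)
Definition mx_rep H phi := phi 1%g = 1%:M /\
  forall g h, H g -> H h -> phi (g * h)%g = phi h *m phi g.

Lemma mx_rep_sub H H' phi : H' `<=` H -> mx_rep H phi -> mx_rep H' phi.
Proof. by move=> HH [h1 hM]; split=> // g h /HH Hg /HH Hh; exact: hM. Qed.

Lemma mx_repV H phi g : subgroup H -> mx_rep H phi -> H g -> phi g^-1%g = invmx (phi g).
Proof.
move=> sH [h1 hM] Hg.
have e : phi g *m phi g^-1%g = 1%:M by rewrite -hM ?mulVg //; exact: subgroupV.
by have [u _] := mulmx1_unit e; rewrite -[RHS]mulmx1 -e mulKmx.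
Qed.

Lemma mx_rep_unit H phi g : subgroup H -> mx_rep H phi -> H g -> phi g \in unitmx.
Proof.
move=> sH [h1 hM] Hg.
have e : phi g *m phi g^-1%g = 1%:M by rewrite -hM ?mulVg //; exact: subgroupV.
by have [] := mulmx1_unit e.
Qed.

Lemma mx_repJ H phi g x : subgroup H -> mx_rep H phi -> H g -> H x ->
  phi (g^-1 * x * g)%g = phi g *m phi x *m invmx (phi g).
Proof.
move=> sH hr Hg Hx; have [_ hM] := hr.
rewrite hM //; last by apply: subgroupM => //; exact: subgroupV.
by rewrite hM //; [rewrite (mx_repV sH hr Hg) mulmxA|exact: subgroupV].
Qed.

(** Reduces conditions that are linear in [phi y] to finitely many y. The finite-index statements
    below come from this. *)
Lemma mx_span_exists phi H : exists s : seq G, (forall x, x \in s -> H x) /\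
  forall y, H y -> exists c : 'I_(size s) -> F, phi y = \sum_i c i *: phi (nth 1%g s i).
Proof.
have [s [sS hs]] := span_exists [set mxvec (phi y) | y in H].
have [t [tH es]] : exists t, (forall x, x \in t -> H x) /\ s = [seq mxvec (phi y) | y <- t].
  elim: s sS {hs} => [_|v s IH h]; first by exists [::].
  have [u us|t [tH ->]] := IH; first by apply: h; rewrite in_cons us orbT.
  have [y Hy <-] := h v (mem_head _ _).
  exists (y :: t); split=> // x; rewrite in_cons => /orP [/eqP -> //|]; exact: tH.
subst s; exists t; split=> // y Hy.
have [|c] := hs (mxvec (phi y)); first by exists y.
move=> /(congr1 vec_mx); rewrite mxvecK raddf_sum /= => e.
have sz := size_map (fun y => mxvec (phi y)) t.
exists (fun i => c (cast_ord (esym sz) i)); rewrite e (reindex (cast_ord (esym sz))) /=; last first.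
  by exists (cast_ord sz) => i _; rewrite ?cast_ordK ?cast_ordKV.
by apply: eq_bigr => i _; rewrite linearZ /= (nth_map 1%g) // mxvecK.
Qed.

Lemma eigenvalue_exists n (A : 'M[F]_n.+1) : exists a, eigenvalue A a.
Proof.
have /closed_rootP [a ra] : size (char_poly A) != 1%N by rewrite size_char_poly.
by exists a; rewrite eigenvalue_root_char.
Qed.

Lemma roots_exist (p : {poly F}) : p != 0 -> exists s : seq F, forall x, root p x = (x \in s).
Proof.
move=> p0; have [r e] := closed_field_poly_normal p.
exists r => x; rewrite e rootZ ?lead_coef_eq0 //; exact: root_prod_XsubC.
Qed.

(** Irreducibility that survives restriction to finite-index subgroups. It holds on a subspace of
    least dimension among those stable under some finite-index subgroup. *)
Definition strongly_irreducible H phi := forall H', subgroup H' -> H' `<=` H ->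
  finite_index H' H -> forall U : 'M[F]_k, U != 0 ->
  (forall g, H' g -> (U *m phi g <= U)%MS) -> row_full U.

(** Schur's lemma: an eigenspace of A is stable under everything that commutes with A. *)
Lemma strongly_irreducible_scalar H phi (A : 'M[F]_k) H' a : strongly_irreducible H phi ->
  subgroup H' -> H' `<=` H -> finite_index H' H -> eigenvalue A a ->
  (forall g, H' g -> phi g *m A = A *m phi g) -> A = a%:M.
Proof.
move=> si sH HH fi ea hc.
have : row_full (eigenspace A a).
  apply: (si H') => // g Hg; apply/eigenspaceP.
  rewrite -mulmxA hc // mulmxA; have /eigenspaceP -> := submx_refl (eigenspace A a).
  by rewrite -scalemxAl.
rewrite -sub1mx => /eigenspaceP; by rewrite mul1mx => ->; rewrite scalemx1.
Qed.

Lemma common_eigenvector H phi : (0 < k)%N -> subgroup H -> mx_rep H phi ->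
  (forall x y, H x -> H y -> phi x *m phi y = phi y *m phi x) ->
  exists2 v : 'rV[F]_k, v != 0 & forall x, H x -> exists a, v *m phi x = a *: v.
Proof.
move=> k0 sH hr hc.
pose P r := `[< exists U : 'M[F]_k, [/\ U != 0, forall g, H g -> (U *m phi g <= U)%MS & \rank U = r] >].
have exP : exists r, P r.
  exists k; apply/asboolP; exists 1%:M; split; last by rewrite mxrank1.
    by rewrite -mxrank_eq0 mxrank1 -lt0n.
  by move=> g _; rewrite mul1mx submx1.
case: (ex_minnP exP) => r /asboolP [U [U0 Ust rU]] rmin.
have r0 : (0 < r)%N by rewrite -rU lt0n mxrank_eq0.
have key x : H x -> exists a, U *m phi x = a *: U.
  move=> Hx.
  pose W := row_base U.
  have WU : (W :=: U)%MS by exact: eq_row_base.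
  have Wf : row_free W by exact: row_base_free.
  have /submxP [A eA] : (W *m phi x <= W)%MS.
    by rewrite (eqmxMr _ WU) WU; exact: Ust.
  have [a ea] : exists a, eigenvalue A a.
    clear eA; move: A; rewrite rU; clear -r0; case: r r0 => // r _ A; exact: eigenvalue_exists.
  exists a; pose E := (U :&: eigenspace (phi x) a)%MS.
  have E0 : E != 0.
    have /eigenvalueP [v ev v0] := ea.
    apply/negP => /eqP e0; have : (v *m W <= E)%MS.
      rewrite sub_capmx -WU submxMl; apply/eigenspaceP.
      by rewrite -mulmxA eA mulmxA ev -scalemxAl.
    rewrite e0 submx0 => /eqP h; case/eqP: v0; apply: (row_free_inj Wf); by rewrite h mul0mx.
  have /rmin : P (\rank E).
    apply/asboolP; exists E; split=> // g Hg; rewrite sub_capmx; apply/andP; split.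
      apply: submx_trans (Ust g Hg); apply: submxMr; exact: capmxSl.
    apply/eigenspaceP; rewrite -mulmxA hc // mulmxA.
    have /eigenspaceP -> : (E <= eigenspace (phi x) a)%MS by exact: capmxSr.
    by rewrite -scalemxAl.
  rewrite -rU => h.
  have : (U <= E)%MS by rewrite -(geq_leqif (mxrank_leqif_sup (capmxSl _ _))).
  by rewrite sub_capmx => /andP [_ /eigenspaceP].
have [i vi] : exists i, row i U != 0.
  by apply/existsP; apply: contraR U0 => /existsPn h; apply/eqP/row_matrixP => i; rewrite row0; apply/eqP; move: (h i); rewrite negbK.
exists (row i U) => // x /key [a e]; exists a.
by rewrite -row_mul e; apply/rowP => j; rewrite !mxE.
Qed.

(** Clifford's argument. H permutes the weights of Z, and there are finitely many of them because
    their values on a finite spanning list are eigenvalues. The stabiliser of the weight chi thus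
    has finite index and preserves the weight space E, which must be everything. *)
Lemma abelian_normal_scalar H phi Z : (0 < k)%N -> subgroup H -> mx_rep H phi ->
  strongly_irreducible H phi -> subgroup Z -> Z `<=` H -> normalizes H Z ->
  (forall x y, Z x -> Z y -> phi x *m phi y = phi y *m phi x) ->
  forall z, Z z -> is_scalar_mx (phi z).
Proof.
move=> k0 sH hr si sZ ZH nZ hc.
have hrZ := mx_rep_sub ZH hr.
have [v v0 hv] := common_eigenvector k0 sZ hrZ hc.
have [chi chiP] : exists chi : G -> F, forall x, Z x -> v *m phi x = chi x *: v.
  exists (fun x => xget 0 [set a | v *m phi x = a *: v]) => x /hv [a e].
  by apply: (@xgetPex _ 0 [set a | v *m phi x = a *: v]); exists a.
have chiE x a : Z x -> v *m phi x = a *: v -> chi x = a.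
  move=> Zx e; have := chiP x Zx; rewrite e => /eqP; rewrite -subr_eq0 -scalerBl scaler_eq0 (negPf v0) orbF subr_eq0.
  by move=> /eqP.
have zJ g z : H g -> Z z -> Z (g^-1 * z * g)%g by move=> Hg Zz; exact: (normalizesV sH nZ Hg Zz).
have vg g z : H g -> Z z -> v *m phi g *m phi z = chi (g^-1 * z * g)%g *: (v *m phi g).
  move=> Hg Zz; have u := mx_rep_unit sH hr Hg.
  have := chiP _ (zJ g z Hg Zz).
  rewrite (mx_repJ sH hr) //; last exact: ZH.
  move=> /(congr1 (fun w => w *m phi g)); by rewrite -!mulmxA mulVmx // mulmx1 -scalemxAl.
have [s [sZ' hs]] := mx_span_exists phi Z.
pose H' : set G := H `&` [set g | forall z, Z z -> chi (g^-1 * z * g)%g = chi z].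
have chi_span g h : H g -> H h -> (forall z, z \in s -> chi (g^-1 * z * g)%g = chi (h^-1 * z * h)%g) ->
    forall z, Z z -> chi (g^-1 * z * g)%g = chi (h^-1 * z * h)%g.
  move=> Hg Hh e z Zz; have [c ec] := hs z Zz.
  have w0 f : H f -> v *m phi f != 0.
    move=> Hf; have u := mx_rep_unit sH hr Hf.
    by apply: contra_neq v0 => h0; rewrite -(mulmxK u v) h0 mul0mx.
  have ce f : H f -> chi (f^-1 * z * f)%g = \sum_i c i * chi (f^-1 * nth 1%g s i * f)%g.
    move=> Hf; apply/eqP; rewrite -subr_eq0.
    have : (chi (f^-1 * z * f)%g - \sum_i c i * chi (f^-1 * nth 1%g s i * f)%g) *: (v *m phi f) = 0.
      rewrite scalerBl -vg // ec mulmx_sumr scaler_suml -sumrB big1 // => i _.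
      by rewrite -scalemxAr vg // ?scalerA ?subrr //; apply: sZ'; exact: mem_nth.
    by move=> /eqP; rewrite scaler_eq0 (negPf (w0 f Hf)) orbF.
  by rewrite !ce //; apply: eq_bigr => i _; rewrite e //; exact: mem_nth.
have sH' : subgroup H'.
  split.
  - by split=> [|z _]; [exact: subgroup1|rewrite invg1 mul1g mulg1].
  - move=> g h [Hg cg] [Hh ch]; split=> [|z Zz]; first exact: subgroupM.
    rewrite -[RHS](cg z Zz) -[RHS]ch; last exact: zJ.
    by rewrite !gs.
  - move=> g [Hg cg]; split=> [|z Zz]; first exact: subgroupV.
    have Zgz : Z (g^-1^-1 * z * g^-1)%g by apply: zJ => //; exact: subgroupV.
    by rewrite -cg // !gs.
have fH' : finite_index H' H.
  (* The vector v [phi g] has weight z |-> chi (g^-1 z g), so this value at a member of the list s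
     is a root of its characteristic polynomial. The position in the list of roots serves as
     colour. *)
  have rts i : exists r : seq F, forall x, root (char_poly (phi (nth 1%g s i))) x = (x \in r).
    by apply: roots_exist; rewrite -size_poly_eq0 size_char_poly.
  have [r hr'] := choice rts.
  pose N := (\max_(i < size s) size (r i)).+1.
  have idx_lt (i : 'I_(size s)) g : (minn (index (chi (g^-1 * nth 1%g s i * g)%g) (r i)) N.-1 < N)%N.
    by rewrite /N /= ltnS geq_minr.
  exists {ffun 'I_(size s) -> 'I_N}, (fun g => [ffun i => Ordinal (idx_lt i g)]).
  move=> g h Hg Hh /ffunP e; split; first by apply: subgroupM (subgroupV _ _) _.
  have e' : forall z, z \in s -> chi (g^-1 * z * g)%g = chi (h^-1 * z * h)%g.
    move=> z zs; have zi : (index z s < size s)%N by rewrite index_mem.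
    have := e (Ordinal zi); rewrite !ffunE => /(congr1 val) /=.
    rewrite !nth_index //.
    have inr f : H f -> chi (f^-1 * z * f)%g \in r (index z s).
      move=> Hf; rewrite -hr' nth_index // -eigenvalue_root_char; apply/eigenvalueP.
      exists (v *m phi f); first by rewrite vg //; exact: sZ'.
      have u := mx_rep_unit sH hr Hf.
      by apply: contra_neq v0 => h0; rewrite -(mulmxK u v) h0 mul0mx.
    have le f : H f -> (index (chi (f^-1 * z * f)%g) (r (index z s)) <= N.-1)%N.
      move=> /inr; rewrite -index_mem => /ltnW /leq_trans; apply.
      exact: (leq_bigmax (Ordinal zi)).
    rewrite !(minn_idPl (le _ _)) // => /(congr1 (nth 0 (r (index z s)))).
    by rewrite !nth_index //; exact: inr.
  have {}e' := chi_span g h Hg Hh e'.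
  move=> z Zz; have Zg : Z (g * z * g^-1)%g by exact: nZ.
  by have := e' _ Zg; rewrite !gs => ->.
move=> z Zz.
pose E := (\bigcap_(i < size s) eigenspace (phi (nth 1%g s i)) (chi (nth 1%g s i)))%MS.
have EP m (w : 'M[_]_(m, k)) : (w <= E)%MS <-> forall z, Z z -> w *m phi z = chi z *: w.
  split=> [/sub_bigcapmxP h y Zy|h].
    have [c ec] := hs y Zy.
    have -> : chi y = \sum_i c i * chi (nth 1%g s i).
      apply: chiE => //; rewrite ec mulmx_sumr scaler_suml; apply: eq_bigr => i _.
      by rewrite -scalemxAr chiP ?scalerA //; apply: sZ'; exact: mem_nth.
    rewrite ec mulmx_sumr scaler_suml; apply: eq_bigr => i _.
    by have /eigenspaceP e := h i isT; rewrite -scalemxAr e scalerA.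
  by apply/sub_bigcapmxP => i _; apply/eigenspaceP; apply: h; apply: sZ'; exact: mem_nth.
have Ev : (v <= E)%MS by apply/EP.
have : row_full E.
  apply: (si H') => //; first by move=> g [].
    by apply: contra_neq v0 => e0; apply/eqP; rewrite -submx0 -e0.
  move=> g [Hg cg]; apply/EP => y Zy.
  have Zy' := zJ g y Hg Zy.
  have /EP hE := submx_refl E.
  have u := mx_rep_unit sH hr Hg.
  have := hE _ Zy'; rewrite (mx_repJ sH hr) // ?cg //; last exact: ZH.
  move=> /(congr1 (fun w => w *m phi g)); by rewrite -!mulmxA mulVmx // mulmx1 -scalemxAl.
rewrite -sub1mx => /EP /(_ z Zz); rewrite mul1mx => ->.
by rewrite scalemx1 scalar_mx_is_scalar.
Qed.

(** Commutators acting as scalars make Q act through a group of class 2, whose centre Z is scalar by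
    the abelian case. Modulo scalars an element x of Q then has finitely many conjugates under H, so
    [phi x] commutes with a finite-index subgroup and Schur's lemma applies. *)
Lemma class2_normal_scalar H phi Q : (0 < k)%N -> subgroup H -> mx_rep H phi ->
  strongly_irreducible H phi -> subgroup Q -> Q `<=` H -> normalizes H Q ->
  (forall x y, Q x -> Q y -> is_scalar_mx (phi [~ x, y]%g)) ->
  forall x, Q x -> is_scalar_mx (phi x).
Proof.
move=> k0 sH hr si sQ QH nQ hc.
have [phi1 phiM] := hr.
have hrQ := mx_rep_sub QH hr.
have uQ x : Q x -> phi x \in unitmx by exact: mx_rep_unit.
pose c x y := xget 0 [set a | phi [~ x, y]%g = a%:M].
have cP x y : Q x -> Q y -> phi y *m phi x = c x y *: (phi x *m phi y).
  move=> Qx Qy; have /is_scalar_mxP [a ea] := hc x y Qx Qy.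
  have e : phi [~ x, y]%g = (c x y)%:M.
    by apply: (@xgetPex _ 0 [set a | phi [~ x, y]%g = a%:M]); exists a.
  have [_ qM] := hrQ.
  rewrite -qM // commgC qM ?e; [|exact: subgroupM|exact: subgroup_comm].
  by rewrite mul_scalar_mx qM.
(* Determinants: the commutation factors are k-th roots of unity, hence finite in number. *)
have cX x y : Q x -> Q y -> c x y ^+ k = 1.
  move=> Qx Qy; have := congr1 determinant (cP x y Qx Qy).
  rewrite detZ !det_mulmx mulrC => h.
  have u : \det (phi x) * \det (phi y) != 0.
    by rewrite mulf_neq0 // -unitfE -unitmxE uQ.
  by apply: (mulIf u); rewrite mul1r -h.
have [mu muP] : exists s : seq F, forall x, root ('X^k - 1) x = (x \in s).
  by apply: roots_exist; rewrite -size_poly_eq0 size_XnsubC.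
have muX a : a ^+ k = 1 -> a \in mu by move=> e; rewrite -muP rootE !hornerE e subrr.
pose Z : set G := Q `&` [set y | forall x, Q x -> phi y *m phi x = phi x *m phi y].
have sZ : subgroup Z.
  split.
  - by split=> [|x _]; [exact: subgroup1|rewrite phi1 mul1mx mulmx1].
  - move=> y z [Qy cy] [Qz cz]; split=> [|x Qx]; first exact: subgroupM.
    have [_ qM] := hrQ; by rewrite qM // -mulmxA cy // mulmxA cz // mulmxA.
  - move=> y [Qy cy]; split=> [|x Qx]; first exact: subgroupV.
    rewrite (mx_repV sQ hrQ Qy); have u := uQ y Qy.
    by apply: (can_inj (mulmxK u)); rewrite mulmxKV // -mulmxA -cy // mulKmx.
have ZH : Z `<=` H by move=> y [/QH].
have nZ : normalizes H Z.
  move=> g y Hg [Qy cy]; split=> [|x Qx]; first exact: nQ.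
  have Qx' := normalizesV sH nQ Hg Qx.
  have Hg' := subgroupV sH Hg.
  have e : (g * y * g^-1 = g^-1^-1 * y * g^-1)%g by rewrite invgK.
  have e' : (x = g^-1^-1 * (g^-1 * x * g) * g^-1)%g by rewrite !gs.
  rewrite e [in phi x]e' !(mx_repJ sH hr Hg') ?(QH _ Qx') ?(QH _ Qy) //; do ?exact: QH.
  have u := mx_rep_unit sH hr Hg'.
  have PK (A B : 'M[_]_k) : phi g^-1%g *m A *m invmx (phi g^-1%g) *m
      (phi g^-1%g *m B *m invmx (phi g^-1%g)) = phi g^-1%g *m (A *m B) *m invmx (phi g^-1%g).
    by rewrite !mulmxA mulmxKV.
  by rewrite !PK cy.
have Zsc : forall z, Z z -> is_scalar_mx (phi z).
  apply: (abelian_normal_scalar k0 sH hr si sZ ZH nZ) => x y [Qx cx] [Qy _]; exact: cx.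
have [s [sQ' hs]] := mx_span_exists phi Q.
have cZ y z : Q y -> Q z -> (forall x, x \in s -> c x y = c x z) -> Z (y^-1 * z)%g.
  move=> Qy Qz e; split=> [|x Qx]; first exact: subgroupM (subgroupV _ _) _.
  have [_ qM] := hrQ.
  have u := uQ y Qy.
  rewrite qM ?(mx_repV sQ hrQ Qy) //; last exact: subgroupV.
  have [d ->] := hs x Qx; rewrite mulmx_sumr mulmx_suml; apply: eq_bigr => i _.
  have si' : nth 1%g s i \in s by exact: mem_nth.
  have Qi := sQ' _ si'; rewrite -scalemxAr -scalemxAl; congr (_ *: _).
  set p := phi (nth 1%g s i).
  have hy : phi y *m p = c (nth 1%g s i) y *: (p *m phi y) by exact: cP.
  have hz : phi z *m p = c (nth 1%g s i) y *: (p *m phi z) by rewrite e //; exact: cP.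
  have c0 : c (nth 1%g s i) y != 0.
    apply/negP => /eqP c0; have := cX _ _ Qi Qy; rewrite c0 expr0n gtn_eqF // => /eqP.
    by rewrite eq_sym oner_eq0.
  have hi : invmx (phi y) *m p = (c (nth 1%g s i) y)^-1 *: (p *m invmx (phi y)).
    apply: (can_inj (mulKmx u)).
    by rewrite mulmxA mulmxV // mul1mx -scalemxAr mulmxA hy -scalemxAl scalerA mulVf // scale1r mulmxK.
  by rewrite -mulmxA hi -scalemxAr [phi z *m (_ *m _)]mulmxA hz -scalemxAl scalerA mulVf // scale1r mulmxA.
move=> x Qx.
have QJ g : H g -> Q (g * x * g^-1)%g by move=> Hg; exact: nQ.
(* The elements that commute with x up to a scalar in the representation. Conjugates of x with the
   same commutation factors against s differ by an element of Z, a scalar; hence finite index. *)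
pose H1 : set G := H `&` [set g | exists a, phi (g * x * g^-1)%g = a *: phi x].
have JM g h : H g -> H h -> phi (g * h * x * (g * h)^-1)%g = invmx (phi g) *m phi (h * x * h^-1)%g *m phi g.
  move=> Hg Hh; have Hg' := subgroupV sH Hg.
  have -> : (g * h * x * (g * h)^-1 = g^-1^-1 * (h * x * h^-1) * g^-1)%g by rewrite !gs.
  rewrite (mx_repJ sH hr) //; last exact/QH/QJ.
  by rewrite (mx_repV sH hr Hg) invmxK.
have J1 g : H g -> phi (g * x * g^-1)%g = invmx (phi g) *m phi x *m phi g.
  by move=> Hg; have := JM g 1%g Hg (subgroup1 sH); rewrite !mulg1 !mul1g invg1 mulg1.
have H1X g a : H g -> phi (g * x * g^-1)%g = a *: phi x -> a ^+ k = 1.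
  move=> Hg e; have := congr1 determinant e; rewrite detZ J1 // !det_mulmx.
  have u := mx_rep_unit sH hr Hg.
  rewrite det_inv mulrAC mulVf ?mul1r; last by rewrite -unitfE -unitmxE.
  move=> h; have u' : \det (phi x) != 0 by rewrite -unitfE -unitmxE uQ.
  by apply: (mulIf u'); rewrite mul1r -h.
have sH1 : subgroup H1.
  split.
  - by split; [exact: subgroup1|exists 1; rewrite mul1g invg1 mulg1 scale1r].
  - move=> g h [Hg [a ea]] [Hh [b eb]]; split; first exact: subgroupM.
    by exists (b * a); rewrite JM // eb -scalemxAr -scalemxAl -J1 // ea scalerA.
  - move=> g [Hg [a ea]]; split; first exact: subgroupV.
    have a0 : a != 0.
      by apply/negP => /eqP a0; have := H1X g a Hg ea; rewrite a0 expr0n gtn_eqF // => /eqP; rewrite eq_sym oner_eq0.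
    exists a^-1; rewrite J1; last exact: subgroupV.
    rewrite (mx_repV sH hr Hg) invmxK.
    have u := mx_rep_unit sH hr Hg.
    move: ea; rewrite J1 // => /(congr1 (fun A => phi g *m A *m invmx (phi g))).
    rewrite !mulmxA mulmxV // mul1mx mulmxK // -scalemxAr -scalemxAl => {2}->.
    by rewrite scalerA mulVf // scale1r.
have fH1 : finite_index H1 H.
  have lt i g : (index (c (nth 1%g s i) (g * x * g^-1)%g) mu < (size mu).+1)%N by rewrite ltnS index_size.
  exists {ffun 'I_(size s) -> 'I_(size mu).+1}, (fun g => [ffun i : 'I_(size s) => Ordinal (lt i g)]).
  move=> g h Hg Hh /ffunP e; split; first by apply: subgroupM (subgroupV _ _) _.
  have : Z ((g * x * g^-1)^-1 * (h * x * h^-1))%g.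
    apply: cZ; [exact: QJ|exact: QJ|] => y ys.
    have yi : (index y s < size s)%N by rewrite index_mem.
    have := e (Ordinal yi); rewrite !ffunE => /(congr1 val) /=; rewrite nth_index //.
    move=> /(congr1 (nth 0 mu)); rewrite !nth_index //; apply: muX; apply: cX; do ?exact: sQ'; exact: QJ.
  move=> /Zsc /is_scalar_mxP [a ea].
  exists a; rewrite JM //; last exact: subgroupV.
  have [_ qM] := hrQ.
  have -> : (h * x * h^-1 = (g * x * g^-1) * ((g * x * g^-1)^-1 * (h * x * h^-1)))%g by rewrite mulVKg.
  rewrite qM; [|exact: QJ|exact: (subgroupM sQ (subgroupV sQ (QJ g Hg)) (QJ h Hh))].
  rewrite ea mul_scalar_mx -scalemxAr -scalemxAl; congr (_ *: _).
  rewrite J1 // (mx_repV sH hr Hg) invmxK.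
  have u := mx_rep_unit sH hr Hg.
  by rewrite !mulmxA mulmxV // mul1mx mulmxK.
(* Again by determinants the scalars occurring in H1 are k-th roots of unity, so requiring the
   scalar 1 loses only finite index. *)
pose H' : set G := H `&` [set g | phi (g * x * g^-1)%g = phi x].
have sH' : subgroup H'.
  split.
  - by split; [exact: subgroup1|rewrite /= mul1g invg1 mulg1].
  - move=> g h [Hg ea] [Hh eb]; split; first exact: subgroupM.
    by rewrite /= JM // eb -J1.
  - move=> g [Hg ea]; split; first exact: subgroupV.
    rewrite /= J1; last exact: subgroupV.
    rewrite (mx_repV sH hr Hg) invmxK.
    have u := mx_rep_unit sH hr Hg.
    by rewrite -{1}ea J1 // !mulmxA mulmxV // mul1mx mulmxK.
have fH' : finite_index H' H.
  apply: (@finite_index_trans _ _ H1) => //; first by move=> g [].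
  pose a g := xget 0 [set a | phi (g * x * g^-1)%g = a *: phi x].
  have aP g : H1 g -> phi (g * x * g^-1)%g = a g *: phi x.
    by move=> [_ h]; exact: (@xgetPex _ 0 [set a | phi (g * x * g^-1)%g = a *: phi x]).
  have lt g : (index (a g) mu < (size mu).+1)%N by rewrite ltnS index_size.
  exists 'I_(size mu).+1, (fun g => Ordinal (lt g)) => g h H1g H1h /(congr1 val) /=.
  have [[Hg _] [Hh _]] := (H1g, H1h).
  move=> /(congr1 (nth 0 mu)); rewrite !nth_index; [|exact: muX (H1X _ _ Hh (aP _ H1h))|exact: muX (H1X _ _ Hg (aP _ H1g))].
  move=> e; split; first by apply: subgroupM (subgroupV _ _) _.
  rewrite /= JM //; last exact: subgroupV.
  rewrite (aP h) // -e -aP // J1 // (mx_repV sH hr Hg) invmxK.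
  have u := mx_rep_unit sH hr Hg.
  by rewrite !mulmxA mulmxV // mul1mx mulmxK.
have [a ea] : exists a, eigenvalue (phi x) a.
  move: (phi x); clear -k0; case: k k0 => // n _ A; exact: eigenvalue_exists.
rewrite (strongly_irreducible_scalar si sH' _ fH' ea) ?scalar_mx_is_scalar //; first by move=> g [].
move=> g [Hg /=]; rewrite J1 // => e.
have u := mx_rep_unit sH hr Hg.
by rewrite -{1}e !mulmxA mulmxV // mul1mx.
Qed.
End LieKolchin.

Section LieKolchinTheorem.
Variables (F : closedFieldType) (G : groupType) (k : nat).
Local Open Scope ring_scope.

(** Among all nonzero subspaces stable under some finite-index subgroup, one of least dimension
    carries a strongly irreducible representation. Climbing the derived series of S from its trivial
    end, each term acts on it by scalars, since its commutators already do. Any vector of the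
    subspace is then an eigenvector. *)
Theorem lie_kolchin (S : set G) (phi : G -> 'M[F]_k) : (0 < k)%N ->
  subgroup S -> normalizes [set: G] S -> derived_solvable S -> finite_index S [set: G] ->
  mx_rep [set: G] phi ->
  exists H, [/\ subgroup H, normalizes [set: G] H & finite_index H [set: G]] /\
    exists2 v : 'rV[F]_k, v != 0 & forall g, H g -> exists a, v *m phi g = a *: v.
Proof.
move=> k0 sS nS [c hc] fS hr.
pose P r := `[< exists H, [/\ subgroup H, finite_index H [set: G] &
  exists U : 'M[F]_k, [/\ U != 0, forall g, H g -> (U *m phi g <= U)%MS & \rank U = r]] >].
have exP : exists r, P r.
  exists k; apply/asboolP; exists [set: G]; split=> //; first exact: finite_index_refl.
  exists 1%:M; split; last by rewrite mxrank1.
    by rewrite -mxrank_eq0 mxrank1 -lt0n.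
  by move=> g _; rewrite mul1mx submx1.
case: (ex_minnP exP) => r /asboolP [H [sH fH [U [U0 Ust rU]]]] rmin.
have r0 : (0 < r)%N by rewrite -rU lt0n mxrank_eq0.
pose W := row_base U.
have WU : (W :=: U)%MS by exact: eq_row_base.
have Wf : row_free W by exact: row_base_free.
have st g : H g -> (W *m phi g <= W)%MS by move=> Hg; rewrite (eqmxMr _ WU) WU; exact: Ust.
pose psi g := W *m phi g *m pinvmx W.
have psiP g : H g -> psi g *m W = W *m phi g by move=> Hg; rewrite mulmxKpV // st.
have [phi1 phiM] := hr.
have hr' : mx_rep H psi.
  split; first by rewrite /psi phi1 mulmx1 mulmxVp.
  move=> g h Hg Hh; apply: (row_free_inj Wf).
  rewrite psiP; last exact: subgroupM.
  by rewrite phiM // mulmxA -psiP // -[LHS]mulmxA -psiP // mulmxA.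
have si : strongly_irreducible H psi.
  move=> H' sH' HH fH' V V0 hV.
  pose E := V *m W; pose E' := <<E>>%MS.
  have rE : \rank E = \rank V by rewrite mxrankMfree.
  have /rmin : P (\rank E').
    apply/asboolP; exists H'; split=> //.
      by apply: finite_index_trans fH' fH => //.
    exists E'; split=> //.
      by rewrite -mxrank_eq0 mxrank_gen rE mxrank_eq0.
    move=> g Hg; rewrite (eqmxMr _ (genmxE E)) genmxE /E -mulmxA -(psiP _ (HH _ Hg)) mulmxA.
    by apply: (submxMr W (hV g Hg)).
  rewrite mxrank_gen rE /row_full => h.
  by rewrite eqn_leq rank_leq_row (leq_trans _ h) // -rU.
have rU0 : (0 < \rank U)%N by rewrite rU.
have scal j : (j <= c)%N -> forall x, H x -> iter (c - j) (@derived G) S x -> is_scalar_mx (psi x).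
  elim: j => [_ x Hx|j IH jc x Hx].
    by rewrite subn0 => /hc ->; case: hr' => -> _; exact: scalar_mx_is_scalar.
  move=> Sx; pose Q := H `&` iter (c - j.+1) (@derived G) S.
  have sD : subgroup (iter (c - j.+1) (@derived G) S) by exact: iter_derived_subgroup.
  have nD : normalizes [set: G] (iter (c - j.+1) (@derived G) S) by exact: iter_derived_normal.
  apply: (class2_normal_scalar rU0 sH hr' si (Q := Q)) => //.
  - exact: subgroupI.
  - by move=> y [].
  - move=> g y Hg [Hy Sy]; split; last exact: nD.
    by apply: (subgroupM sH (subgroupM sH Hg Hy) (subgroupV sH Hg)).
  - move=> y z [Hy Sy] [Hz Sz]; apply: IH; [exact: ltnW|exact: subgroup_comm|].
    have -> : (c - j = (c - j.+1).+1)%N by lia.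
    exact: derived_comm.
have sSH : subgroup (S `&` H) by exact: subgroupI.
have fSH : finite_index (S `&` H) [set: G] by exact: finite_indexI.
have [C [sC CS nC fC]] := finite_index_core sSH (@subgroupT G) (@subsetT _ _) fSH.
exists C; split=> //; exists (row (Ordinal rU0) W).
  apply: contraTneq isT => w0.
  have := row_free_inj Wf (x1 := delta_mx 0 (Ordinal rU0) : 'rV_(\rank U)) (x2 := 0).
  rewrite mul0mx -rowE => /(_ w0) /rowP /(_ (Ordinal rU0)); rewrite !mxE !eqxx => /eqP.
  by rewrite oner_eq0.
move=> g /CS [Sg Hg].
have /is_scalar_mxP [a ea] : is_scalar_mx (psi g).
  by apply: (scal c) => //; rewrite subnn.
by exists a; rewrite -row_mul -psiP // ea mul_scalar_mx; apply/rowP => i; rewrite !mxE.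
Qed.
End LieKolchinTheorem.

Section SeparablePart.
Local Open Scope ring_scope.

(** The squarefree part: in characteristic 0 it keeps the roots, and the formula p / gcd(p, p')
    commutes with field extensions. So it is rational when p is. *)
Definition separable_part (F : fieldType) (p : {poly F}) := p %/ gcdp p p^`().

(** If a were lost, the full power of X - a dividing p would divide the gcd and thus p', whereas
    differentiation lowers the multiplicity by exactly one. *)
Lemma root_separable_part (F : numFieldType) (p : {poly F}) a : p != 0 -> root p a ->
  root (separable_part p) a.
Proof.
move=> p0 ra; apply/negP => /negP nr.
have [n [q nq e]] := multiplicity_XsubC p a.
rewrite p0 /= in nq.
case: n e => [|n] e; first by move: ra; rewrite e mulr1 (negPf nq).
pose g := gcdp p p^`().
have pg : p = separable_part p * g by rewrite divpK // dvdp_gcdl.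
have cop : coprimep (('X - a%:P) ^+ n.+1) (separable_part p).
  by apply: coprimep_expl; rewrite coprimep_sym coprimep_XsubC.
have d1 : ('X - a%:P) ^+ n.+1 %| p^`().
  apply: dvdp_trans (dvdp_gcdr p p^`()).
  by rewrite -(Gauss_dvdpr _ cop) -pg e dvdp_mulIr.
move: d1; rewrite e derivM deriv_exp derivXsubC mul1r dvdp_addr ?dvdp_mulIr //.
rewrite /= mulrnAr -scaler_nat dvdpZr ?pnatr_eq0 // exprS.
rewrite dvdp_mul2r ?expf_neq0 ?polyXsubC_eq0 // dvdp_XsubCl.
by rewrite (negPf nq).
Qed.

Lemma map_separable_part (F F' : fieldType) (f : {rmorphism F -> F'}) (p : {poly F}) :
  map_poly f (separable_part p) = separable_part (map_poly f p).
Proof. by rewrite /separable_part map_divp gcdp_map deriv_map. Qed.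

Lemma integer_multiple n (u : 'rV[rat]_n) : exists (N : int) (w : 'rV[int]_n),
  N != 0 /\ map_mx intr w = N%:~R *: u.
Proof.
pose N := \prod_j denq (u 0 j).
have N0 : N != 0 by apply/prodf_neq0 => j _; exact: denq_neq0.
exists N, (\row_j (numq (u 0 j) * \prod_(l | l != j) denq (u 0 l))); split=> //.
have dn (x : rat) : (denq x)%:~R * x = (numq x)%:~R.
  by rewrite -{2}[x]divq_num_den mulrC divfK // intr_eq0 denq_neq0.
apply/rowP => j; rewrite !mxE.
have -> : N = denq (u 0 j) * \prod_(l | l != j) denq (u 0 l) by rewrite /N (bigD1 j).
by rewrite !intrM mulrAC dn.
Qed.
End SeparablePart.

Section AdditiveMatrix.
Local Open Scope ring_scope.

Lemma additive_matrix k m (f : 'rV[int]_k -> 'rV[int]_m) :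
  (forall u v, f (u + v) = f u + f v) -> exists B, forall v, f v = v *m B.
Proof.
move=> fD.
have f0 : f 0 = 0 by apply: (addrI (f 0)); rewrite -fD !addr0.
have fN u : f (- u) = - f u by apply: (addrI (f u)); rewrite -fD !addrN.
have fZ (n : int) u : f (n *: u) = n *: f u.
  have e (p : nat) : f (p%:Z *: u) = p%:Z *: f u.
    elim: p => [|p IH]; first by rewrite !scale0r.
    by rewrite intS !scalerDl !scale1r fD IH.
  by case: n => p; rewrite ?NegzE ?scaleNr ?fN e.
exists (\matrix_i f (delta_mx 0 i)) => v.
rewrite mulmx_sum_row {1}(row_sum_delta v).
under [RHS]eq_bigr => i _ do rewrite rowK -fZ.
elim/big_ind2: _ => // x1 x2 y1 y2 <- <-; exact: fD.
Qed.

Variable G : groupType.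
Implicit Types K A : set G.

Definition hom_on A m (h : G -> 'rV[int]_m) := forall x y, A x -> A y -> h (x * y)%g = h x + h y.

Lemma hom_on1 A m (h : G -> 'rV[int]_m) : subgroup A -> hom_on A h -> h 1%g = 0.
Proof.
move=> sA hh; apply: (addrI (h 1%g)); rewrite -hh ?mulg1 ?addr0 //; exact: subgroup1.
Qed.

Lemma hom_onV A m (h : G -> 'rV[int]_m) x : subgroup A -> hom_on A h -> A x -> h x^-1%g = - h x.
Proof.
move=> sA hh Ax; apply: (addrI (h x)).
by rewrite -hh ?mulgV ?addrN ?(hom_on1 sA hh) //; exact: subgroupV.
Qed.

Lemma hom_on_factor A k m (e : G -> 'rV[int]_k) (h : G -> 'rV[int]_m) : subgroup A ->
  hom_on A e -> hom_on A h -> (forall v, exists2 a, A a & e a = v) ->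
  (forall x, A x -> e x = 0 -> h x = 0) -> exists B, forall x, A x -> h x = e x *m B.
Proof.
move=> sA he hh sur ker.
have key x y : A x -> A y -> e x = e y -> h x = h y.
  move=> Ax Ay exy; have Ay' := subgroupV sA Ay.
  apply/eqP; rewrite -subr_eq0 -(hom_onV sA hh Ay) -hh //; apply/eqP/ker.
    exact: subgroupM.
  by rewrite he // (hom_onV sA he Ay) exy subrr.
have /choice [w wP] : forall v, exists a, A a /\ e a = v.
  by move=> v; have [a Aa ea] := sur v; exists a.
have [B hB] : exists B, forall v, h (w v) = v *m B.
  apply: (@additive_matrix _ _ (fun v => h (w v))) => u v.
  have [[Au eu] [Av ev]] := (wP u, wP v); have [Auv euv] := wP (u + v).
  rewrite -hh //; apply: key => //; first exact: subgroupM.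
  by rewrite he // eu ev.
exists B => x Ax; rewrite -hB; have [Aw ew] := wP (e x).
exact: key.
Qed.
End AdditiveMatrix.

Section Tower.
Local Open Scope ring_scope.
Variables (F : numClosedFieldType) (G : groupType).
Implicit Types K A D : set G.
Hypothesis fg : forall H : set G, subgroup H -> finitely_generated H.
Hypothesis vsol : exists S : set G, [/\ subgroup S, normalizes [set: G] S, derived_solvable S & finite_index S [set: G]].

Local Notation toF := (map_mx (intr : int -> F)).

(** The conditions on [phi] are imposed on the vectors [e x] only, since [e] need not be onto: A
    will be a proper sublattice of the section for which [e] was built. *)
Definition semisimple_section K A D := exists k (e : G -> 'rV[int]_k.+1) (phi : G -> 'M[int]_k.+1),
  [/\ hom_on A e, forall x, A x -> (e x = 0 <-> K x) &
      forall g x, A x -> e (g * x * g^-1)%g = e x *m phi g] /\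
  (forall g h x, D g -> D h -> A x -> e x *m (phi g *m phi h) = e x *m (phi h *m phi g)) /\
      (forall g, D g -> exists p : {poly F}, separable_poly p /\
        forall x, A x -> toF (e x) *m horner_mx (toF (phi g)) p = 0).

(** The rational columns r with v r = 0 form a proper subspace because v is nonzero, so some nonzero
    rational u is orthogonal to all of them. It satisfies every rational linear relation satisfied
    by v. *)
Lemma rat_orthogonal k (v : 'rV[F]_k) : v != 0 -> exists u : 'rV[int]_k, u != 0 /\
  forall m (X : 'M[rat]_(k, m)), v *m map_mx ratr X = 0 -> map_mx intr u *m X = 0.
Proof.
move=> v0.
pose S := [set r : 'rV[rat]_k | v *m map_mx ratr r^T = 0].
have [s [sS hs]] := span_exists S.
pose B : 'M[rat]_(size s, k) := \matrix_(i < size s) nth 0 s i.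
have SB r : (r <= B)%MS -> S r.
  move=> /submxP [D ->]; rewrite /S /= trmx_mul map_mxM mulmxA.
  suff -> : v *m map_mx ratr B^T = 0 by rewrite mul0mx.
  apply/rowP => i; have Si : S (nth 0 s i) by apply: sS; exact: mem_nth.
  have := congr1 (fun w : 'M[_]_1 => w 0 0) Si; rewrite !mxE => e; rewrite -[RHS]e.
  by apply: eq_bigr => j _; rewrite !mxE.
have nfB : ~~ row_full B.
  apply/negP => fB; case/eqP: v0; apply/rowP => i.
  have Si := SB (delta_mx 0 i) (submx_full _ fB).
  have := congr1 (fun w : 'M[_]_1 => w 0 0) Si; rewrite !mxE (bigD1 i) //= big1 => [|j ji].
    by rewrite !mxE !eqxx rmorph1 mulr1 addr0.
  by rewrite !mxE (negPf ji) /= rmorph0 mulr0.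
have /rowV0Pn [u /sub_kermxP uB u0] : kermx B^T != 0.
  by rewrite kermx_eq0 /row_free mxrank_tr.
have [N [w [N0 eN]]] := integer_multiple u.
have N0' : (N%:~R : rat) != 0 by rewrite intr_eq0.
exists w; split.
  apply: contra_neq u0 => w0; move: eN; rewrite w0 map_mx0 => /esym/eqP.
  by rewrite scaler_eq0 (negPf N0') => /eqP.
move=> m X hX; rewrite eN -scalemxAl.
suff -> : u *m X = 0 by rewrite scaler0.
apply/rowP => j; rewrite mxE.
have SX : S (col j X)^T.
  by rewrite /S /= trmxK map_col !colE mulmxA hX mul0mx.
have [c ec] := hs _ SX.
have -> : \sum_i u 0 i * X i j = (u *m ((col j X)^T)^T) 0 0.
  by rewrite mxE; apply: eq_bigr => i _; rewrite !mxE.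
rewrite ec raddf_sum mulmx_sumr summxE mxE big1 // => i _.
rewrite /= linearZ /= -scalemxAr mxE.
suff -> : (u *m (nth 0 s i)^T) 0 0 = (u *m B^T) 0 i by rewrite uB mxE mulr0.
by rewrite !mxE; apply: eq_bigr => l _; rewrite !mxE.
Qed.

(** On a common eigenvector v of a finite-index D, the matrices of D commute and are killed by the
    squarefree parts of their minimal polynomials. These relations are rational, hence hold for some
    nonzero integer vector, so the elements of the section satisfying them go beyond K. *)
Lemma semisimple_section_exists K : subgroup K -> normalizes [set: G] K ->
  ~ finite_index K [set: G] ->
  exists A, [/\ subgroup A, normalizes [set: G] A, K `<=` A & ~ (A `<=` K)] /\
    exists D, [/\ subgroup D, finite_index D [set: G] & semisimple_section K A D].
Proof.
move=> sK nK nfK.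
have [A0 [[sA nA KA] [abA tfA nfA]]] := torsion_free_abelian_section fg sK nK vsol nfK.
have [k [e [eM eK esur]]] := free_abelian_section sK nK sA abA (fg sA) tfA.
case: k => [|k] in e eM eK esur.
  case: nfA; apply: finite_indexS (finite_index_refl sA) => // x Ax.
  by apply/eK => //; rewrite thinmx0.
have /choice [phi phiP] : forall g, exists B : 'M[int]_k.+1,
    forall x, A0 x -> e (g * x * g^-1)%g = e x *m B.
  move=> g; apply: (hom_on_factor sA eM _ esur) => [x y Ax Ay|x Ax ex].
    by rewrite -eM; [congr e; rewrite !gs|exact: nA|exact: nA].
  by apply/eK; [exact: nA|apply: nK => //; apply/eK].
have phi_ext (B C : 'M[int]_k.+1) : (forall x, A0 x -> e x *m B = e x *m C) -> B = C.
  move=> h; apply/row_matrixP => i; rewrite !rowE.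
  by have [a Aa <-] := esur (delta_mx 0 i); exact: h.
have phi1 : phi 1%g = 1%:M.
  by apply: phi_ext => x Ax; rewrite -phiP // mulmx1 !gs.
have phiM g h : phi (g * h)%g = phi h *m phi g.
  apply: phi_ext => x Ax; rewrite -phiP // mulmxA -phiP // -phiP; last exact: nA.
  by congr e; rewrite !gs.
pose ph g := toF (phi g).
have hr : mx_rep [set: G] ph.
  by split=> [|g h _ _]; rewrite /ph ?phi1 ?map_mx1 // phiM map_mxM.
have [S [sS nS slS fS]] := vsol.
have [D [[sD nD fD] [v v0 hv]]] := lie_kolchin (ltn0Sn k) sS nS slS fS hr.
pose sp g := separable_part (mxminpoly (ph g)).
(* The sublattice cut out by all these relations. Conjugation by g permutes the relations because D
   is normal. *)
pose A : set G := A0 `&` [set x | (forall g h, D g -> D h ->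
    e x *m (phi g *m phi h) = e x *m (phi h *m phi g)) /\
  forall g, D g -> toF (e x) *m horner_mx (ph g) (sp g) = 0].
exists A.
have sA' : subgroup A.
  split.
  - split; first exact: subgroup1.
    by rewrite /= (hom_on1 sA eM) map_mx0; split=> *; rewrite !mul0mx.
  - move=> x y [Ax [cx px]] [Ay [cy py]]; split; first exact: subgroupM.
    rewrite /= eM //; split=> [g h Dg Dh|g Dg]; first by rewrite !mulmxDl cx // cy.
    by rewrite map_mxD mulmxDl px // py // addr0.
  - move=> x [Ax [cx px]]; split; first exact: subgroupV.
    rewrite /= (hom_onV sA eM Ax); split=> [g h Dg Dh|g Dg]; first by rewrite !mulNmx cx.
    by rewrite map_mxN mulNmx px // oppr0.
split; first split=> //.
- move=> g x _ [Ax [cx px]]; split; first exact: nA.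
  rewrite /= phiP //.
  have Dg h : D h -> D (g^-1 * h * g)%g by move=> Dh; exact: (normalizesV (@subgroupT G) nD).
  have pc h : phi g *m phi h = phi (g^-1 * h * g)%g *m phi g by rewrite -!phiM !gs.
  split=> [h1 h2 Dh1 Dh2|h Dh].
    have pc2 f1 f2 : phi g *m (phi f1 *m phi f2) =
        phi (g^-1 * f1 * g)%g *m phi (g^-1 * f2 * g)%g *m phi g.
      by rewrite mulmxA pc -mulmxA pc mulmxA.
    have h := congr1 (fun w => w *m phi g) (cx _ _ (Dg _ Dh1) (Dg _ Dh2)).
    by rewrite /= -!(mulmxA (e x)) in h; rewrite -!(mulmxA (e x)) !pc2.
  have Dh' := Dg _ Dh.
  have u : ph g \in unitmx by exact: (mx_rep_unit (@subgroupT G) hr).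
  have ej : ph (g^-1 * h * g)%g = ph g *m ph h *m invmx (ph g).
    exact: (mx_repJ (@subgroupT G) hr).
  have em : sp (g^-1 * h * g)%g = sp h.
    by congr separable_part; rewrite ej -(conjumx _ u) mxminpoly_uconj.
  have eh : horner_mx (ph (g^-1 * h * g)%g) (sp h) =
      ph g *m horner_mx (ph h) (sp h) *m invmx (ph g).
    by rewrite ej; exact: horner_mx_uconj.
  have := px _ Dh'; rewrite em eh; move: (horner_mx _ _) => M hM.
  have -> : toF (e x *m phi g) = toF (e x) *m ph g by rewrite map_mxM.
  by rewrite -mulmxA -[ph g *m M](mulmxKV u) mulmxA hM mul0mx.
- move=> x Kx; split; first exact: KA.
  have ex0 : e x = 0 by apply/eK => //; exact: KA.
  by rewrite /= ex0 map_mx0; split=> *; rewrite !mul0mx.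
- have [u [u0 hu]] := rat_orthogonal v0.
  have [a Aa ea] := esur u.
  move=> AK; case/eqP: u0; rewrite -ea; apply/eK => //; apply: AK; split=> //=.
  have iQ (M : 'M[int]_k.+1) : map_mx (ratr : rat -> F) (map_mx intr M) = toF M.
    by apply/matrixP => i j; rewrite !mxE ratr_int.
  have iQ0 (w : 'rV[int]_k.+1) : map_mx (intr : int -> rat) w = 0 -> w = 0.
    by move=> /rowP h; apply/rowP => i; have := h i; rewrite !mxE => /eqP; rewrite intr_eq0 => /eqP.
  rewrite ea; split=> [g h Dg Dh|g Dg].
    apply/eqP; rewrite -subr_eq0 -mulmxBr; apply/eqP; apply: iQ0.
    rewrite map_mxM; apply: hu; rewrite iQ !map_mxB !map_mxM mulmxBr !mulmxA.
    have [[x hx] [y hy]] := (hv _ Dg, hv _ Dh).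
    by rewrite -/(ph g) -/(ph h) hx -scalemxAl hy -scalemxAl hx !scalerA mulrC subrr.
  have [x hx] := hv _ Dg.
  pose pQ : 'M[rat]_k.+1 := map_mx intr (phi g).
  have e1 : sp g = map_poly ratr (separable_part (mxminpoly pQ)).
    by rewrite map_separable_part -mxminpoly_map iQ.
  have e2 : horner_mx (ph g) (sp g) = map_mx ratr (horner_mx pQ (separable_part (mxminpoly pQ))).
    by rewrite e1 map_horner_mx iQ.
  have iQ' (w : 'rV[int]_k.+1) : map_mx (ratr : rat -> F) (map_mx intr w) = toF w.
    by apply/matrixP => i j; rewrite !mxE ratr_int.
  rewrite e2 -iQ' -map_mxM hu ?map_mx0 // -e2.
  have hp (p : {poly F}) : v *m horner_mx (ph g) p = p.[x] *: v.
    elim/poly_ind: p => [|p c IH]; first by rewrite rmorph0 mulmx0 horner0 scale0r.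
    rewrite rmorphD rmorphM /= horner_mx_X horner_mx_C mulmxDr mulmxA IH -scalemxAl hx.
    by rewrite mul_mx_scalar scalerA hornerMXaddC scalerDl.
  rewrite hp (rootP _) ?scale0r //; apply: root_separable_part.
    by rewrite monic_neq0 // mxminpoly_monic.
  by rewrite root_mxminpoly -eigenvalue_root_char; apply/eigenvalueP; exists v.
exists D; split=> //; exists k, e, phi; split; first by split=> [x y [Ax _] [Ay _]|x [Ax _]|g x [Ax _]]; [exact: eM|exact: eK|exact: phiP].
split=> // [g h x Dg Dh [_ [cx _]]|g Dg]; first exact: cx.
exists (sp g); split; last by move=> x [_ [_ px]]; exact: px.
by apply: make_separable; rewrite monic_neq0 // mxminpoly_monic.
Qed.

Lemma semisimple_sectionS K A D D' : D' `<=` D -> semisimple_section K A D -> semisimple_section K A D'.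
Proof.
move=> DD [k [e [phi [h1 [hc hp]]]]]; exists k, e, phi; split=> //; split=> [g h x /DD Dg /DD Dh|g /DD Dg].
  exact: hc.
exact: hp.
Qed.

(* Each step is a free abelian section K / K' on which Delta acts by simultaneously diagonalizable matrices. *)
Inductive tower Delta : set G -> Prop :=
| tower_top : tower Delta Delta
| tower_step K K' k (e : G -> 'rV[int]_k) (phi : G -> 'M[int]_k) (P : 'M[F]_k) :
    tower Delta K -> subgroup K' -> normalizes [set: G] K' -> K' `<=` K ->
    hom_on K e -> (forall x, K x -> (e x = 0 <-> K' x)) -> (forall v, exists2 a, K a & e a = v) ->
    (forall g x, K x -> e (g * x * g^-1)%g = e x *m phi g) ->
    P \in unitmx -> (forall d, Delta d -> is_diag_mx (P *m toF (phi d) *m invmx P)) ->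
    tower Delta K'.

Lemma separable_diagonalizable k (M : 'M[F]_k.+1) (p : {poly F}) : separable_poly p ->
  horner_mx M p = 0 -> diagonalizable M.
Proof.
move=> sp hp; have [r e] := closed_field_poly_normal p.
have p0 : p != 0 by exact: separable_poly_neq0.
apply/diagonalizableP; exists r.
  rewrite -separable_prod_XsubC; apply: dvdp_separable sp.
  by rewrite {1}e dvdpZr // lead_coef_eq0.
by have := mxminpoly_min hp; rewrite {1}e dvdpZr // lead_coef_eq0.
Qed.

Lemma codiagonalizable_set k (D : set G) (f : G -> 'M[F]_k) :
  (forall g h, D g -> D h -> f g *m f h = f h *m f g) ->
  (forall g, D g -> diagonalizable (f g)) ->
  exists2 P, P \in unitmx & forall g, D g -> is_diag_mx (P *m f g *m invmx P).
Proof.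
move=> hc hd; have [s [sD hs]] := mx_span_exists f D.
have [P uP /allP hP] : codiagonalizable [seq f x | x <- s].
  apply/codiagonalizableP; split.
    move=> _ _ /mapP [x xs ->] /mapP [y ys ->]; apply: hc; exact: sD.
  by move=> _ /mapP [x xs ->]; apply: hd; exact: sD.
exists P => // g Dg; have [c ->] := hs g Dg.
rewrite mulmx_sumr mulmx_suml; apply/is_diag_mxP => i j ij; rewrite summxE big1 // => l _.
have := hP (f (nth 1%g s l)) (map_f _ (mem_nth _ (ltn_ord l))).
move=> /(diagonalizable_forP _ uP) /(_ i j ij) h.
by rewrite -scalemxAr -scalemxAl mxE h mulr0.
Qed.

(** Intersecting with Delta changes the lattice, so surjective coordinates e are chosen afresh. The
    old ones are e B for an integer matrix B, and [phi g *m B = B *m phi0 g]. As B is injective,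
    commutation and the separable annihilating polynomials pass from [phi0] to [phi]. *)
Lemma tower_section K A D Delta : subgroup K -> normalizes [set: G] K -> subgroup A ->
  K `<=` A -> subgroup Delta -> normalizes [set: G] Delta ->
  semisimple_section K A Delta -> normalizes [set: G] A ->
  tower Delta (A `&` Delta) -> tower Delta (K `&` Delta).
Proof.
move=> sK nK sA KA sD nD [k0 [e0 [phi0 [[e0M e0K phi0P] [hc hp]]]]] nA tw.
have sK' : subgroup (K `&` Delta) by exact: subgroupI.
have nK' : normalizes [set: G] (K `&` Delta) by exact: normalizesI.
have sA' : subgroup (A `&` Delta) by exact: subgroupI.
have nA' : normalizes [set: G] (A `&` Delta) by exact: normalizesI.
have e0M' : hom_on (A `&` Delta) e0 by move=> x y [Ax _] [Ay _]; exact: e0M.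
have e0X x n : A x -> e0 (x ^+ n)%g = e0 x *+ n.
  move=> Ax; elim: n => [|n IH]; first by rewrite (hom_on1 sA e0M).
  by rewrite expgS e0M ?IH ?mulrS //; exact: subgroupX.
have ab x y : (A `&` Delta) x -> (A `&` Delta) y -> (K `&` Delta) [~ x, y]%g.
  move=> [Ax Dx] [Ay Dy]; split; last exact: subgroup_comm.
  apply/e0K; first exact: subgroup_comm.
  have [Ax' Ay'] := (subgroupV sA Ax, subgroupV sA Ay).
  rewrite /commg /conjg !e0M //; do ?[exact: subgroupM|apply: subgroupM => //; exact: subgroupM].
  by rewrite !(hom_onV sA e0M) // [e0 x + e0 y]addrC addKr addNr.
have tf x n : (A `&` Delta) x -> (0 < n)%N -> (K `&` Delta) (x ^+ n)%g -> (K `&` Delta) x.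
  move=> [Ax Dx] n0 [Kx _]; split=> //; apply/e0K => //.
  have : e0 (x ^+ n)%g = 0 by apply/e0K => //; exact: subgroupX.
  rewrite e0X // => /rowP h; apply/rowP => i; have := h i; rewrite mulmxnE !mxE => /eqP.
  by rewrite mulrn_eq0 gtn_eqF //= => /eqP.
have [k [e [eM eK esur]]] := free_abelian_section sK' nK' sA' ab (fg sA') tf.
have eM' : hom_on (A `&` Delta) e := eM.
have [B hB] : exists B, forall x, (A `&` Delta) x -> e0 x = e x *m B.
  apply: (hom_on_factor sA' eM' e0M' esur) => x Ax /eK [] // Kx _; apply/e0K => //; by case: Ax.
have /choice [phi phiP] : forall g, exists C : 'M[int]_k,
    forall x, (A `&` Delta) x -> e (g * x * g^-1)%g = e x *m C.
  move=> g; apply: (hom_on_factor sA' eM' _ esur) => [x y Ax Ay|x Ax ex].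
    by rewrite -eM; [congr e; rewrite !gs|exact: nA'|exact: nA'].
  by apply/eK; [exact: nA'|apply: nK' => //; apply/eK].
have ext m (M N : 'M[int]_(k, m)) : (forall x, (A `&` Delta) x -> e x *m M = e x *m N) -> M = N.
  move=> h; apply/row_matrixP => i; rewrite !rowE.
  by have [a Aa <-] := esur (delta_mx 0 i); exact: h.
have phiB g : phi g *m B = B *m phi0 g.
  apply: ext => x Ax; rewrite !mulmxA -phiP // -!hB //; last exact: nA'.
  by apply: phi0P; case: Ax.
have phiM g h : phi (g * h)%g = phi h *m phi g.
  apply: ext => x Ax; rewrite -phiP // mulmxA -phiP // -phiP; last exact: nA'.
  by congr e; rewrite !gs.
have Binj (v : 'rV[int]_k) : v *m B = 0 -> v = 0.
  have [a Aa <-] := esur v; rewrite -hB // => h; apply/eK => //; split; last by case: Aa.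
  by apply/e0K => //; case: Aa.
(* Injectivity on integer vectors gives injectivity over the rationals by clearing denominators, and
   rank is insensitive to field extension. *)
have fB : row_free (toF B).
  have -> : toF B = map_mx (ratr : rat -> F) (map_mx intr B).
    by apply/matrixP => i j; rewrite !mxE ratr_int.
  rewrite row_free_map -kermx_eq0; apply/rowV0P => u /sub_kermxP uB.
  have [N [w [N0 eN]]] := integer_multiple u.
  have w0 : w = 0.
    apply: Binj; apply/rowP => j; have : map_mx (intr : int -> rat) (w *m B) = 0.
      by rewrite map_mxM eN -scalemxAl uB scaler0.
    by move=> /rowP /(_ j); rewrite !mxE => /eqP; rewrite intr_eq0 => /eqP.
  move: eN; rewrite w0 map_mx0 => /esym/eqP; rewrite scaler_eq0 intr_eq0 (negPf N0) /=.
  by move=> /eqP.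
have [P uP hP] : exists2 P, P \in unitmx & forall d, Delta d -> is_diag_mx (P *m toF (phi d) *m invmx P).
  apply: codiagonalizable_set => [g h Dg Dh|g Dg].
    rewrite -!map_mxM; congr (map_mx _ _).
    suff : phi g *m phi h *m B = phi h *m phi g *m B.
      move=> /(congr1 toF); rewrite !(map_mxM _ _ B) => /(row_free_inj fB).
      by move=> /matrixP h1; apply/matrixP => i j; have := h1 i j; rewrite !mxE => /eqP; rewrite eqr_int => /eqP.
    rewrite -!mulmxA !phiB ![phi _ *m (B *m _)]mulmxA !phiB -!mulmxA; apply: ext => x Ax.
    by rewrite !(mulmxA (e x)) -!hB // ?mulmxA -?mulmxA; apply: hc => //; case: Ax.
  have [p [sp hp']] := hp g Dg.
  suff : horner_mx (toF (phi0 g)) p = horner_mx (toF (phi0 g)) p -> diagonalizable (toF (phi g)) by apply.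
  move=> _; case: k => [|k] in e eM eK esur eM' B hB phi phiP ext phiB phiM Binj fB *.
    by rewrite [toF _]thinmx0; exact: diagonalizable0.
  apply: (separable_diagonalizable sp); apply: (row_free_inj fB); rewrite mul0mx.
  have -> : horner_mx (toF (phi g)) p *m toF B = toF B *m horner_mx (toF (phi0 g)) p.
    elim/poly_ind: p {sp hp'} => [|p c IH]; first by rewrite !rmorph0 mul0mx mulmx0.
    rewrite !rmorphD !rmorphM /= !horner_mx_X !horner_mx_C mulmxDl mulmxDr.
    rewrite mul_scalar_mx mul_mx_scalar; congr (_ + _).
    by rewrite -mulmxA -map_mxM phiB map_mxM mulmxA IH mulmxA.
  apply/row_matrixP => i; rewrite row_mul row0.
  have [a Aa ea] := esur (delta_mx 0 i).
  have -> : row i (toF B) = toF (e0 a) by rewrite hB // ea -rowE map_row.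
  by apply: hp'; case: Aa.
apply: (tower_step tw sK' nK' _ eM' eK esur phiP uP hP).
by move=> x [/KA Ax Dx].
Qed.

(** Semisimple sections are stacked upwards from 1 until the subgroup reached has finite index.
    Delta is a normal subgroup of finite index inside that subgroup and inside the groups attached
    to all the sections; intersecting with it gives the tower. *)
Theorem tower_exists : exists Delta, [/\ subgroup Delta, normalizes [set: G] Delta,
  finite_index Delta [set: G] & tower Delta [set 1%g]].
Proof.
pose nrm K := subgroup K /\ normalizes [set: G] K.
have /choice [nx nxP] : forall K, exists A, nrm K -> ~ finite_index K [set: G] ->
    [/\ nrm A, K `<=` A & ~ (A `<=` K)] /\
    exists D, [/\ subgroup D, finite_index D [set: G] & semisimple_section K A D].
  move=> K; have [[sK nK]|nn] := pselect (nrm K); last by exists K.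
  have [fK|nfK] := pselect (finite_index K [set: G]); first by exists K.
  have [A [[sA nA KA AK] hD]] := semisimple_section_exists sK nK nfK.
  by exists A.
pose K i := iter i (fun K => if `[< finite_index K [set: G] >] then K else nx K) [set 1%g].
have KS i : K i.+1 = if `[< finite_index (K i) [set: G] >] then K i else nx (K i) by [].
have nK i : nrm (K i).
  elim: i => [|i IH].
    by split; [exact: subgroup_set1|move=> g _ _ ->; rewrite /= mulg1 mulgV].
  by rewrite KS; case: asboolP => // nf; have [[]] := nxP _ IH nf.
have Kmono i : K i `<=` K i.+1.
  by rewrite KS; case: asboolP => [_|nf]; [exact: subset_refl|have [[]] := nxP _ (nK i) nf].
have Kle i j : (i <= j)%N -> K i `<=` K j.
  elim: j => [|j IH]; first by rewrite leqn0 => /eqP ->.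
  by rewrite leq_eqVlt => /orP [/eqP -> //|/IH h]; exact: subset_trans (Kmono j).
have exf : exists i, `[< finite_index (K i) [set: G] >].
  (* A strictly increasing chain is impossible: its union is finitely generated, hence equal to one
     of its terms. *)
  apply: contrapT => /forallNP nf.
  pose U := [set x | exists i, K i x].
  have sU : subgroup U.
    split.
    - by exists 0%N.
    - move=> x y [i Ki] [j Kj]; exists (maxn i j); apply: subgroupM; first by case: (nK (maxn i j)).
        by apply: Kle Ki; rewrite leq_maxl.
      by apply: Kle Kj; rewrite leq_maxr.
    - by move=> x [i Ki]; exists i; apply: subgroupV => //; case: (nK i).
  have [s [sU' gen]] := fg sU.
  have [i hi] : exists i, forall x, x \in s -> K i x.
    elim: s sU' {gen} => [_|x s IH h]; first by exists 0%N.
    have [z zs|i hi] := IH; first by apply: h; rewrite in_cons zs orbT.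
    have [j Kj] := h x (mem_head _ _).
    exists (maxn i j) => z; rewrite in_cons => /orP [/eqP ->|/hi].
      by apply: Kle Kj; rewrite leq_maxr.
    by apply: Kle; rewrite leq_maxl.
  have UK : U `<=` K i by apply: gen => //; case: (nK i).
  have nfi : ~ finite_index (K i) [set: G] by move=> f; apply: (nf i); apply/asboolP.
  have [[_ _ h] _] := nxP _ (nK i) nfi; apply: h.
  by move=> x nx1; apply: UK; exists i.+1; rewrite KS; case: asboolP.
case: (ex_minnP exf) => r /asboolP fr rmin.
have sec i : (i < r)%N -> exists D, [/\ subgroup D, finite_index D [set: G] &
    semisimple_section (K i) (K i.+1) D].
  move=> ir; have nfi : ~ finite_index (K i) [set: G].
    by move=> f; have := rmin i; rewrite leqNgt ir => h; have := h (asboolT f).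
  by rewrite KS; case: asboolP => // _; have [_] := nxP _ (nK i) nfi.
have [D [sD fD hD]] : exists D, [/\ subgroup D, finite_index D [set: G] & forall i, (i < r)%N ->
    semisimple_section (K i) (K i.+1) D].
  elim: (r) sec => [|j IH] h.
    by exists [set: G]; split=> //; exact: finite_index_refl.
  have [i ij|D [sD fD hD]] := IH; first by apply: h; exact: ltnW.
  have [D' [sD' fD' hD']] := h j (ltnSn j).
  exists (D `&` D'); split; [exact: subgroupI|exact: finite_indexI|].
  move=> i; rewrite ltnS leq_eqVlt => /orP [/eqP ->|ij].
    by apply: semisimple_sectionS hD' => x [].
  by apply: semisimple_sectionS (hD i ij) => x [].
have [Delta [sDl Dl nDl fDl]] := finite_index_core (subgroupI (nK r).1 sD) (@subgroupT G)
  (@subsetT _ _) (finite_indexI fr fD).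
exists Delta; split=> //.
have tw i : (i <= r)%N -> tower Delta (K (r - i)%N `&` Delta).
  elim: i => [_|i IH ir].
    rewrite subn0 (_ : K r `&` Delta = Delta); first exact: tower_top.
    by apply/seteqP; split=> x; [case|move=> Dx; split=> //; case: (Dl x Dx)].
  have e : (r - i = (r - i.+1).+1)%N by lia.
  have [[sK nK'] [sA nA]] := (nK (r - i.+1)%N, nK (r - i.+1).+1).
  apply: (tower_section (A := K (r - i.+1).+1)) => //.
    have ir' : (r - i.+1 < r)%N by lia.
    by apply: semisimple_sectionS (hD _ ir') => x /Dl [].
  by rewrite -e; apply: IH; exact: ltnW.
have := tw r (leqnn r); rewrite subnn (_ : K 0%N `&` Delta = [set 1%g]) //.
apply/seteqP; split=> x; first by case.
by move=> -> ; split=> //; exact: subgroup1.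
Qed.
End Tower.

(** * Cohomology of function modules *)

Lemma fun0E (T : Type) (V : nmodType) (x : T) : (0%R : T -> V) x = 0%R. Proof. by []. Qed.

Ltac abel := apply/funext => ?; rewrite ?fctE ?fun0E; ring.

(** Proves a linear identity between functions whose difference of sides is that of h, up to
    sign. *)
Ltac abel_eq h := match type of h with ?l = ?r =>
  apply/eqP; rewrite -subr_eq0; apply/eqP; first
  [ transitivity (l - r)%R; [abel | by apply/eqP; rewrite subr_eq0; apply/eqP; exact: h]
  | transitivity (r - l)%R; [abel | by apply/eqP; rewrite subr_eq0; apply/eqP; exact: esym h] ] end.

Section Cohomology.
Local Open Scope ring_scope.
Variables (C : numFieldType) (X : Type) (G : groupType) (act : G -> (X -> C) -> X -> C).
Hypotheses (act1 : forall a, act 1%g a = a)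
  (actM : forall g h a, act (g * h)%g a = act g (act h a))
  (actD : forall g a b, act g (a + b) = act g a + act g b)
  (actZ : forall g k a, act g (fun x => k * a x) = fun x => k * act g a x).
Variable M : set (X -> C).
Hypotheses (MD : forall a b, M a -> M b -> M (a + b))
  (MZ : forall k a, M a -> M (fun x => k * a x))
  (Mact : forall g a, M a -> M (act g a)) (M0 : M 0).
Implicit Types (K H L : set G) (d c : G -> X -> C) (z : G -> G -> X -> C).

Lemma act0 g : act g 0 = 0.
Proof. by apply: (addrI (act g 0)); rewrite -actD !addr0. Qed.

Lemma actN g a : act g (- a) = - act g a.
Proof. by apply: (addrI (act g a)); rewrite -actD !addrN act0. Qed.

Lemma actB g a b : act g (a - b) = act g a - act g b.
Proof. by rewrite actD actN. Qed.

Lemma act_sum g (I : Type) (r : seq I) (f : I -> X -> C) :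
  act g (\sum_(i <- r) f i) = \sum_(i <- r) act g (f i).
Proof. by elim/big_rec2: _ => [|i y1 y2 _ <-]; rewrite ?act0 ?actD. Qed.

Lemma actK g a : act g^-1%g (act g a) = a.
Proof. by rewrite -actM mulVg act1. Qed.

Lemma actVK g a : act g (act g^-1%g a) = a.
Proof. by rewrite -actM mulgV act1. Qed.

Lemma MN a : M a -> M (- a).
Proof.
by move=> /(MZ (-1)); congr M; apply/funext => x; rewrite mulN1r.
Qed.

Lemma MB a b : M a -> M b -> M (a - b).
Proof. by move=> Ma Mb; apply: MD => //; exact: MN. Qed.

Definition fixed_by K a := forall k, K k -> act k a = a.

Lemma fixed_byD K a b : fixed_by K a -> fixed_by K b -> fixed_by K (a + b).
Proof. by move=> ha hb k Kk; rewrite actD ha // hb. Qed.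

Lemma fixed_byN K a : fixed_by K a -> fixed_by K (- a).
Proof. by move=> ha k Kk; rewrite actN ha. Qed.

Lemma fixed_by_act L K g a : subgroup L -> normalizes L K -> L g -> fixed_by K a -> fixed_by K (act g a).
Proof.
move=> sL nLK Lg ha k Kk; have Kk' := normalizesV sL nLK Lg Kk.
by rewrite -{2}(ha _ Kk') -!actM !gs.
Qed.

(* The first and second cohomology groups of L / K in the K-invariants of M vanish. *)
Definition H1_trivial L K := forall d, (forall g, L g -> M (d g)) ->
  (forall g h, L g -> L h -> d (g * h)%g = d g + act g (d h)) ->
  (forall k, K k -> d k = 0) ->
  exists2 m, M m & forall g, L g -> d g = act g m - m.

(** Cochains of L / K are functions on L invariant under right multiplication by K. When K is normal
    this is invariance on either side. *)
Definition cochain1 L K c := (forall g, L g -> M (c g) /\ fixed_by K (c g)) /\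
  (forall g k, L g -> K k -> c (g * k)%g = c g).

Definition cocycle2 L K z := [/\ forall g h, L g -> L h -> M (z g h) /\ fixed_by K (z g h),
  forall g h k, L g -> L h -> K k -> z (g * k)%g h = z g h /\ z g (h * k)%g = z g h &
  forall g h w, L g -> L h -> L w ->
    z g (h * w)%g = z g h + z (g * h)%g w - act g (z h w)].

Definition cobound c : G -> G -> X -> C := fun g h => act g (c h) - c (g * h)%g + c g.

Definition H2_trivial L K := forall z, cocycle2 L K z ->
  exists2 c, cochain1 L K c & forall g h, L g -> L h -> z g h = cobound c g h.

(** Inflation-restriction: once the coboundary trivialising d on H is subtracted, the remainder
    vanishes on H. *)
Lemma H1_trivial_trans K H L : H `<=` L -> K `<=` H ->
  H1_trivial H K -> H1_trivial L H -> H1_trivial L K.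
Proof.
move=> HL KH hH hL d dM dD dK.
have [m Mm em] : exists2 m, M m & forall h, H h -> d h = act h m - m.
  by apply: hH => // [h /HL|g h /HL Lg /HL Lh]; [exact: dM|exact: dD].
have [m' Mm' em'] : exists2 m', M m' & forall g, L g -> d g - (act g m - m) = act g m' - m'.
  apply: (hL (fun g => d g - (act g m - m))).
  - by move=> g Lg; apply: MB; [exact: dM|apply: MB => //; exact: Mact].
  - by move=> g h Lg Lh /=; rewrite dD // actM !actB; abel.
  - by move=> h Hh; rewrite em // subrr.
exists (m + m') => [|g Lg]; first exact: MD.
by have := em' g Lg => /(canRL (subrK _)) ->; rewrite actD; abel.
Qed.

Lemma cochain1D L K c c' : cochain1 L K c -> cochain1 L K c' -> cochain1 L K (fun g => c g + c' g).
Proof.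
move=> [h1 h2] [h1' h2']; split=> [g Lg|g k Lg Kk]; last by rewrite h2 // h2'.
have [Mc fc] := h1 g Lg; have [Mc' fc'] := h1' g Lg.
by split; [exact: MD|exact: fixed_byD].
Qed.

Lemma cochain1N L K c : cochain1 L K c -> cochain1 L K (fun g => - c g).
Proof.
move=> [h1 h2]; split=> [g Lg|g k Lg Kk]; last by rewrite h2.
by have [Mc fc] := h1 g Lg; split; [exact: MN|exact: fixed_byN].
Qed.

Lemma cocycle2B L K z c : subgroup L -> K `<=` L -> normalizes L K ->
  cocycle2 L K z -> cochain1 L K c -> cocycle2 L K (fun g h => z g h - cobound c g h).
Proof.
move=> sL KL nLK [z1 z2 z3] [c1 c2].
split=> [g h Lg Lh|g h k Lg Lh Kk|g h w Lg Lh Lw].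
- have [Mz fz] := z1 g h Lg Lh.
  have [[Mg fg] [Mh fh]] := (c1 g Lg, c1 h Lh).
  have [Mgh fgh] := c1 _ (subgroupM sL Lg Lh).
  split; first by apply: MB => //; apply: MD => //; apply: MB => //; exact: Mact.
  apply: fixed_byD => //; apply: fixed_byN; apply: fixed_byD => //; apply: fixed_byD.
    exact: (fixed_by_act sL nLK).
  exact: fixed_byN.
- have [-> ->] := z2 g h k Lg Lh Kk; have Lk := KL _ Kk.
  have Kk' := normalizesV sL nLK Lh Kk.
  have Lgh := subgroupM sL Lg Lh.
  rewrite /cobound; split; last by rewrite mulgA (c2 h k) // (c2 (g * h)%g k).
  have -> : (g * k * h = g * h * (h^-1 * k * h))%g by rewrite !gs.
  by rewrite (c2 (g * h)%g) // (c2 g k) // actM (c1 h Lh).2.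
- rewrite /cobound z3 // !actB !actD !actN !actM !mulgA; abel.
Qed.

Lemma cobound_sub z c c' g h : z g h - cobound c g h = cobound c' g h ->
  z g h = cobound (fun g => c g + c' g) g h.
Proof. by move=> /(canRL (subrK _)) ->; rewrite /cobound actD; abel. Qed.

Lemma cocycle2_sub z L K H : H `<=` L -> cocycle2 L K z -> cocycle2 H K z.
Proof.
move=> HL [z1 z2 z3]; split=> [g h /HL ? /HL ?|g h k /HL ? /HL ?|g h w /HL ? /HL ? /HL ?].
- exact: z1.
- exact: z2.
- exact: z3.
Qed.

Lemma transversal_exists H L : subgroup H -> H `<=` L -> exists rep : G -> G,
  [/\ forall g, L g -> L (rep g) /\ H (g * (rep g)^-1)%g,
     forall h g, H h -> L g -> rep (h * g)%g = rep g & forall h, H h -> rep h = 1%g].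
Proof.
move=> sH HL.
pose S g := [set t | [/\ L t, H (g * t^-1)%g & H g -> t = 1%g]].
pose rep g := xget 1%g (S g).
have repP g : L g -> S g (rep g).
  move=> Lg; have [Hg|nHg] := pselect (H g).
    apply: (@xgetPex _ 1%g (S g)); exists 1%g; split=> //; first by apply/HL; exact: subgroup1.
    by rewrite invg1 mulg1.
  by apply: (@xgetPex _ 1%g (S g)); exists g; split=> //; rewrite mulgV; exact: subgroup1.
exists rep; split=> [g /repP []//|h g Hh Lg|h Hh].
  congr (xget _ _); apply/seteqP; split=> t [Lt Ht tg]; split=> //.
  - by apply: (subgroupMl sH Hh); rewrite mulgA.
  - by move=> Hg; apply: tg; exact: subgroupM.
  - by rewrite -mulgA; exact: subgroupM.
  - by move=> Hg; apply: tg; exact: (subgroupMl sH Hh).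
by have [_ _] := repP h (HL _ Hh); apply.
Qed.

(** The Hochschild-Serre argument made explicit. The cocycle is modified successively to vanish on H
    x H, on H x L and on L x H. It then descends to L / H, where it is a coboundary by
    hypothesis. *)
Lemma H2_trivial_trans K H L : subgroup K -> subgroup H -> subgroup L -> K `<=` H -> H `<=` L ->
  normalizes L K -> normalizes L H ->
  H1_trivial H K -> H2_trivial H K -> H2_trivial L H -> H2_trivial L K.
Proof.
move=> sK sH sL KH HL nK nH h1 h2 h2' z hz.
have KL := subset_trans KH HL.
have [rep [repP repM rep1]] := transversal_exists sH HL.
pose eta g := (g * (rep g)^-1)%g.
have etaH g : L g -> H (eta g) by move=> /repP [].
have repK g k : L g -> K k -> rep (g * k)%g = rep g.
  by move=> Lg Kk; rewrite -(repM (g * k * g^-1)%g g) ?gs //; apply/KH/nK.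
have etaM h g : H h -> L g -> eta (h * g)%g = (h * eta g)%g by move=> Hh Lg; rewrite /eta repM // mulgA.
have etaK g k : L g -> K k -> exists2 k', K k' & eta (g * k)%g = (eta g * k')%g.
  move=> Lg Kk; have [Lt _] := repP g Lg; rewrite /eta repK //.
  exists (rep g * k * (rep g)^-1)%g; [exact: nK|by rewrite !gs].
have gE g : (eta g * rep g)%g = g by rewrite /eta !gs.
have repL g : L g -> L (rep g) by move=> /repP [].
suff step z' : cocycle2 L K z' -> (forall h g, H h -> L g -> z' h g = 0) ->
    exists2 c, cochain1 L K c & forall g h, L g -> L h -> z' g h = cobound c g h.
  have [c1 [c1a c1b] ec1] := h2 z (cocycle2_sub HL hz).
  pose c1' g := if `[< H g >] then c1 g else 0.
  have cc1 : cochain1 L K c1'.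
    split=> [g Lg|g k Lg Kk]; rewrite /c1'.
      case: asboolP => [Hg|_]; first exact: c1a.
      by split=> // k _; rewrite act0.
    have -> : `[< H (g * k)%g >] = `[< H g >].
      by apply/asbool_equiv_eq; split=> h; [apply: subgroupMr h => //; exact: KH|apply: subgroupM => //; exact: KH].
    by case: asboolP => // Hg; exact: c1b.
  pose z1 g h := z g h - cobound c1' g h.
  have hz1 : cocycle2 L K z1 by exact: cocycle2B.
  have z1H g h : H g -> H h -> z1 g h = 0.
    move=> Hg Hh; rewrite /z1 ec1 // /cobound /c1' !asboolT ?subrr //; exact: subgroupM.
  have [z1a z1b z1c] := hz1.
  (* Writing g = [eta g * rep g] with [eta g] in H, the cocycle relation for h, [eta g], [rep g]
     gives z1(h, g) = c2(h g) - h c2(g). So adding the coboundary of c2 makes the cocycle vanish on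
     H x L. *)
  pose c2 g := z1 (eta g) (rep g).
  have cc2 : cochain1 L K c2.
    split=> [g Lg|g k Lg Kk]; rewrite /c2; first by apply: z1a; [exact/HL/etaH|exact: repL].
    rewrite repK //; have [k' Kk' ->] := etaK g k Lg Kk.
    by have [-> _] := z1b (eta g) (rep g) k' (HL _ (etaH _ Lg)) (repL _ Lg) Kk'.
  pose z2 g h := z1 g h - cobound (fun g => - c2 g) g h.
  have [c ? hc] : exists2 c, cochain1 L K c & forall g h, L g -> L h -> z2 g h = cobound c g h.
    apply: step; first by apply: cocycle2B => //; exact: cochain1N.
    move=> h g Hh Lg; have Lh := HL _ Hh.
    have e := z1c h (eta g) (rep g) Lh (HL _ (etaH _ Lg)) (repL _ Lg).
    rewrite gE (z1H h (eta g) Hh (etaH _ Lg)) in e.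
    have ch : c2 h = 0.
      rewrite /c2 rep1 // z1H //; [exact: etaH|exact: subgroup1].
    rewrite /z2 /cobound ch e /c2 repM // etaM // actN. abel.
  exists (fun g => c1' g + (- c2 g + c g)).
    by apply: cochain1D => //; apply: cochain1D => //; exact: cochain1N.
  move=> g h Lg Lh; apply: (cobound_sub (z := z)); apply: (cobound_sub (z := z1)).
  exact: hc.
move=> hz' zH; clear z hz; rename z' into z; rename hz' into hz.
have [za zb zc] := hz.
have zV g h : L g -> H h -> L (g^-1 * h * g)%g.
  by move=> Lg Hh; apply/HL; exact: (normalizesV sL nH).
(* For fixed g, the map sending h to z(g, g^-1 h g) is a 1-cocycle of H trivial on K, hence the
   coboundary of some m g. *)
have /choice [m mP] : forall g, exists a, L g -> [/\ M a, fixed_by K a, H g -> a = 0 &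
    forall h, H h -> z g (g^-1 * h * g)%g = act h a - a].
  move=> g; have [Lg|] := pselect (L g); last by exists 0.
  have [Hg|nHg] := pselect (H g).
    exists 0 => _; split=> // [k _|h Hh]; first exact: act0.
    by rewrite zH ?act0 ?subrr //; exact: zV.
  have e h : H h -> (g * (g^-1 * h * g) = h * g)%g by rewrite !gs.
  have [a Ma ea] : exists2 a, M a & forall h, H h -> z g (g^-1 * h * g)%g = act h a - a.
    apply: (h1 (fun h => z g (g^-1 * h * g)%g)).
    - by move=> h Hh; have [] := za g (g^-1 * h * g)%g Lg (zV _ _ Lg Hh).
    - move=> h h' Hh Hh'.
      have -> : (g^-1 * (h * h') * g = (g^-1 * h * g) * (g^-1 * h' * g))%g by rewrite !gs.
      rewrite zc ?e //; do ?exact: zV.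
      rewrite (zH (g^-1 * h * g)%g) //; [|exact: (normalizesV sL nH)|exact: zV].
      rewrite act0 subr0; congr (_ + _).
      have := zc h g (g^-1 * h' * g)%g (HL _ Hh) Lg (zV _ _ Lg Hh').
      rewrite e // (zH h g) // (zH h (h' * g)%g) //; last by apply: subgroupM => //; exact: HL.
      by move=> h0; abel_eq h0.
    - move=> k Kk; have Kk' := normalizesV sL nK Lg Kk.
      have [_] := zb g 1%g _ Lg (subgroup1 sL) Kk'; rewrite mul1g => ->.
      have := zc g 1%g 1%g Lg (subgroup1 sL) (subgroup1 sL).
      rewrite !mulg1 (zH 1%g 1%g) ?act0 ?subr0; [|exact: subgroup1|exact: subgroup1].
      by move=> h0; apply: (addrI (z g 1%g)); rewrite -h0 addr0.
  exists a => _; split=> // k Kk; have := ea _ (KH _ Kk).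
  have Kk' := normalizesV sL nK Lg Kk.
  have [_] := zb g 1%g _ Lg (subgroup1 sL) Kk'; rewrite mul1g => ->.
  have := zc g 1%g 1%g Lg (subgroup1 sL) (subgroup1 sL).
  rewrite !mulg1 (zH 1%g 1%g) ?act0 ?subr0; [|exact: subgroup1|exact: subgroup1].
  move=> h0 h1'; apply: (addIr (- a)); rewrite subrr -h1'.
  by apply: (addrI (z g 1%g)); rewrite -h0 addr0.
(* The primitives are taken on the transversal and extended by c2(h g) = h c2(g). This equivariance
   keeps the vanishing on H x L already obtained. *)
pose c2 g := act (eta g) (m (rep g)).
have cc2 : cochain1 L K c2.
  split=> [g Lg|g k Lg Kk].
    have [Ma fa _ _] := mP (rep g) (repL _ Lg).
    split; first exact: Mact.
    exact: (fixed_by_act sL nK (HL _ (etaH _ Lg))).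
  rewrite /c2 repK //; have [k' Kk' ->] := etaK g k Lg Kk.
  by have [_ fa _ _] := mP (rep g) (repL _ Lg); rewrite actM fa.
have c2H h : H h -> c2 h = 0.
  move=> Hh; rewrite /c2 rep1 //; have [_ _ m1 _] := mP 1%g (subgroup1 sL).
  by rewrite m1 ?act0 //; exact: subgroup1.
have c2M h g : H h -> L g -> c2 (h * g)%g = act h (c2 g).
  by move=> Hh Lg; rewrite /c2 repM // etaM // actM.
have c2P g h : L g -> H h -> z g (g^-1 * h * g)%g = act h (c2 g) - c2 g.
  move=> Lg Hh; have Lt := repL _ Lg; have He := etaH _ Lg.
  have [_ _ _ ht] := mP _ Lt.
  have Hh' : H ((eta g)^-1 * h * eta g)%g.
    by apply: subgroupM => //; apply: subgroupM => //; exact: subgroupV.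
  have := ht _ Hh'.
  have -> : ((rep g)^-1 * ((eta g)^-1 * h * eta g) * rep g = g^-1 * h * g)%g.
    by rewrite -{3 4}(gE g) !gs.
  have := zc (eta g) (rep g) (g^-1 * h * g)%g (HL _ He) Lt (zV _ _ Lg Hh).
  rewrite gE (zH (eta g) (rep g)) // (zH (eta g)) //; last by apply: subgroupM => //; exact: zV.
  move=> h0 h3; have -> : z g (g^-1 * h * g)%g = act (eta g) (z (rep g) (g^-1 * h * g)%g).
    by abel_eq h0.
  by rewrite h3 actB -!actM !gs.
pose z3 g h := z g h - cobound (fun g => - c2 g) g h.
have hz3 : cocycle2 L K z3 by apply: cocycle2B => //; exact: cochain1N.
have z3l h g : H h -> L g -> z3 h g = 0.
  by move=> Hh Lg; rewrite /z3 zH // /cobound actN c2M // (c2H h) //; abel.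
have z3r g h : L g -> H h -> z3 g h = 0.
  move=> Lg Hh; rewrite /z3 /cobound (c2H h) // oppr0 act0.
  have Hh' : H (g * h * g^-1)%g by exact: nH.
  have -> : (g * h = g * h * g^-1 * g)%g by rewrite !gs.
  rewrite c2M //; have := c2P g _ Lg Hh'.
  have -> : (g^-1 * (g * h * g^-1) * g = h)%g by rewrite !gs.
  by move=> ->; abel.
have [z3a z3b z3c] := hz3.
have z3i g h k : L g -> L h -> H k -> z3 g (h * k)%g = z3 g h.
  move=> Lg Lh Hk; rewrite z3c ?(z3r h k) ?(z3r (g * h)%g k) //; do ?[exact: HL|exact: subgroupM].
  by rewrite act0 addr0 subr0.
have z3f g h k : L g -> L h -> H k -> z3 (g * k)%g h = act (g * k * g^-1)%g (z3 g h).
  move=> Lg Lh Hk; have Hk' : H (g * k * g^-1)%g by exact: nH.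
  have -> : (g * k = g * k * g^-1 * g)%g by rewrite !gs.
  have := z3c _ g h (HL _ Hk') Lg Lh.
  rewrite (z3l _ g) // (z3l _ (g * h)%g) //; last exact: subgroupM.
  rewrite !mulgVK => h0.
  by abel_eq h0.
have z3k g h k : L g -> L h -> H k -> z3 (g * k)%g h = z3 g h.
  move=> Lg Lh Hk; have := z3c g k h Lg (HL _ Hk) Lh.
  have -> : (k * h = h * (h^-1 * k * h))%g by rewrite !gs.
  rewrite z3i //; last exact: (normalizesV sL nH).
  rewrite (z3r g k) // (z3l k h) // act0 => h0.
  by abel_eq h0.
(* Vanishing on H x L and L x H makes z3 invariant under H in both arguments, and comparing this
   with [z3f] shows that its values are fixed by H. *)
have [|c [c1 c2'] hc] := h2' z3.
  split=> [g h Lg Lh|g h k Lg Lh Hk|g h w Lg Lh Lw]; [|by split; [exact: z3k|exact: z3i]|exact: z3c].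
  have [Mz _] := z3a g h Lg Lh; split=> // k Hk.
  have Hk' := normalizesV sL nH Lg Hk.
  have := z3f g h _ Lg Lh Hk'; rewrite z3k // => {2}->.
  by congr (act _ _); rewrite !gs.
exists (fun g => - c2 g + c g).
  apply: cochain1D; first exact: cochain1N.
  split=> [g Lg|g k Lg Kk]; last by apply: c2' => //; exact: KH.
  by have [Mc fc] := c1 g Lg; split=> // k /KH; exact: fc.
by move=> g h Lg Lh; apply: (cobound_sub (z := z)); exact: hc.
Qed.

(** The list t has exactly one representative per coset of K, so left translation by g permutes the
    cosets that it represents. *)
Lemma coset_sum K L (s : seq G) : subgroup K -> subgroup L -> K `<=` L ->
  (forall x, x \in s -> L x) -> (forall g, L g -> exists2 x, x \in s & K (x^-1 * g)%g) ->
  exists t : seq G, [/\ t != [::], forall x, x \in t -> L x &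
    forall (u : G -> X -> C) g, L g -> (forall x k, L x -> K k -> u (x * k)%g = u x) ->
      \sum_(x <- t) u (g * x)%g = \sum_(x <- t) u x].
Proof.
move=> sK sL KL sLs hs.
pose S g := [set x | L x /\ K (x^-1 * g)%g].
pose rep g := xget 1%g (S g).
have repP g : L g -> S g (rep g).
  by move=> Lg; apply: (@xgetPex _ 1%g (S g)); exists g; split=> //; rewrite mulVg; exact: subgroup1.
have repE g h : K (g^-1 * h)%g -> rep g = rep h.
  move=> Kgh; congr (xget _ _); apply/seteqP; split=> x [Lx Kx]; split=> //.
    exact: cong_trans Kx Kgh.
  exact: cong_trans Kx (cong_sym sK Kgh).
have repI g : L g -> rep (rep g) = rep g by move=> Lg; apply: repE; have [_] := repP g Lg.
pose t := undup [seq rep x | x <- s].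
have tL x : x \in t -> L x.
  by rewrite mem_undup => /mapP [y /sLs /repP [Ly _] ->].
have trep g : L g -> rep g \in t.
  move=> Lg; have [x xs Kx] := hs g Lg.
  by rewrite mem_undup; apply/mapP; exists x => //; apply: repE; exact: cong_sym.
have tI x : x \in t -> rep x = x by rewrite mem_undup => /mapP [y /sLs Ly ->]; exact: repI.
exists t; split=> // [|u g Lg hu].
  apply/eqP => t0; have := trep _ (subgroup1 sL); by rewrite t0.
have urep x : L x -> u x = u (rep x).
  move=> Lx; have [Lr Kr] := repP x Lx.
  by rewrite -(hu (rep x) ((rep x)^-1 * x)%g) // mulVKg.
transitivity (\sum_(x <- [seq rep (g * x)%g | x <- t]) u x).
  rewrite big_map; apply: eq_big_seq => x /tL Lx; apply: urep; exact: subgroupM.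
apply: perm_big.
have inj : {in t &, injective (fun x => rep (g * x)%g)}.
  move=> x y xt yt /= e; rewrite -(tI x xt) -(tI y yt); apply: repE.
  have [[_ kx] [_ ky]] := (repP _ (subgroupM sL Lg (tL _ xt)), repP _ (subgroupM sL Lg (tL _ yt))).
  rewrite -e in ky; have := cong_trans sK (cong_sym sK kx) ky; by rewrite !gs.
have u1 : uniq [seq rep (g * x)%g | x <- t] by rewrite map_inj_in_uniq // undup_uniq.
apply: uniq_perm => //; first exact: undup_uniq.
have [||_] := uniq_min_size u1 (s2 := t) _ _; rewrite ?size_map //.
by move=> _ /mapP [x /tL Lx ->]; apply: trep; exact: subgroupM.
Qed.

Lemma sum_cocycleE (t : seq G) (f f' f'' : G -> X -> C) (a : X -> C) :
  (forall x, x \in t -> f x = f' x + f'' x - a) ->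
  \sum_(x <- t) f x = \sum_(x <- t) f' x + \sum_(x <- t) f'' x - a *+ size t.
Proof.
elim: t => [|x t IH] h; first by rewrite !big_nil addr0 subr0.
rewrite !big_cons IH; last by move=> y yt; apply: h; rewrite in_cons yt orbT.
rewrite h ?mem_head // mulrS; abel.
Qed.

Lemma fun_mulrnE (a : X -> C) n x : (a *+ n) x = a x *+ n.
Proof. by elim: n => [//|n IH]; rewrite !mulrS -IH. Qed.

(** Averaging: summing the cocycle relation over the n cosets gives g D = D - n d(g), with D the sum
    of the d(x). Degree 2 is treated in the same way. *)
Lemma finite_H1_trivial K L : subgroup K -> subgroup L -> K `<=` L -> normalizes L K ->
  finite_index K L -> H1_trivial L K.
Proof.
move=> sK sL KL nK /finite_index_reps [s [sLs hs]] d dM dD dK.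
have [t [t0 tL tsum]] := coset_sum sK sL KL sLs hs.
pose n : C := (size t)%:R; have n0 : n != 0 by rewrite pnatr_eq0 size_eq0.
pose D := \sum_(x <- t) d x.
have MS : M D by rewrite /D big_seq; elim/big_rec: _ => // x y xt My; apply: MD => //; exact/dM/tL.
exists (fun x => - n^-1 * D x); first exact: MZ.
move=> g Lg; have e : act g D = D - d g *+ size t.
  rewrite /D act_sum (@sum_cocycleE t _ (fun x => d (g * x)%g) (fun=> 0) (d g)).
    rewrite [X in _ + X - _]big1 // addr0 tsum // => x k Lx Kk; rewrite dD ?(dK k Kk) ?act0 ?addr0 //; exact: KL.
  by move=> x /tL Lx; rewrite dD //; abel.
rewrite actZ e; apply/funext => x; rewrite !fctE fun_mulrnE -mulr_natr -/n; by field.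
Qed.

Lemma finite_H2_trivial K L : subgroup K -> subgroup L -> K `<=` L -> normalizes L K ->
  finite_index K L -> H2_trivial L K.
Proof.
move=> sK sL KL nK /finite_index_reps [s [sLs hs]] z [za zb zc].
have [t [t0 tL tsum]] := coset_sum sK sL KL sLs hs.
pose n : C := (size t)%:R; have n0 : n != 0 by rewrite pnatr_eq0 size_eq0.
pose D g := \sum_(x <- t) z g x.
have DP g : L g -> M (D g) /\ fixed_by K (D g).
  move=> Lg; rewrite /D big_seq; elim/big_rec: _ => [|x y xt [My fy]].
    by split=> // k _; exact: act0.
  by have [Mz fz] := za g x Lg (tL _ xt); split; [exact: MD|exact: fixed_byD].
exists (fun g x => n^-1 * D g x).
  split=> [g Lg|g k Lg Kk].
    have [MDg fDg] := DP g Lg; split; first exact: MZ.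
    by move=> k Kk; rewrite actZ fDg.
  apply/funext => x; congr (_ * _); congr (_ _); rewrite /D big_seq [RHS]big_seq.
  by apply: eq_bigr => y /tL Ly; have [] := zb g y k Lg Ly Kk.
move=> g h Lg Lh; have e : D (g * h)%g = D g + act g (D h) - z g h *+ size t.
  rewrite /D act_sum -(tsum (z g) h) // => [|x k Lx Kk]; last by have [] := zb g x k Lg Lx Kk.
  by apply: sum_cocycleE => x /tL Lx; rewrite zc //; abel.
rewrite /cobound e actZ; apply/funext => x; rewrite !fctE fun_mulrnE -mulr_natr -/n; by field.
Qed.

Section Cyclic.
Variables (K H : set G) (b : G) (e : G -> int).
Hypotheses (sK : subgroup K) (sH : subgroup H) (KH : K `<=` H) (nK : normalizes H K) (Hb : H b)
  (eM : forall g h, H g -> H h -> e (g * h)%g = e g + e h) (eb : e b = 1)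
  (eK : forall g, H g -> (e g = 0 <-> K g))
  (surj : forall a, M a -> fixed_by K a -> exists m, [/\ M m, fixed_by K m & act b m - m = a]).

Lemma cyclic_decomp h : H h -> K ((zpow b (e h))^-1 * h)%g.
Proof.
move=> Hh.
have e1 : e 1%g = 0 by apply/eK; exact: subgroup1.
have eV g : H g -> e g^-1%g = - e g.
  by move=> Hg; apply: (addrI (e g)); rewrite -eM ?mulgV ?addrN //; exact: subgroupV.
have eX (p : nat) : e (b ^+ p)%g = p%:Z.
  elim: p => [//|p IH]; rewrite expgS eM ?IH ?eb ?intS //; exact: subgroupX.
have ez m : e (zpow b m) = m.
  case: m => p; first exact: eX.
  by rewrite /zpow eV ?eX ?NegzE //; exact: subgroupX.
have Hz := subgroup_zpow (e h) sH Hb.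
by apply/eK; [exact: subgroupM (subgroupV _ _) _|rewrite eM ?eV ?ez ?addNr //; exact: subgroupV].
Qed.

Lemma cyclic_ind (P : set G) : subgroup (H `&` P) -> P b -> K `<=` P -> forall h, H h -> P h.
Proof.
move=> sP Pb KP h Hh; have Kh := cyclic_decomp Hh.
rewrite -(mulVKg (zpow b (e h)) h).
have h1 : (H `&` P) (zpow b (e h)) by exact: subgroup_zpow.
have h2 : (H `&` P) ((zpow b (e h))^-1 * h)%g by split; [exact: KH|exact: KP].
by have [] := subgroupM sP h1 h2.
Qed.

(** The H^1 of an infinite cyclic group is the cokernel of b - 1 on the invariants, and [surj] makes
    it vanish. *)
Lemma cyclic_H1_trivial : H1_trivial H K.
Proof.
move=> d dM dD dK.
have fd : fixed_by K (d b).
  move=> k Kk; have Kk' := normalizesV sH nK Hb Kk.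
  have := dD k b (KH Kk) Hb; rewrite (dK k Kk) add0r => <-.
  have -> : (k * b = b * (b^-1 * k * b))%g by rewrite !gs.
  by rewrite dD ?(dK _ Kk') ?act0 ?addr0 //; exact: KH.
have [m [Mm fm em]] := surj (dM b Hb) fd.
exists m => // h Hh; apply: (cyclic_ind (P := [set h | d h = act h m - m])) Hh; last 2 first.
- by rewrite /= em.
- by move=> k Kk /=; rewrite dK // fm // subrr.
split.
- split; first exact: subgroup1.
  by rewrite /= act1 dK ?subrr //; exact: subgroup1.
- move=> g h1 [Hg eg] [Hh1 eh]; split; first exact: subgroupM.
  by rewrite /= dD // eg eh actM actB; abel.
- move=> g [Hg eg]; split; first exact: subgroupV.
  have := dD g^-1%g g (subgroupV sH Hg) Hg; rewrite mulVg dK; last exact: subgroup1.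
  rewrite eg actB actK => h0; rewrite /=; by abel_eq h0.
Qed.

(** Recursion over all integers: backward steps use the right inverse f' of f. *)
Lemma bi_infinite_sequence (f f' : int -> (X -> C) -> X -> C) (P : set (X -> C)) a0 :
  (forall i a, P a -> P (f i a)) -> (forall i a, P a -> P (f' i a)) -> P a0 ->
  (forall i a, P a -> f i (f' i a) = a) ->
  exists y : int -> X -> C, [/\ y 0 = a0, forall i, P (y i) & forall i, y (i + 1) = f i (y i)].
Proof.
move=> Pf Pf' P0 ff.
pose yp := fix yp (n : nat) := if n is n'.+1 then f n' (yp n') else a0.
pose yn := fix yn (n : nat) := if n is n'.+1 then f' (- (n'.+1)%:Z) (yn n') else a0.
have Pyp n : P (yp n) by elim: n => //= n IH; exact: Pf.
have Pyn n : P (yn n) by elim: n => //= n IH; exact: Pf'.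
exists (fun i => match i with Posz n => yp n | Negz n => yn n.+1 end).
split=> [//|[n|n]|[n|n]]; [exact: Pyp|exact: (Pyn n.+1)| |].
  by rewrite -PoszD addn1.
case: n => [|n].
  have -> : Negz 0 + 1 = 0 by lia.
  by rewrite /= NegzE ff.
have -> : Negz n.+1 + 1 = Negz n by lia.
change (yn n.+1 = f (Negz n.+1) (f' (- n.+2%:Z) (yn n.+1))).
by rewrite NegzE ff //; exact: (Pyn n.+1).
Qed.

(** An infinite cyclic group is free: a primitive c with c(b) = 0 is determined along the powers of
    b by the relation for the pair (b, b^i). The general relation then spreads from b and K to all
    of H. *)
Lemma cyclic_H2_trivial : H2_trivial H K.
Proof.
move=> z [za zb zc].
pose P := [set a | M a /\ fixed_by K a].
have H1 := subgroup1 sH.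
have Hz i : H (zpow b i) by exact: subgroup_zpow.
have Hb' := subgroupV sH Hb.
have Pact g a : H g -> P a -> P (act g a).
  by move=> Hg [Ma fa]; split; [exact: Mact|exact: (fixed_by_act sH nK)].
have PD a a' : P a -> P a' -> P (a + a') by move=> [? ?] [? ?]; split; [exact: MD|exact: fixed_byD].
have PN a : P a -> P (- a) by move=> [? ?]; split; [exact: MN|exact: fixed_byN].
have Pz g h : H g -> H h -> P (z g h) by exact: za.
(* The initial value z 1 1 is forced, since the coboundary of c at (1, 1) is c 1. The next value, c
   b, then comes out as 0. *)
have [y [y0 Py yS]] := @bi_infinite_sequence (fun i a => act b a - z b (zpow b i))
  (fun i a => act b^-1%g (a + z b (zpow b i))) P (z 1%g 1%g)
  (fun i a Pa => PD _ _ (Pact _ _ Hb Pa) (PN _ (Pz _ _ Hb (Hz i))))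
  (fun i a Pa => Pact _ _ Hb' (PD _ _ Pa (Pz _ _ Hb (Hz i))))
  (Pz _ _ H1 H1) (fun i a _ => etrans (congr1 (fun v => v - _) (actVK b _)) (addrK _ _)).
pose c h := y (e h).
have e1 : e 1%g = 0 by apply/eK => //; exact: subgroup1.
have ek k : K k -> e k = 0 by move=> Kk; apply/eK => //; exact: KH.
have z1 h : H h -> z 1%g h = z 1%g 1%g.
  move=> Hh; have := zc 1%g 1%g h H1 H1 Hh; rewrite !mul1g act1 => h0; by abel_eq h0.
have zbd h : H h -> z b (zpow b (e h)) = z b h.
  move=> Hh; have Kh := cyclic_decomp Hh.
  by have [_] := zb b (zpow b (e h)) _ Hb (Hz _) Kh; rewrite mulVKg.
have cb : c b = 0.
  rewrite /c eb -[1]add0r yS y0 (_ : zpow b 0 = 1%g) //.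
  have := zc b 1%g 1%g Hb H1 H1; rewrite !mulg1 => h0; by abel_eq h0.
pose good := [set g | forall h, H h -> c (g * h)%g = act g (c h) + c g - z g h].
have c1 : c 1%g = z 1%g 1%g by rewrite /c e1.
have all_good : forall g, H g -> good g.
  apply: cyclic_ind.
  - split.
    + by split=> // h Hh; rewrite mul1g act1 c1 z1 // addrK.
    + move=> g h [Hg gg] [Hh gh]; split; first exact: subgroupM.
      move=> w Hw; have Hhw := subgroupM sH Hh Hw.
      rewrite -mulgA (gg (h * w)%g) // (gh w) // (gg h) // zc // actM !actD actN; abel.
    + move=> g [Hg gg]; have Hg' := subgroupV sH Hg; split=> // h Hh.
      have E w : H w -> c (g^-1 * w)%g = act g^-1%g (c w - c g + z g (g^-1 * w)%g).
        move=> Hw; have := gg (g^-1 * w)%g (subgroupM sH Hg' Hw).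
        rewrite mulVKg => ->; rewrite -[LHS](actK g); congr (act _ _); abel.
      have := E _ H1; rewrite mulg1 => ->; rewrite E //.
      have := zc g g^-1%g h Hg Hg' Hh; rewrite mulgV z1 // -c1 => ->.
      rewrite !actD !actN actK; abel.
  - move=> h Hh; rewrite cb /c eM // eb [1 + _]addrC yS /= zbd //; abel.
  - move=> k Kk h Hh; rewrite /c eM //; last exact: KH.
    rewrite ek // add0r y0.
    have [_ fc] := Py (e h); rewrite fc //.
    have [zk _] := zb 1%g h k H1 Hh Kk; rewrite mul1g in zk.
    by rewrite zk z1 // addrK.
exists c.
  split=> [g Hg|g k Hg Kk]; first exact: Py.
  by rewrite /c eM ?(ek k Kk) ?addr0 //; exact: KH.
by move=> g h Hg Hh; rewrite /cobound (all_good g Hg h Hh); abel.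
Qed.
End Cyclic.
End Cohomology.

(** * Polynomial functions and lattices of translations *)

Section PolynomialFunctions.
Local Open Scope ring_scope.

(** The algebra of functions generated by S and the constants. Functions rather than formal
    polynomials make substitution immediate, also in functions of several points. *)
Inductive polyfun (F : comNzRingType) (X : Type) (S : set (X -> F)) : (X -> F) -> Prop :=
| polyfun_cst a : polyfun S (fun=> a)
| polyfun_gen f : S f -> polyfun S f
| polyfun_add f g : polyfun S f -> polyfun S g -> polyfun S (fun x => f x + g x)
| polyfun_mul f g : polyfun S f -> polyfun S g -> polyfun S (fun x => f x * g x).

Lemma polyfun_comp (F : comNzRingType) (X Y : Type) (S : set (X -> F)) (T : set (Y -> F)) (h : X -> Y) g :
  (forall f, T f -> polyfun S (f \o h)) -> polyfun T g -> polyfun S (g \o h).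
Proof.
move=> hT; elim=> [a|f /hT //|f1 f2 _ h1 _ h2|f1 f2 _ h1 _ h2].
- exact: polyfun_cst.
- exact: (polyfun_add h1 h2).
- exact: (polyfun_mul h1 h2).
Qed.

Lemma polyfun_scale (F : comNzRingType) (X : Type) (S : set (X -> F)) a f :
  polyfun S f -> polyfun S (fun x => a * f x).
Proof. by move=> h; apply: polyfun_mul => //; exact: polyfun_cst. Qed.

Lemma polyfun_opp (F : comNzRingType) (X : Type) (S : set (X -> F)) f :
  polyfun S f -> polyfun S (fun x => - f x).
Proof.
by move=> /(polyfun_scale (-1)); congr polyfun; apply/funext => x; rewrite mulN1r.
Qed.

Lemma polyfun_sub (F : comNzRingType) (X : Type) (S : set (X -> F)) f g :
  polyfun S f -> polyfun S g -> polyfun S (fun x => f x - g x).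
Proof. by move=> hf /polyfun_opp; exact: polyfun_add. Qed.

Lemma polyfun_sum (F : comNzRingType) (X : Type) (S : set (X -> F)) (I : Type) (r : seq I) (f : I -> X -> F) :
  (forall i, polyfun S (f i)) -> polyfun S (fun x => \sum_(i <- r) f i x).
Proof.
move=> h; elim: r => [|i r IH].
  by rewrite (_ : (fun x => _) = fun=> 0); [exact: polyfun_cst|apply/funext => x; rewrite big_nil].
rewrite (_ : (fun x => _) = fun x => f i x + \sum_(j <- r) f j x); first exact: polyfun_add.
by apply/funext => x; rewrite big_cons.
Qed.

Lemma polyfun_map (F F' : comNzRingType) (X : Type) (phi : {rmorphism F -> F'}) (S : set (X -> F))
  (T : set (X -> F')) f : (forall g, S g -> polyfun T (phi \o g)) ->
  polyfun S f -> polyfun T (phi \o f).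
Proof.
move=> hS; elim=> [a|g /hS //|f1 f2 _ h1 _ h2|f1 f2 _ h1 _ h2].
- exact: polyfun_cst.
- rewrite (_ : phi \o _ = fun x => phi (f1 x) + phi (f2 x)); first exact: polyfun_add.
  by apply/funext => x /=; rewrite rmorphD.
- rewrite (_ : phi \o _ = fun x => phi (f1 x) * phi (f2 x)); first exact: polyfun_mul.
  by apply/funext => x /=; rewrite rmorphM.
Qed.

Variable R : realType.
Local Notation C := R[i].

Definition ccoord n : set ('rV[R]_n -> C) := [set f | exists i : 'I_n, f = fun x : 'rV[R]_n => (x 0 i)%:C%C].
Definition cpoly n := polyfun (@ccoord n).

(** Restriction to a line returns to formal polynomials in one variable, where leading coefficients
    and roots are available. *)
Lemma cpoly_line n (g : 'rV[R]_n -> C) x v : cpoly g ->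
  exists p : {poly C}, forall r : R, g (x + r *: v) = p.[r%:C%C].
Proof.
elim=> [a|_ [i ->]|f1 f2 _ [p1 h1] _ [p2 h2]|f1 f2 _ [p1 h1] _ [p2 h2]].
- by exists a%:P => r; rewrite hornerC.
- exists ((x 0 i)%:C%C%:P + (v 0 i)%:C%C%:P * 'X) => r.
  by rewrite !hornerE !mxE rmorphD rmorphM /= mulrC.
- by exists (p1 + p2) => r; rewrite hornerD h1 h2.
- by exists (p1 * p2) => r; rewrite hornerM h1 h2.
Qed.

Lemma poly_eq_nat (p q : {poly C}) : (forall m : nat, p.[m%:R] = q.[m%:R]) -> p = q.
Proof.
move=> h; apply/eqP; rewrite -subr_eq0; apply/negP => /negP nz.
pose d := size (p - q); pose rs := [seq (m%:R : C) | m <- iota 0 d].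
suff : (size rs < d)%N by rewrite size_map size_iota ltnn.
apply: max_poly_roots nz _ _.
  by apply/allP => _ /mapP [m _ ->]; rewrite rootE hornerD hornerN h subrr.
by rewrite map_inj_uniq ?iota_uniq //; move=> a b /eqP; rewrite eqr_nat => /eqP.
Qed.

Definition shift n (v : 'rV[R]_n) (g : 'rV[R]_n -> C) x := g (x - v).

(** On each line in the direction v, comparing leading coefficients forces a = 1 or g = 0. If a = 1,
    the restriction takes the same value at all natural numbers, hence is constant. *)
Lemma shift_eigen n (g : 'rV[R]_n -> C) v a : cpoly g -> (forall x, a * shift v g x = g x) ->
  (a = 1 /\ forall x r, g (x + r *: v) = g x) \/ g = fun=> 0.
Proof.
move=> pg h; have [a1|a1] := eqVneq a 1; [left; split=> // x r|right; apply/funext => x].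
  have [p hp] := cpoly_line x v pg.
  have ep (m : nat) : p.[m%:R] = p.[0].
    elim: m => [//|m IH]; rewrite -IH.
    have e (k : nat) : p.[k%:R] = g (x + k%:R *: v) by rewrite hp rmorph_nat.
    rewrite !e -[LHS]h a1 mul1r /shift; congr g.
    by rewrite -natr1 scalerDl scale1r addrA addrK.
  have ec : p = p.[0]%:P by apply: poly_eq_nat => m; rewrite hornerC ep.
  by rewrite hp ec hornerC -[x in RHS]addr0 -(scale0r v) hp ec hornerC.
have [p hp] := cpoly_line x v pg.
have ep : a *: (p \Po ('X - 1%:P)) = p.
  apply: poly_eq_nat => m; rewrite hornerZ horner_comp !hornerE.
  have e (k : R) : p.[k%:C%C] = g (x + k *: v) by rewrite hp.
  have -> : (m%:R - 1 : C) = (m%:R - 1 : R)%:C%C by rewrite rmorphB rmorph_nat rmorph1.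
  have -> : (m%:R : C) = (m%:R : R)%:C%C by rewrite rmorph_nat.
  by rewrite !e -[RHS]h /shift scalerBl scale1r addrA.
have p0 : p = 0.
  apply/eqP; rewrite -lead_coef_eq0; apply/eqP.
  have sX : size ('X - 1%:P : {poly C}) = 2%N by rewrite size_XsubC.
  have := congr1 lead_coef ep; rewrite lead_coefZ lead_coef_comp ?sX //.
  rewrite lead_coefXsubC expr1n mulr1 => /eqP; rewrite -subr_eq0 -{2}[lead_coef p]mul1r -mulrBl.
  by rewrite mulf_eq0 subr_eq0 (negPf a1) => /eqP.
by have := hp 0; rewrite scale0r addr0 p0 horner0.
Qed.

Lemma shift_cpoly n (g : 'rV[R]_n -> C) v : cpoly g -> cpoly (shift v g).
Proof.
apply: (polyfun_comp (h := fun x => x - v)) => _ [i ->].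
rewrite (_ : _ \o _ = fun x : 'rV[R]_n => (x 0 i)%:C%C - (v 0 i)%:C%C).
  by apply: polyfun_sub; [apply: polyfun_gen; exists i|exact: polyfun_cst].
by apply/funext => x /=; rewrite !mxE rmorphB.
Qed.

Definition nabla n (v : 'rV[R]_n) (g : 'rV[R]_n -> C) x := shift v g x - g x.

Lemma nablaD n v (f g : 'rV[R]_n -> C) : nabla v (fun x => f x + g x) = fun x => nabla v f x + nabla v g x.
Proof. by apply/funext => x; rewrite /nabla /shift; ring. Qed.

Lemma nablaM n v (f g : 'rV[R]_n -> C) : nabla v (fun x => f x * g x) =
  fun x => (nabla v f x * g x + f x * nabla v g x) + nabla v f x * nabla v g x.
Proof. by apply/funext => x; rewrite /nabla /shift; ring. Qed.

Definition nilp n v d (g : 'rV[R]_n -> C) := iter d (nabla v) g = fun=> 0.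

Lemma iter_nablaD n v d (f g : 'rV[R]_n -> C) :
  iter d (nabla v) (fun x => f x + g x) = fun x => iter d (nabla v) f x + iter d (nabla v) g x.
Proof. by elim: d => //= d ->; exact: nablaD. Qed.

Lemma nilpS n v d e (g : 'rV[R]_n -> C) : (d <= e)%N -> nilp v d g -> nilp v e g.
Proof.
move=> /subnKC <-; rewrite /nilp addnC iterD => ->.
by elim: (e - d)%N => //= k ->; apply/funext => x; rewrite /nabla /shift subrr.
Qed.

Lemma nilpD n v d (f g : 'rV[R]_n -> C) : nilp v d f -> nilp v d g -> nilp v d (fun x => f x + g x).
Proof. by rewrite /nilp iter_nablaD => -> ->; apply/funext => x; rewrite addr0. Qed.

Lemma nilpM n v d e (f g : 'rV[R]_n -> C) : nilp v d f -> nilp v e g ->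
  nilp v (d + e) (fun x => f x * g x).
Proof.
have [m] := ubnP (d + e); elim: m => // m IH in d e f g * => hm hf hg.
case: d => [|d] in hm hf *.
  have -> : (fun x => f x * g x) = fun=> 0.
    by apply/funext => x; rewrite (_ : f = fun=> 0) ?mul0r.
  exact: (nilpS (leq0n _)).
case: e => [|e] in hm hg *.
  have -> : (fun x => f x * g x) = fun=> 0.
    by apply/funext => x; rewrite (_ : g = fun=> 0) ?mulr0.
  exact: (nilpS (leq0n _)).
have hf' : nilp v d (nabla v f) by move: hf; rewrite /nilp iterSr.
have hg' : nilp v e (nabla v g) by move: hg; rewrite /nilp iterSr.
rewrite /nilp addSn iterSr nablaM.
apply: nilpD; first apply: nilpD.
- by apply: IH => //; lia.
- have -> : (d + e.+1 = d.+1 + e)%N by lia.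
  by apply: IH => //; lia.
- by apply: (@nilpS _ _ (d + e)); [lia|apply: IH => //; lia].
Qed.

Lemma cpoly_nilp n v (g : 'rV[R]_n -> C) : cpoly g -> exists d, nilp v d g.
Proof.
elim=> [a|_ [i ->]|f1 f2 _ [d1 h1] _ [d2 h2]|f1 f2 _ [d1 h1] _ [d2 h2]].
- by exists 1%N; apply/funext => x /=; rewrite /nabla /shift subrr.
- exists 2%N; apply/funext => x /=; rewrite /nabla /shift !mxE !rmorphB; ring.
- exists (maxn d1 d2); apply: nilpD; [apply: nilpS h1|apply: nilpS h2]; lia.
- by exists (d1 + d2)%N; exact: nilpM.
Qed.

(** Polynomials independent of the first j coordinates are those invariant under the first j lattice
    directions. This filtration serves to treat Z^k one generator at a time. *)
Definition depends_from n j (g : 'rV[R]_n -> C) :=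
  forall x y : 'rV[R]_n, (forall l : 'I_n, (j <= l)%N -> x 0 l = y 0 l) -> g x = g y.

Definition cpoly_from n j : set ('rV[R]_n -> C) := [set g | cpoly g /\ depends_from j g].

Lemma nabla_from n j v (g : 'rV[R]_n -> C) : cpoly_from j g -> cpoly_from j (nabla v g).
Proof.
move=> [pg dg]; split; first by apply: polyfun_sub => //; exact: shift_cpoly.
move=> x y h; rewrite /nabla /shift (dg _ (y - v)) ?(dg x y) // => l jl.
by rewrite !mxE h.
Qed.

Lemma cpoly_fromZ n j a (g : 'rV[R]_n -> C) : cpoly_from j g -> cpoly_from j (fun x => a * g x).
Proof.
by move=> [pg dg]; split; [exact: polyfun_scale|move=> x y h; rewrite (dg x y)].
Qed.

Lemma cpoly_fromD n j (f g : 'rV[R]_n -> C) : cpoly_from j f -> cpoly_from j g ->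
  cpoly_from j (fun x => f x + g x).
Proof.
move=> [pf df] [pg dg]; split; first exact: polyfun_add.
by move=> x y h; rewrite (df x y) // (dg x y).
Qed.

Lemma cpoly_fromM n j (f g : 'rV[R]_n -> C) : cpoly_from j f -> cpoly_from j g ->
  cpoly_from j (fun x => f x * g x).
Proof.
move=> [pf df] [pg dg]; split; first exact: polyfun_mul.
by move=> x y h; rewrite (df x y) // (dg x y).
Qed.

(* Up to sign, the binomial coefficient (x_j choose k+1); it solves [nabla c_(k+1) = - shift c_k]. *)
Fixpoint binom_coord n (j : 'I_n) k (x : 'rV[R]_n) : C :=
  if k is k'.+1 then binom_coord j k' x * ((x 0 j)%:C%C - k%:R) / (k.+1)%:R else - (x 0 j)%:C%C.

Lemma binom_coord_from n (j : 'I_n) k : cpoly_from j (binom_coord j k).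
Proof.
have c : cpoly_from j (fun x : 'rV[R]_n => (x 0 j)%:C%C).
  by split; [apply: polyfun_gen; exists j|move=> x y ->].
have cst a : cpoly_from j (fun x : 'rV[R]_n => a : C) by split; [exact: polyfun_cst|].
elim: k => [|k IH].
  by rewrite (_ : binom_coord _ _ = fun x => -1 * (x 0 j)%:C%C); [exact: cpoly_fromM|apply/funext => x; rewrite mulN1r].
rewrite (_ : binom_coord _ _ = fun x => binom_coord j k x * ((x 0 j)%:C%C + - k.+1%:R) * (k.+2)%:R^-1) //.
by apply: cpoly_fromM => //; apply: cpoly_fromM => //; apply: cpoly_fromD.
Qed.

Lemma nabla_binom_coord n (j : 'I_n) k :
  nabla (delta_mx 0 j) (binom_coord j k.+1) = fun x => - shift (delta_mx 0 j) (binom_coord j k) x.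
Proof.
have s (x : 'rV[R]_n) : ((x - delta_mx 0 j) 0 j)%:C%C = (x 0 j)%:C%C - 1 :> C.
  by rewrite !mxE !eqxx rmorphB rmorph1.
have nz (m : nat) : (m.+1%:R : C) != 0 by rewrite pnatr_eq0.
have E i w : binom_coord j i.+1 w = binom_coord j i w * ((w 0 j)%:C%C - (i%:R + 1)) / (i%:R + 2).
  by rewrite natr1 -natrD addn2.
have alg (A B X m : C) : m + 3 != 0 -> B * (X - 1 - (m + 1)) = A * (m + 2) ->
    A * (X - 1 - (m + 2)) / (m + 3) - (A + B) * (X - (m + 2)) / (m + 3) = - A.
  move=> m3 h; apply/eqP; rewrite -subr_eq0; apply/eqP.
  transitivity ((A * (m + 2) - B * (X - 1 - (m + 1))) / (m + 3)); first by field.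
  by rewrite h subrr mul0r.
apply/funext => x; elim: k => [|k IH]; rewrite /nabla /shift.
  rewrite /= !s; by field.
set y := x - delta_mx 0 j.
have e : binom_coord j k.+1 x = binom_coord j k.+1 y + binom_coord j k y.
  by move: IH; rewrite /nabla /shift -/y => h; rewrite -[binom_coord j k y]opprK -h; ring.
have e2 : binom_coord j k y * ((x 0 j)%:C%C - 1 - (k%:R + 1)) = binom_coord j k.+1 y * (k%:R + 2).
  have k2 : k%:R + 2 != 0 :> C by rewrite -natrD pnatr_eq0 addnC.
  by rewrite E s divfK.
have k3 : k%:R + 3 != 0 :> C by rewrite -natrD pnatr_eq0 addnC.
rewrite -(alg _ _ _ _ k3 e2) -e.
have e3 w : binom_coord j k.+2 w = binom_coord j k.+1 w * ((w 0 j)%:C%C - (k%:R + 2)) / (k%:R + 3).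
  rewrite E; have -> : k.+1%:R + 1 = k%:R + 2 :> C by rewrite -natr1; ring.
  by have -> : k.+1%:R + 2 = k%:R + 3 :> C by rewrite -natr1; ring.
by rewrite !e3 s.
Qed.

(** Summation by parts with c_k = [binom_coord j k]: the difference of c_k f equals (nabla c_k) f +
    (shift c_k)(nabla f), and shift c_k = - nabla c_(k+1). The problem for f thus reduces to one for
    nabla f, and nabla is nilpotent on f. It starts with nabla c_0 = 1. *)
Lemma shift_antiderivative n (j : 'I_n) (g : 'rV[R]_n -> C) : cpoly_from j g ->
  exists2 h, cpoly_from j h & nabla (delta_mx 0 j) h = g.
Proof.
set v := delta_mx 0 j.
have key d k f : nilp v d f -> cpoly_from j f ->
    exists2 h, cpoly_from j h & nabla v h = fun x => nabla v (binom_coord j k) x * f x.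
  elim: d k f => [|d IH] k f nf pf.
    exists (fun=> 0); first by split; [exact: polyfun_cst|].
    by apply/funext => x; rewrite (_ : f = fun=> 0) // /nabla /shift subrr mulr0.
  have [|h ph eh] := IH k.+1 (nabla v f) _ (nabla_from v pf); first by move: nf; rewrite /nilp iterSr.
  have pb := binom_coord_from j k.
  exists (fun x => binom_coord j k x * f x + h x).
    by apply: cpoly_fromD => //; exact: cpoly_fromM.
  rewrite nablaD nablaM eh nabla_binom_coord; apply/funext => x.
  by rewrite /nabla /shift -/v; ring.
move=> pg; have [d nd] := cpoly_nilp v pg.1.
have [h ph eh] := key d 0%N g nd pg; exists h => //; rewrite eh; apply/funext => x.
have -> : nabla v (binom_coord j 0) x = 1; last by rewrite mul1r.
by rewrite /nabla /shift /= /v !mxE !eqxx rmorphB rmorph1; ring.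
Qed.

(** For a different from 1 the operator is (a - 1) + a nabla, a nonzero scalar plus a nilpotent
    operator on g. The recursion inverts it. *)
Lemma shift_surjective n (j : 'I_n) a (g : 'rV[R]_n -> C) : cpoly_from j g ->
  exists2 h, cpoly_from j h & forall x, a * shift (delta_mx 0 j) h x - h x = g x.
Proof.
have [-> /shift_antiderivative [h ph eh]|a1] := eqVneq a 1.
  by exists h => // x; rewrite mul1r -eh.
set v := delta_mx 0 j; move=> pg; have [d nd] := cpoly_nilp v pg.1.
elim: d g nd pg => [|d IH] g nd pg.
  exists (fun=> 0); first by split; [exact: polyfun_cst|].
  by move=> x; rewrite (_ : g = fun=> 0) // mulr0 subrr.
have a0 : a - 1 != 0 by rewrite subr_eq0.
have [|h ph eh] := IH (nabla v g) _ (nabla_from v pg); first by move: nd; rewrite /nilp iterSr.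
exists (fun x => (a - 1)^-1 * g x + (- (a / (a - 1))) * h x).
  by apply: cpoly_fromD; exact: cpoly_fromZ.
move=> x; have := eh x; rewrite /nabla /shift => e.
transitivity ((a - 1)^-1 * (a * g (x - v) - g x) - a / (a - 1) * (a * h (x - v) - h x)); first by field.
by rewrite e; field.
Qed.
End PolynomialFunctions.

Section PolynomialSpan.
Local Open Scope ring_scope.
Variables (R : realType) (n : nat) (Z : Type).
Local Notation C := R[i].
Implicit Types (P : set ('rV[R]_n -> C)) (E : set (Z -> C)) (F : 'rV[R]_n * Z -> C).

(** The image of P tensor E in the functions of (x, z). *)
Definition pspan P E : set ('rV[R]_n * Z -> C) := [set F |
  exists m (g : 'I_m -> 'rV[R]_n -> C) (w : 'I_m -> Z -> C),
  [/\ forall i, P (g i), forall i, E (w i) & forall x, F x = \sum_i g i x.1 * w i x.2]].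

Lemma pspan0 P E : pspan P E 0.
Proof. by exists 0%N, (fun=> fun=> 0), (fun=> fun=> 0); split=> [[]|[]|x]; rewrite ?big_ord0. Qed.

Lemma pspan1 P E g w : P g -> E w -> pspan P E (fun x => g x.1 * w x.2).
Proof. by move=> Pg Ew; exists 1%N, (fun=> g), (fun=> w); split=> // x; rewrite big_ord1. Qed.

Lemma pspanD P E F F' : pspan P E F -> pspan P E F' -> pspan P E (F + F').
Proof.
move=> [m [g [w [Pg Ew eF]]]] [m' [g' [w' [Pg' Ew' eF']]]].
exists (m + m')%N, (fun i : 'I_(m + m') => match fintype.split i with inl j => g j | inr j => g' j end),
  (fun i : 'I_(m + m') => match fintype.split i with inl j => w j | inr j => w' j end).
split=> [i|i|x]; do ?by case: (fintype.split i).
rewrite fctE eF eF' big_split_ord /=; congr (_ + _); apply: eq_bigr => i _.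
  by rewrite (unsplitK (inl i)).
by rewrite (unsplitK (inr i)).
Qed.

Lemma pspan_sum P E (I : Type) (r : seq I) (F : I -> 'rV[R]_n * Z -> C) :
  (forall i, pspan P E (F i)) -> pspan P E (\sum_(i <- r) F i).
Proof. by move=> h; elim/big_rec: _ => [|i F' _]; [exact: pspan0|exact: pspanD]. Qed.

Lemma pspanZ P E a F : (forall g, P g -> P (fun x => a * g x)) -> pspan P E F ->
  pspan P E (fun x => a * F x).
Proof.
move=> PZ [m [g [w [Pg Ew eF]]]]; exists m, (fun i x => a * g i x), w; split=> // [i|x].
  exact: PZ.
by rewrite eF mulr_sumr; apply: eq_bigr => i _; rewrite mulrA.
Qed.

Lemma pspanS P P' E E' : P `<=` P' -> E `<=` E' -> pspan P E `<=` pspan P' E'.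
Proof.
move=> PP EE F [m [g [w [Pg Ew eF]]]]; exists m, g, w; split=> // i; [exact: PP|exact: EE].
Qed.

Lemma pspan_sumE m (g : 'I_m -> 'rV[R]_n -> C) (w : 'I_m -> Z -> C) F :
  (forall x, F x = \sum_i g i x.1 * w i x.2) -> F = \sum_i (fun x => g i x.1 * w i x.2).
Proof. by move=> h; apply/funext => x; rewrite h fct_sumE. Qed.

(** In an expression with the least number of terms the w_i are linearly independent, so identities
    can be compared coefficient by coefficient. *)
Lemma pspan_independent P E F : (forall f g a, P f -> P g -> P (fun x => f x + a * g x)) ->
  pspan P E F -> exists m (g : 'I_m -> 'rV[R]_n -> C) (w : 'I_m -> Z -> C),
  [/\ forall i, P (g i), forall i, E (w i), forall x, F x = \sum_i g i x.1 * w i x.2 &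
     forall c : 'I_m -> C, (forall z, \sum_i c i * w i z = 0) -> forall i, c i = 0].
Proof.
move=> PD hF.
pose Q m := `[< exists (g : 'I_m -> 'rV[R]_n -> C) (w : 'I_m -> Z -> C),
  [/\ forall i, P (g i), forall i, E (w i) & forall x, F x = \sum_i g i x.1 * w i x.2] >].
have exQ : exists m, Q m by case: hF => m h; exists m; exact/asboolP.
case: (ex_minnP exQ) => m /asboolP [g [w [Pg Ew eF]]] mmin.
exists m, g, w; split=> // c hc i; apply: contrapT => /eqP ci.
case: m => [|m] in g w Pg Ew eF mmin c hc i ci *; first by case: i {ci}.
suff : Q m by move=> /mmin; rewrite ltnn.
apply/asboolP.
exists (fun l x => g (lift i l) x + (- (c (lift i l) / c i)) * g i x), (fun l => w (lift i l)).
split=> // [l|[x z]]; first exact: PD.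
rewrite eF (bigD1_ord i) //=.
have wi : w i z = - \sum_l (c (lift i l) / c i) * w (lift i l) z.
  apply: (mulfI ci); rewrite mulrN mulr_sumr; apply/eqP; rewrite -addr_eq0; apply/eqP.
  rewrite -[RHS](hc z) (bigD1_ord i) //=; congr (_ + _); apply: eq_bigr => l _.
  by rewrite mulrA mulrCA mulfV // mulr1.
rewrite wi mulrN mulr_sumr -sumrN -big_split /=; apply: eq_bigr => l _.
by ring.
Qed.

Variables (aw : (Z -> C) -> Z -> C).
Hypotheses (awD : forall v w, aw (v + w) = aw v + aw w)
  (awZ : forall a w, aw (fun z => a * w z) = fun z => a * aw w z).

Lemma aw_sum m (c : 'I_m -> C) (w : 'I_m -> Z -> C) :
  aw (fun z => \sum_i c i * w i z) = fun z => \sum_i c i * aw (w i) z.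
Proof.
have aw0 : aw 0 = 0 by apply: (addrI (aw 0)); rewrite -awD !addr0.
have -> : (fun z => \sum_i c i * w i z) = \sum_i (fun z => c i * w i z).
  by apply/funext => z; rewrite fct_sumE.
have -> : (fun z => \sum_i c i * aw (w i) z) = \sum_i (fun z => c i * aw (w i) z).
  by apply/funext => z; rewrite fct_sumE.
by elim/big_rec2: _ => [//|i v u _ <-]; rewrite awD awZ.
Qed.

Definition translate_act (v : 'rV[R]_n) F : 'rV[R]_n * Z -> C :=
  fun x => aw (fun z => F (x.1 - v, z)) x.2.

Lemma translate_act_span m (g : 'I_m -> 'rV[R]_n -> C) (w : 'I_m -> Z -> C) v F :
  (forall x, F x = \sum_i g i x.1 * w i x.2) ->
  forall x, translate_act v F x = \sum_i g i (x.1 - v) * aw (w i) x.2.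
Proof.
move=> eF x; have e := aw_sum (fun i => g i (x.1 - v)) w.
by rewrite -[RHS](congr1 (fun f => f x.2) e) /translate_act; congr aw; apply/funext => z; rewrite eF.
Qed.

(** With independent eigenvectors w_i of eigenvalue a_i, invariance means a_i g_i(x - v) = g_i(x)
    for each i. So either g_i = 0, or a_i = 1 and g_i does not involve the j-th coordinate. *)
Lemma translate_act_invariant (j : 'I_n) E F : (forall w, E w -> exists a, aw w = fun z => a * w z) ->
  pspan (cpoly_from j) E F -> translate_act (delta_mx 0 j) F = F ->
  pspan (cpoly_from j.+1) [set w | E w /\ aw w = w] F.
Proof.
move=> hE hF invF.
have [|m [g [w [Pg Ew eF ind]]]] := pspan_independent _ hF.
  by move=> f g a pf pg; apply: cpoly_fromD => //; exact: cpoly_fromZ.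
have /choice [a ha] := fun i => hE _ (Ew i).
rewrite (pspan_sumE eF); apply: pspan_sum => i.
have eg x l : a l * g l (x - delta_mx 0 j) - g l x = 0.
  apply: (ind (fun l => a l * g l (x - delta_mx 0 j) - g l x)) => z.
  have := congr1 (fun F => F (x, z)) invF; rewrite (translate_act_span _ eF) eF /= => h.
  apply/eqP; rewrite -[X in _ == X](subrr (\sum_i g i x * w i z)) -{1}h -sumrB.
  by apply/eqP; apply: eq_bigr => l' _; rewrite ha; ring.
have [[a1 cg]|g0] := shift_eigen (v := delta_mx 0 j) (a := a i) (Pg i).1 (fun x => subr0_eq (eg x i)).
  apply: pspan1; last by split=> //; rewrite ha a1; apply/funext => z; rewrite mul1r.
  split; first by have [] := Pg i.
  move=> x y h; rewrite -(cg x (y 0 j - x 0 j)); have [_ dg] := Pg i.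
  apply: dg => l jl; rewrite !mxE eqxx /=; have [->|lj] := eqVneq l j.
    by rewrite mulr1 addrC subrK.
  by rewrite mulr0 addr0 h // ltn_neqAle jl andbT eq_sym.
by rewrite g0 (_ : (fun x => _) = 0); [exact: pspan0|apply/funext => x; rewrite mul0r].
Qed.

Lemma translate_act_surjective (j : 'I_n) E F : (forall w, E w -> exists a, aw w = fun z => a * w z) ->
  pspan (cpoly_from j) E F -> exists2 F', pspan (cpoly_from j) E F' &
  translate_act (delta_mx 0 j) F' - F' = F.
Proof.
move=> hE [m [g [w [Pg Ew eF]]]].
have /choice [a ha] := fun i => hE _ (Ew i).
have /choice [h hP] : forall i, exists h, cpoly_from j h /\
    forall x, a i * h (x - delta_mx 0 j) - h x = g i x.
  by move=> i; have [h ph eh] := shift_surjective (a i) (Pg i); exists h.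
pose F' (x : 'rV[R]_n * Z) := \sum_i h i x.1 * w i x.2.
have eF' x : F' x = \sum_i h i x.1 * w i x.2 by [].
exists F'; first by exists m, h, w; split=> // i; have [] := hP i.
apply/funext => x; rewrite !fctE (translate_act_span _ eF') eF eF' -sumrB.
by apply: eq_bigr => i _; have [_ <-] := hP i; rewrite ha; ring.
Qed.
End PolynomialSpan.

Section LatticeCohomology.
Local Open Scope ring_scope.
Variables (R : realType) (G : groupType) (Z : Type) (k n : nat).
Local Notation C := R[i].
Local Notation X := ('rV[R]_(k + n) * Z)%type.
Variables (aw : G -> (Z -> C) -> Z -> C) (act : G -> (X -> C) -> X -> C).
Hypotheses (act1 : forall a, act 1%g a = a)
  (actM : forall g h a, act (g * h)%g a = act g (act h a))
  (actD : forall g a b, act g (a + b) = act g a + act g b)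
  (actZ : forall g k a, act g (fun x => k * a x) = fun x => k * act g a x)
  (aw1 : forall w, aw 1%g w = w)
  (awM : forall g h w, aw (g * h)%g w = aw g (aw h w))
  (awD : forall g v w, aw g (v + w) = aw g v + aw g w)
  (awZ : forall g a w, aw g (fun z => a * w z) = fun z => a * aw g w z).
Variables (K K' : set G) (e : G -> 'rV[int]_k) (E : set (Z -> C)).
Local Notation M := (pspan (@cpoly R (k + n)) E).
Hypotheses (Mact : forall g a, M a -> M (act g a))
  (sK : subgroup K) (sK' : subgroup K') (KK' : K' `<=` K) (nK' : normalizes [set: G] K')
  (eM : hom_on K e) (eK : forall x, K x -> (e x = 0 <-> K' x))
  (esur : forall v, exists2 a, K a & e a = v)
  (actK : forall g F, K g -> act g F = translate_act (aw g) (row_mx (map_mx intr (e g)) 0) F)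
  (EK : forall g w, K g -> E w -> exists a, aw g w = fun z => a * w z)
  (EK' : forall g w, K' g -> E w -> aw g w = w).

(** A filtration from H 0 = K' to H k = K with infinite cyclic quotients, to which the cyclic case
    and transitivity apply in turn. *)
Let H j : set G := [set g | K g /\ forall l : 'I_k, (j <= l)%N -> e g 0 l = 0].
Let EH j : set (Z -> C) := [set w | E w /\ forall g, H j g -> aw g w = w].

Let sH j : subgroup (H j).
Proof.
split.
- by split=> [|l _]; [exact: subgroup1|rewrite (hom_on1 sK eM) mxE].
- move=> x y [Kx hx] [Ky hy]; split=> [|l jl]; first exact: subgroupM.
  by rewrite eM // mxE hx // hy // addr0.
- move=> x [Kx hx]; split=> [|l jl]; first exact: subgroupV.
  by rewrite (hom_onV sK eM Kx) mxE hx // oppr0.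
Qed.

Let HS j : H j `<=` H j.+1.
Proof. by move=> g [Kg h]; split=> // l jl; apply: h; exact: ltnW. Qed.

Let H0 : H 0%N = K'.
Proof.
apply/seteqP; split=> g.
  by move=> [Kg h]; apply/eK => //; apply/rowP => l; rewrite mxE h.
by move=> K'g; split=> [|l _]; [exact: KK'|have -> : e g = 0 by apply/eK => //; exact: KK']; rewrite ?mxE.
Qed.

Let Hk : H k = K.
Proof.
by apply/seteqP; split=> g => [[]//|Kg]; split=> // l; rewrite leqNgt ltn_ord.
Qed.

Let nH j : normalizes (H j.+1) (H j).
Proof.
move=> g x [Kg _] [Kx hx]; have Kg' := subgroupV sK Kg; split=> [|l jl].
  by apply: subgroupM => //; exact: subgroupM.
rewrite !eM // ?(hom_onV sK eM Kg); last exact: subgroupM.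
by rewrite addrAC subrr add0r hx.
Qed.

Let step j (jk : (j < k)%N) : exists b, [/\ H j.+1 b, e b = delta_mx 0 (Ordinal jk) &
  forall F, act b F = translate_act (aw b) (delta_mx 0 (lshift n (Ordinal jk))) F].
Proof.
have [b Kb eb] := esur (delta_mx 0 (Ordinal jk)); exists b; split=> // [|F].
  split=> // l jl; rewrite eb mxE eqxx /= -val_eqE /=.
  by rewrite gtn_eqF.
rewrite actK // eb; suff -> : row_mx (map_mx intr (delta_mx 0 (Ordinal jk))) 0 = delta_mx 0 (lshift n (Ordinal jk)) :> 'rV[R]_(k + n) by [].
apply/rowP => l.
rewrite [RHS]mxE eqxx /=; case: (splitP l) => i li.
  have -> : l = lshift n i by exact: ord_inj.
  by rewrite row_mxEl !mxE eqxx /= (inj_eq (@lshift_inj _ _)); case: (_ == _).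
have -> : l = rshift k i by exact: ord_inj.
by rewrite row_mxEr mxE eq_rlshift.
Qed.

Let ind j (jk : (j < k)%N) b : H j.+1 b -> e b = delta_mx 0 (Ordinal jk) ->
  forall P : set G, subgroup (H j.+1 `&` P) -> P b -> H j `<=` P -> forall h, H j.+1 h -> P h.
Proof.
move=> Hb eb P; apply: (cyclic_ind (e := fun g => e g 0 (Ordinal jk)) (sH j) (sH j.+1) (@HS j) Hb).
- by move=> g h [Kg _] [Kh _]; rewrite eM // mxE.
- by rewrite eb mxE !eqxx.
- move=> g [Kg hg]; split=> [e0|[_ h]]; last by apply: h.
  split=> // l; rewrite leq_eqVlt => /orP [/eqP jl|]; last exact: hg.
  by rewrite -e0; congr (e g 0 _); apply: val_inj.
Qed.

(** An explicit description of the H j-invariants is carried along the filtration, because the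
    cyclic case needs b - 1 to be onto these invariants and not merely onto all functions. *)
Let invariants j : (j <= k)%N -> forall F, M F -> fixed_by act (H j) F -> pspan (cpoly_from j) (EH j) F.
Proof.
elim: j => [_ F MF _|j IH jk F MF fF].
  apply: pspanS MF => [g pg|w Ew].
    by split=> // x y h; congr g; apply/rowP => l; exact: h.
  by split=> // g; rewrite H0 => K'g; exact: EK'.
have [b [Hb eb actb]] := step jk.
have hF := IH (ltnW jk) F MF (fun g Hg => fF g (HS Hg)).
have := translate_act_invariant (awD b) (awZ b) (j := lshift n (Ordinal jk)) (E := EH j) _ hF.
rewrite -actb => /(_ _ (fF b Hb)) h; apply: pspanS (h _); last first.
- by move=> w [Ew _]; apply: EK => //; case: Hb.
- move=> w [[Ew hw] bw]; split=> //; apply: (ind Hb eb) => //.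
  split.
  - by split; [exact: subgroup1|exact: aw1].
  - move=> g h' [Hg eg] [Hh eh]; split; first exact: subgroupM.
    by rewrite /= awM eh.
  - move=> g [Hg eg]; split; first exact: subgroupV.
    by rewrite /= -{1}eg -awM mulVg aw1.
- by [].
Qed.

Let invariantsP j F : (j <= k)%N -> pspan (cpoly_from j) (EH j) F -> M F /\ fixed_by act (H j) F.
Proof.
move=> jk hF; split; first by apply: pspanS hF => [g []|w []].
have [m [g [w [Pg Ew eF]]]] := hF.
move=> h Hh; have [Kh eh] := Hh; rewrite actK //; apply/funext => x.
rewrite (translate_act_span (awD h) (awZ h) _ eF) eF; apply: eq_bigr => i _.
have [_ ->] := Ew i; last by [].
congr (_ * _); have [_ dg] := Pg i; apply: dg => l jl; rewrite !mxE.
case: (splitP l) => i' li; last by rewrite mxE subr0.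
by rewrite mxE eh ?subr0 // -li.
Qed.

Let surj j (jk : (j < k)%N) b : H j.+1 b ->
  (forall F, act b F = translate_act (aw b) (delta_mx 0 (lshift n (Ordinal jk))) F) ->
  forall F, M F -> fixed_by act (H j) F ->
  exists m, [/\ M m, fixed_by act (H j) m & act b m - m = F].
Proof.
move=> Hb actb F MF fF; have hF := invariants (ltnW jk) MF fF.
have [|m hm em] := translate_act_surjective (awD b) (awZ b) (j := lshift n (Ordinal jk)) _ hF.
  by move=> w [Ew _]; apply: EK => //; case: Hb.
have [Mm fm] := invariantsP (ltnW jk) hm.
by exists m; split=> //; rewrite actb.
Qed.

Let MZ a F : M F -> M (fun x => a * F x).
Proof. by apply: pspanZ => g; exact: polyfun_scale. Qed.

Let triv j : (j <= k)%N -> H1_trivial act M (H j) K' /\ H2_trivial act M (H j) K'.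
Proof.
elim: j => [_|j IH jk].
  rewrite H0; split; first apply: finite_H1_trivial => //; last apply: finite_H2_trivial => //.
  all: do ?[exact: pspanD|exact: MZ|exact: pspan0|exact: finite_index_refl|exact: normalizes_sub nK'].
have [h1 h2] := IH (ltnW jk).
have [b [Hb eb actb]] := step jk.
pose e' g := e g 0 (Ordinal jk).
have e'M g h : H j.+1 g -> H j.+1 h -> e' (g * h)%g = e' g + e' h.
  by move=> [Kg _] [Kh _]; rewrite /e' eM // mxE.
have e'b : e' b = 1 by rewrite /e' eb mxE !eqxx.
have e'K g : H j.+1 g -> (e' g = 0 <-> H j g).
  move=> [Kg hg]; split=> [e0|[_ h]]; last by apply: h.
  split=> // l; rewrite leq_eqVlt => /orP [/eqP jl|]; last exact: hg.
  by rewrite -e0; congr (e g 0 _); apply: val_inj.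
have sb := surj Hb actb.
have MD := @pspanD R (k + n) Z (@cpoly R (k + n)) E.
have c1 := cyclic_H1_trivial act1 actM actD (sH j) (sH j.+1) (@HS j) (@nH j) Hb e'M e'b e'K sb.
have c2 := cyclic_H2_trivial act1 actM actD MD MZ Mact (sH j) (sH j.+1) (@HS j) (@nH j) Hb e'M e'b e'K.
have K'H i : K' `<=` H i.
  by move=> g K'g; split=> [|l _]; [exact: KK'|rewrite (eK (KK' K'g)).2 // mxE].
split; first exact: (H1_trivial_trans actM actD MD MZ Mact (@HS j) (@K'H j) h1 c1).
apply: (H2_trivial_trans actM actD MD MZ Mact _ sK' (sH j) (sH j.+1) (@K'H j) (@HS j) _ (@nH j) h1 h2 c2).
  exact: pspan0.
exact: normalizes_sub nK'.
Qed.

Lemma lattice_cohomology : [/\ H1_trivial act M K K', H2_trivial act M K K' &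
  forall F, M F -> fixed_by act K F -> pspan (cpoly_from k) [set w | E w /\ forall g, K g -> aw g w = w] F].
Proof.
by have [h1 h2] := triv (leqnn k); rewrite -Hk; split=> // F; exact: invariants.
Qed.
End LatticeCohomology.

(** * Polynomial maps, complexification and coefficient modules *)

Section PolynomialMaps.
Local Open Scope ring_scope.
Variable F : comNzRingType.

Definition coords n : set ('rV[F]_n -> F) := [set f | exists i, f = fun x : 'rV[F]_n => x 0 i].

Definition coords2 (K : comNzRingType) (X Y : Type) (S : set (X -> K)) (T : set (Y -> K)) : set (X * Y -> K) :=
  [set h | (exists2 f, S f & h = f \o fst) \/ (exists2 g, T g & h = g \o snd)].

Definition polymap (X : Type) (S : set (X -> F)) n (h : X -> 'rV[F]_n) :=
  forall i, polyfun S (fun x => h x 0 i).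

Section Operations.
Variables (X : Type) (S : set (X -> F)).

Lemma polymap_cst n (a : 'rV[F]_n) : polymap S (fun=> a).
Proof. by move=> i; exact: polyfun_cst. Qed.

Lemma polymapD n (f g : X -> 'rV[F]_n) : polymap S f -> polymap S g -> polymap S (fun x => f x + g x).
Proof.
move=> pf pg i; have := polyfun_add (pf i) (pg i).
by congr polyfun; apply/funext => x; rewrite mxE.
Qed.

Lemma polymapN n (f : X -> 'rV[F]_n) : polymap S f -> polymap S (fun x => - f x).
Proof.
move=> pf i; have := polyfun_opp (pf i).
by congr polyfun; apply/funext => x; rewrite mxE.
Qed.

Lemma polymapM n m (f : X -> 'rV[F]_n) (A : 'M[F]_(n, m)) : polymap S f -> polymap S (fun x => f x *m A).
Proof.
move=> pf i; rewrite (_ : (fun x => _) = fun x => \sum_j f x 0 j * A j i); last first.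
  by apply/funext => x; rewrite mxE.
by apply: polyfun_sum => j; apply: polyfun_mul (pf j) _; exact: polyfun_cst.
Qed.

Lemma polymap_row n m (f : X -> 'rV[F]_n) (g : X -> 'rV[F]_m) :
  polymap S f -> polymap S g -> polymap S (fun x => row_mx (f x) (g x)).
Proof.
move=> pf pg i; rewrite (_ : (fun x => _) = fun x => match fintype.split i with inl j => f x 0 j | inr j => g x 0 j end).
  by case: (fintype.split i) => j.
by apply/funext => x; rewrite mxE; case: (fintype.split i).
Qed.

Lemma polymap_lsub n m (f : X -> 'rV[F]_(n + m)) : polymap S f -> polymap S (fun x => lsubmx (f x)).
Proof. by move=> pf i; have := pf (lshift m i); congr polyfun; apply/funext => x; rewrite mxE. Qed.

Lemma polymap_rsub n m (f : X -> 'rV[F]_(n + m)) : polymap S f -> polymap S (fun x => rsubmx (f x)).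
Proof. by move=> pf i; have := pf (rshift n i); congr polyfun; apply/funext => x; rewrite mxE. Qed.

Lemma polyfun_at n (f : X -> 'rV[F]_n) g : polymap S f -> polyfun (@coords n) g -> polyfun S (fun x => g (f x)).
Proof. by move=> pf; apply: polyfun_comp => _ [i ->]; exact: pf. Qed.

Lemma polymap_at n m (f : X -> 'rV[F]_n) (g : 'rV[F]_n -> 'rV[F]_m) :
  polymap S f -> polymap (@coords n) g -> polymap S (fun x => g (f x)).
Proof. by move=> pf pg i; exact: (polyfun_at pf (pg i)). Qed.

Lemma polyfun_at2 n m (f : X -> 'rV[F]_n) (f' : X -> 'rV[F]_m) g : polymap S f -> polymap S f' ->
  polyfun (coords2 (@coords n) (@coords m)) g -> polyfun S (fun x => g (f x, f' x)).
Proof.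
move=> pf pf'; apply: (polyfun_comp (h := fun x => (f x, f' x))) => h.
by case=> [[_ [i ->] ->]|[_ [i ->] ->]]; [exact: pf|exact: pf'].
Qed.

Lemma polymap_at2 n m p (f : X -> 'rV[F]_n) (f' : X -> 'rV[F]_m) (g : 'rV[F]_n * 'rV[F]_m -> 'rV[F]_p) :
  polymap S f -> polymap S f' ->
  polymap (coords2 (@coords n) (@coords m)) g -> polymap S (fun x => g (f x, f' x)).
Proof. by move=> pf pf' pg i; exact: (polyfun_at2 pf pf' (pg i)). Qed.
End Operations.

Lemma polymap_id n : polymap (@coords n) (fun x => x).
Proof. by move=> i; apply: polyfun_gen; exists i. Qed.

Lemma polymap_fst n m : polymap (coords2 (@coords n) (@coords m)) (fun x => x.1).
Proof. by move=> i; apply: polyfun_gen; left; exists (fun x : 'rV_n => x 0 i) => //; exists i. Qed.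

Lemma polymap_snd n m : polymap (coords2 (@coords n) (@coords m)) (fun x => x.2).
Proof. by move=> i; apply: polyfun_gen; right; exists (fun x : 'rV_m => x 0 i) => //; exists i. Qed.
End PolynomialMaps.
#[global] Hint Resolve polymap_id polymap_fst polymap_snd polymap_cst : core.

Section Complexification.
Local Open Scope ring_scope.
Variable R : realType.
Local Notation C := R[i].

Definition complexify (X : Type) (f : X -> R) : X -> C := fun x => (f x)%:C%C.
Definition real_part (X : Type) (f : X -> C) : X -> R := fun x => complex.Re (f x).

Lemma complexifyK (X : Type) (f : X -> R) : real_part (complexify f) = f.
Proof. by []. Qed.

Lemma polyfun_complexify (X : Type) (S : set (X -> R)) (T : set (X -> C)) f :
  (forall g, S g -> polyfun T (complexify g)) -> polyfun S f -> polyfun T (complexify f).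
Proof. exact: (polyfun_map (phi := real_complex R)). Qed.

Lemma polyfun_real_part (X : Type) (S : set (X -> R)) (T : set (X -> C)) f :
  (forall g, T g -> exists2 h, S h & g = complexify h) -> polyfun T f -> polyfun S (real_part f).
Proof.
move=> hT pf; suff: polyfun S (real_part f) /\ polyfun S (fun x => complex.Im (f x)) by case.
elim: pf => [a|g /hT [h Sh ->]|f1 f2 _ [r1 i1] _ [r2 i2]|f1 f2 _ [r1 i1] _ [r2 i2]].
- by split; exact: polyfun_cst.
- by split; [exact: polyfun_gen|exact: polyfun_cst].
- split.
    by have := polyfun_add r1 r2; congr polyfun; apply/funext => x; rewrite /real_part raddfD.
  by have := polyfun_add i1 i2; congr polyfun; apply/funext => x; rewrite raddfD.
- split.
    have := polyfun_sub (polyfun_mul r1 r2) (polyfun_mul i1 i2); congr polyfun; apply/funext => x.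
    by rewrite /real_part; case: (f1 x) (f2 x) => a b [c d].
  have := polyfun_add (polyfun_mul r1 i2) (polyfun_mul i1 r2); congr polyfun; apply/funext => x.
  by rewrite /real_part; case: (f1 x) (f2 x) => a b [c d].
Qed.

Lemma cpoly_complexify n f : polyfun (@coords R n) f -> cpoly (complexify f).
Proof. by apply: polyfun_complexify => _ [i ->]; apply: polyfun_gen; exists i. Qed.
End Complexification.

(* A finite-dimensional linear action z |-> z *m tau g on 'rV_m and phi on the row vectors of length k make
   G act on the functions on 'rV_m * 'I_k, seen as functions from 'rV_m to row vectors. *)
Section Coefficients.
Local Open Scope ring_scope.
Variables (R : realType) (G : groupType) (m k : nat) (tau : G -> 'M[R]_m) (phi : G -> 'M[R]_k).
Local Notation C := R[i].
Local Notation Z := ('rV[R]_m * 'I_k)%type.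
Hypotheses (tau1 : tau 1%g = 1%:M) (tauM : forall g h, tau (g * h)%g = tau h *m tau g)
  (phi1 : phi 1%g = 1%:M) (phiM : forall g h, phi (g * h)%g = phi h *m phi g).

Definition coef_act (g : G) (w : Z -> C) : Z -> C :=
  fun z => \sum_l w (z.1 *m tau g^-1%g, l) * (phi g l z.2)%:C%C.

Lemma coef_act1 w : coef_act 1%g w = w.
Proof.
apply/funext => [[z l]]; rewrite /coef_act /= invg1 tau1 mulmx1 (bigD1 l) //= phi1 mxE eqxx mulr1.
by rewrite big1 ?addr0 // => j /negPf jl; rewrite mxE jl mulr0.
Qed.

Lemma coef_actM g h w : coef_act (g * h)%g w = coef_act g (coef_act h w).
Proof.
apply/funext => [[z l]]; rewrite /coef_act /= invgM tauM phiM mulmxA.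
under eq_bigr => i _ do rewrite mxE rmorph_sum mulr_sumr.
rewrite exchange_big /=; apply: eq_bigr => i _; rewrite mulr_suml.
by apply: eq_bigr => j _; rewrite rmorphM mulrA.
Qed.

Lemma coef_actD g v w : coef_act g (v + w) = coef_act g v + coef_act g w.
Proof.
apply/funext => z; change (coef_act g (v + w) z = coef_act g v z + coef_act g w z).
by rewrite /coef_act -big_split /=; apply: eq_bigr => i _; rewrite -mulrDl.
Qed.

Lemma coef_actZ g a w : coef_act g (fun z => a * w z) = fun z => a * coef_act g w z.
Proof.
by apply/funext => z; rewrite /coef_act mulr_sumr; apply: eq_bigr => i _; rewrite mulrA.
Qed.

Variables (Delta K : set G) (Q : 'M[C]_m) (P : 'M[C]_k).
Hypotheses (sD : subgroup Delta) (nD : normalizes [set: G] Delta)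
  (Qu : Q \in unitmx) (Qd : forall d, Delta d -> is_diag_mx (Q *m map_mx (real_complex R) (tau d) *m invmx Q))
  (Pu : P \in unitmx) (Pd : forall d, Delta d -> is_diag_mx (P *m map_mx (real_complex R) (phi d) *m invmx P))
  (tauK : forall g, K g -> tau g = 1%:M) (phiK : forall g, K g -> phi g = 1%:M) (sK : subgroup K).

(** Only eigenfunctions of every element of Delta are kept. This set is stable under G because Delta
    is normal, and it spans all polynomial coefficients once multiplied by polynomials in x. *)
Definition coef_eigen : set (Z -> C) := [set w | (forall l, cpoly (fun z => w (z, l))) /\
  forall d, Delta d -> exists a, coef_act d w = fun z => a * w z].

Lemma coef_eigen_act g w : coef_eigen w -> coef_eigen (coef_act g w).
Proof.
move=> [pw ew]; split=> [l|d Dd].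
  apply: polyfun_sum => j; apply: polyfun_mul; last exact: (polyfun_cst _ (phi g j l)%:C%C).
  apply: (polyfun_comp (h := fun z => z *m tau g^-1%g) _ (pw j)) => _ [i ->].
  by apply: (cpoly_complexify (f := fun z => (z *m tau g^-1%g) 0 i)); apply: polymapM.
have Dd' : Delta (g^-1 * d * g)%g by apply: normalizesV (subgroupT _) nD _ Dd.
have [a ea] := ew _ Dd'; exists a.
rewrite -coef_actZ -ea -!coef_actM; congr (coef_act _ w); by rewrite !gs.
Qed.

Lemma coef_eigen_fixed g w : K g -> coef_act g w = w.
Proof.
move=> Kg; apply/funext => [[z l]]; rewrite /coef_act /= tauK ?mulmx1; last exact: subgroupV.
rewrite phiK // (bigD1 l) //= mxE eqxx mulr1 big1 ?addr0 // => j /negPf jl.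
by rewrite mxE jl mulr0.
Qed.

Let scal : set ('rV[R]_m -> C) := [set w | cpoly w /\
  forall d, Delta d -> exists a, forall z, w (z *m tau d) = a * w z].

Let lin_scal i : scal (fun z => (map_mx (real_complex R) z *m invmx Q) 0 i).
Proof.
split=> [|d Dd].
  rewrite (_ : (fun z => _) = fun z : 'rV[R]_m => \sum_j (z 0 j)%:C%C * invmx Q j i); last first.
    by apply/funext => z; rewrite mxE; apply: eq_bigr => j _; rewrite mxE.
  apply: polyfun_sum => j; apply: polyfun_mul; last exact: polyfun_cst.
  by apply: polyfun_gen; exists j.
have /is_diag_mxP dg := Qd Dd.
exists ((Q *m map_mx (real_complex R) (tau d) *m invmx Q) i i) => z.
rewrite map_mxM -mulmxA; set T := map_mx _ (tau d); set zc := map_mx _ z.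
rewrite -{1}(mulmxKV Qu zc) -!mulmxA (mulmxA Q) mulmxA mxE (bigD1 i) //= big1 ?addr0; first by rewrite mulrC.
by move=> j ji; rewrite dg ?mulr0.
Qed.

Let pspan_scal n F : polyfun (coords2 (@ccoord R n) (@ccoord R m)) F -> pspan (@cpoly R n) scal F.
Proof.
have cst a : scal (fun=> a) by split; [exact: polyfun_cst|move=> d _; exists 1 => z; rewrite mul1r].
elim=> [a|h|f g _ hf _ hg|f g _ hf _ hg].
- rewrite (_ : (fun=> a) = fun x => a * 1); last by apply/funext => x; rewrite mulr1.
  apply: (pspan1 (g := fun=> a) (w := fun=> 1)) => //; exact: polyfun_cst.
- case=> [[f Sf ->]|[_ [i ->] ->]].
    rewrite (_ : f \o fst = fun x => f x.1 * 1); last by apply/funext => x; rewrite mulr1.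
    by apply: (pspan1 (w := fun=> 1)) => //; exact: polyfun_gen.
  exists m, (fun j=> fun=> Q j i), (fun j z => (map_mx (real_complex R) z *m invmx Q) 0 j); split=> [j|j|x].
  + exact: polyfun_cst.
  + exact: lin_scal.
  + have /matrixP /(_ 0 i) := mulmxKV Qu (map_mx (real_complex R) x.2).
    rewrite mxE [map_mx _ _ _ _]mxE /= => <-; by apply: eq_bigr => j _; rewrite mulrC.
- exact: pspanD.
- have [p [u [w [pu sw ef]]]] := hf; have [p' [u' [w' [pu' sw' eg]]]] := hg.
  rewrite (_ : (fun x => _) = \sum_i \sum_j (fun x => (u i x.1 * u' j x.1) * (w i x.2 * w' j x.2))).
    apply: pspan_sum => i; apply: pspan_sum => j.
    apply: (pspan1 (g := fun x => u i x * u' j x) (w := fun z => w i z * w' j z)).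
      exact: (polyfun_mul (pu i) (pu' j)).
    have [c1 e1] := sw i; have [c2 e2] := sw' j; split; first exact: (polyfun_mul c1 c2).
    move=> d Dd; have [a ea] := e1 d Dd; have [b eb] := e2 d Dd.
    by exists (a * b) => z; rewrite ea eb; ring.
  apply/funext => x; rewrite ef eg fct_sumE mulr_suml; apply: eq_bigr => i _.
  by rewrite fct_sumE mulr_sumr; apply: eq_bigr => j _; ring.
Qed.

(** Coordinates in which [tau] is diagonal are eigenfunctions of Delta, and so are their products;
    the rows of P play the same role for [phi]. Expanding F in both bases writes it as a combination
    of eigenfunctions. *)
Lemma coef_pspan n (F : 'rV[R]_n * Z -> C) :
  (forall l, polyfun (coords2 (@ccoord R n) (@ccoord R m)) (fun x => F (x.1, (x.2, l)))) ->
  pspan (@cpoly R n) coef_eigen F.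
Proof.
move=> pF.
rewrite (_ : F = \sum_j \sum_i fun x => F (x.1, (x.2.1, j)) * invmx P j i * P i x.2.2); last first.
  apply/funext => [[x [z l]]]; rewrite fct_sumE /=.
  transitivity (\sum_j F (x, (z, j)) * (invmx P *m P) j l).
    rewrite mulVmx // (bigD1 l) //= mxE eqxx mulr1 big1 ?addr0 // => j /negPf jl.
    by rewrite mxE jl mulr0.
  apply: eq_bigr => j _; rewrite fct_sumE mxE mulr_sumr; apply: eq_bigr => i _.
  by rewrite mulrA.
apply: pspan_sum => j; apply: pspan_sum => i.
have [p [u [w [pu sw eF]]]] := pspan_scal (pF j).
rewrite (_ : (fun x => _) = \sum_r fun x => (invmx P j i * u r x.1) * (w r x.2.1 * P i x.2.2)); last first.
  apply/funext => [[x [z l]]]; rewrite fct_sumE /= (eF (x, z)) -mulrA mulr_suml.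
  by apply: eq_bigr => r _ /=; ring.
apply: pspan_sum => r.
apply: (pspan1 (g := fun x => invmx P j i * u r x) (w := fun z => w r z.1 * P i z.2)).
  exact: (polyfun_scale _ (pu r)).
have [cw ew] := sw r; split=> [l|d Dd].
  by apply: polyfun_mul => //; exact: (polyfun_cst _ (P i l)).
have [a ea] := ew _ (subgroupV sD Dd); have /is_diag_mxP dg := Pd Dd.
exists (a * (P *m map_mx (real_complex R) (phi d) *m invmx P) i i).
apply/funext => [[z l]]; rewrite /coef_act /= ea.
have /matrixP /(_ i l) := mulmxKV Pu (P *m map_mx (real_complex R) (phi d)).
rewrite mxE (bigD1 i) //= big1 ?addr0; last by move=> h hi; rewrite dg ?mul0r // eq_sym.
move=> e; transitivity (a * w r z * \sum_h P i h * (phi d h l)%:C%C).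
  by rewrite mulr_sumr; apply: eq_bigr => h _; rewrite mulrA.
have <- : (P *m map_mx (real_complex R) (phi d)) i l = \sum_h P i h * (phi d h l)%:C%C.
  by rewrite mxE; apply: eq_bigr => h _; congr (_ * _); rewrite mxE.
by rewrite -e; ring.
Qed.

Lemma pspan_coef n (F : 'rV[R]_n * Z -> C) l : pspan (@cpoly R n) coef_eigen F ->
  polyfun (coords2 (@ccoord R n) (@ccoord R m)) (fun x => F (x.1, (x.2, l))).
Proof.
move=> [p [u [w [pu ew eF]]]].
rewrite (_ : (fun x => _) = fun x => \sum_i u i x.1 * w i (x.2, l)); last by apply/funext => x; rewrite eF.
apply: polyfun_sum => i; apply: polyfun_mul.
  apply: (polyfun_comp (h := fst) _ (pu i)) => f Sf; apply: polyfun_gen; left; by exists f.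
apply: (polyfun_comp (h := snd) _ ((ew i).1 l)) => f Sf; apply: polyfun_gen; right; by exists f.
Qed.
End Coefficients.

(** * Polynomial group laws and affine actions *)

Record polygroup (R : realType) := Polygroup {
  pg_dim : nat;
  pg_mul : 'rV[R]_pg_dim -> 'rV[R]_pg_dim -> 'rV[R]_pg_dim;
  pg_inv : 'rV[R]_pg_dim -> 'rV[R]_pg_dim;
  pg_mulA : associative pg_mul;
  pg_mul0x : left_id 0%R pg_mul;
  pg_mulx0 : right_id 0%R pg_mul;
  pg_mulVx : left_inverse 0%R pg_inv pg_mul;
  pg_mulxV : right_inverse 0%R pg_inv pg_mul;
  pg_mul_poly : polymap (coords2 (@coords R pg_dim) (@coords R pg_dim)) (fun x => pg_mul x.1 x.2);
  pg_inv_poly : polymap (@coords R pg_dim) pg_inv }.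

Definition pg_sort (R : realType) (N : polygroup R) : Type := 'rV[R]_(pg_dim N).
Coercion pg_sort : polygroup >-> Sortclass.
HB.instance Definition _ (R : realType) (N : polygroup R) := Choice.copy (pg_sort N) 'rV[R]_(pg_dim N).
HB.instance Definition _ (R : realType) (N : polygroup R) :=
  isGroup.Build (pg_sort N) (@pg_mulA R N) (@pg_mul0x R N) (@pg_mulx0 R N) (@pg_mulVx R N) (@pg_mulxV R N).

Section AffineRepresentations.
Local Open Scope ring_scope.
Variables (R : realType) (G : groupType).
Local Notation C := R[i].
Local Notation toC := (map_mx (real_complex R)).

(* Automorphisms act on row vectors from the right, whence the reversed product in ar_linM. *)
Record affine_rep := AffineRep {
  ar_group :> polygroup R;
  ar_lin : G -> 'M[R]_(pg_dim ar_group);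
  ar_trans : G -> ar_group;
  ar_lin1 : ar_lin 1%g = 1%:M;
  ar_linM : forall g h, ar_lin (g * h)%g = ar_lin h *m ar_lin g;
  ar_linP : forall g (x y : ar_group), ((x * y)%g : 'rV_(_)) *m ar_lin g =
    ((x *m ar_lin g : ar_group) * (y *m ar_lin g : ar_group))%g;
  ar_transM : forall g h, ar_trans (g * h)%g = (ar_trans g * (ar_trans h *m ar_lin g : ar_group))%g }.

Definition ar_act (A : affine_rep) g (x : A) : A := (ar_trans A g * (x *m ar_lin A g : A))%g.

Definition simul_diag (D : set G) n (t : G -> 'M[R]_n) :=
  exists2 P : 'M[C]_n, P \in unitmx & forall d, D d -> is_diag_mx (P *m toC (t d) *m invmx P).

Definition trivial_on (K : set G) (A : affine_rep) :=
  forall g, K g -> ar_lin A g = 1%:M /\ ar_trans A g = 0.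

Definition fun_act (A : affine_rep) (Z : Type) (aw : G -> (Z -> C) -> Z -> C) g (F : A * Z -> C) : A * Z -> C :=
  fun x => aw g (fun z => F (ar_act g^-1%g x.1, z)) x.2.

(** E is a set of eigenvectors rather than a linear space; the coefficient module itself is the span
    taken by [pspan]. *)
Record coef_system (D K : set G) (Z : Type) (aw : G -> (Z -> C) -> Z -> C) (E : set (Z -> C)) : Prop := CoefSystem {
  cs_1 : forall w, aw 1%g w = w;
  cs_M : forall g h w, aw (g * h)%g w = aw g (aw h w);
  cs_D : forall g v w, aw g (v + w) = aw g v + aw g w;
  cs_Z : forall g a w, aw g (fun z => a * w z) = fun z => a * aw g w z;
  cs_E : forall g w, E w -> E (aw g w);
  cs_diag : forall d w, D d -> E w -> exists a, aw d w = fun z => a * w z;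
  cs_fix : forall g w, K g -> E w -> aw g w = w }.

(* Allowing an auxiliary variable z in an arbitrary set Z covers functions of several points of A with values in a
   representation, once these are written in coordinates x, x^-1 y, ... *)
Definition acyclic (D K : set G) (A : affine_rep) := forall (Z : Type) (aw : G -> (Z -> C) -> Z -> C) (E : set (Z -> C)),
  coef_system D K aw E -> let M := pspan (@cpoly R (pg_dim A)) E in
  [/\ H1_trivial (@fun_act A Z aw) M [set: G] K, H2_trivial (@fun_act A Z aw) M [set: G] K &
   forall F, M F -> fixed_by (@fun_act A Z aw) [set: G] F -> forall x y z, F (x, z) = F (y, z)].

Lemma ar_actM (A : affine_rep) g h (x : A) : ar_act (g * h)%g x = ar_act g (ar_act h x).
Proof. by rewrite /ar_act ar_transM ar_linM ar_linP mulmxA !mulgA. Qed.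

Lemma ar_trans1 (A : affine_rep) : ar_trans A 1%g = 1%g.
Proof.
have := ar_transM A 1%g 1%g; rewrite mulg1 ar_lin1 => h; apply: (mulgI (ar_trans A 1%g)).
by rewrite mulg1 {3}h mulmx1.
Qed.

Lemma ar_act1 (A : affine_rep) (x : A) : ar_act 1%g x = x.
Proof. by rewrite /ar_act ar_trans1 ar_lin1 mulmx1 mul1g. Qed.

Lemma ar_actK (A : affine_rep) g (x : A) : ar_act g^-1%g (ar_act g x) = x.
Proof. by rewrite -ar_actM mulVg ar_act1. Qed.

Lemma ar_actVK (A : affine_rep) g (x : A) : ar_act g (ar_act g^-1%g x) = x.
Proof. by rewrite -ar_actM mulgV ar_act1. Qed.

Lemma ar_linK (A : affine_rep) g (x : A) : x *m ar_lin A g *m ar_lin A g^-1%g = x.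
Proof. by rewrite -mulmxA -ar_linM mulVg ar_lin1 mulmx1. Qed.

Lemma ar_linVK (A : affine_rep) g (x : A) : x *m ar_lin A g^-1%g *m ar_lin A g = x.
Proof. by rewrite -mulmxA -ar_linM mulgV ar_lin1 mulmx1. Qed.

Lemma ar_actMl (A : affine_rep) g (x y : A) : ar_act g (x * y)%g = (ar_act g x * (y *m ar_lin A g : A))%g.
Proof. by rewrite /ar_act ar_linP mulgA. Qed.

Lemma ar_act_poly (A : affine_rep) g : polymap (@coords R (pg_dim A)) (@ar_act A g).
Proof.
apply: (polymap_at2 (f := fun=> ar_trans A g) (f' := fun x => x *m ar_lin A g) _ _ (@pg_mul_poly R A)) => //.
exact: polymapM.
Qed.

Section RealCoefficients.
Variables (A : affine_rep) (D K : set G) (m k : nat) (tau : G -> 'M[R]_m) (phi : G -> 'M[R]_k).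
Hypotheses (acA : acyclic D K A) (sD : subgroup D) (nD : normalizes [set: G] D) (sK : subgroup K)
  (tau1 : tau 1%g = 1%:M) (tauM : forall g h, tau (g * h)%g = tau h *m tau g) (tauD : simul_diag D tau)
  (phi1 : phi 1%g = 1%:M) (phiM : forall g h, phi (g * h)%g = phi h *m phi g) (phiD : simul_diag D phi)
  (tauK : forall g, K g -> tau g = 1%:M) (phiK : forall g, K g -> phi g = 1%:M).
Local Notation n := (pg_dim A).
Local Notation Z := ('rV[R]_m * 'I_k)%type.

Definition real_act (g : G) (F : A * Z -> R) : A * Z -> R :=
  fun x => \sum_l F (ar_act g^-1%g x.1, (x.2.1 *m tau g^-1%g, l)) * phi g l x.2.2.

Definition real_poly : set (A * Z -> R) := [set F |
  forall l, polyfun (coords2 (@coords R n) (@coords R m)) (fun x => F (x.1, (x.2, l)))].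

Let cact := @fun_act A Z (coef_act tau phi).

Let complexify_act g F : cact g (complexify F) = complexify (real_act g F).
Proof.
apply/funext => x; rewrite /cact /fun_act /coef_act /complexify /real_act rmorph_sum.
by apply: eq_bigr => l _; rewrite rmorphM.
Qed.

Let real_part_act g F : real_part (cact g F) = real_act g (real_part F).
Proof.
apply/funext => x; rewrite /cact /fun_act /coef_act /real_part /real_act raddf_sum.
by apply: eq_bigr => l _ /=; case: (F _) => a b /=; rewrite mulr0 subr0.
Qed.

Let complexifyD (X : Type) (f g : X -> R) : complexify (f + g) = complexify f + complexify g.
Proof. by apply/funext => x; exact: rmorphD. Qed.
Let complexifyN (X : Type) (f : X -> R) : complexify (- f) = - complexify f.
Proof. by apply/funext => x; exact: rmorphN. Qed.
Let real_partD (X : Type) (f g : X -> C) : real_part (f + g) = real_part f + real_part g.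
Proof. by apply/funext => x; exact: raddfD. Qed.
Let real_partN (X : Type) (f : X -> C) : real_part (- f) = - real_part f.
Proof. by apply/funext => x; exact: raddfN. Qed.

(** Diagonalising D requires complex coefficients, while the group law to be constructed is real.
    Cocycles are complexified; as the action is real, the real part of a complex primitive is again
    a primitive. *)
Lemma real_cohomology : [/\ H1_trivial real_act real_poly [set: G] K,
  H2_trivial real_act real_poly [set: G] K &
  forall F, real_poly F -> fixed_by real_act [set: G] F -> forall x y z, F (x, z) = F (y, z)].
Proof.
have [Q Qu Qd] := tauD; have [P Pu Pd] := phiD.
pose E := coef_eigen tau phi D.
have cs : coef_system D K (coef_act tau phi) E.
  split.
  - exact: coef_act1.
  - exact: coef_actM.
  - exact: coef_actD.
  - exact: coef_actZ.
  - by move=> g w; exact: coef_eigen_act.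
  - by move=> d w Dd [_]; exact.
  - by move=> g w Kg _; exact: (coef_eigen_fixed tauK phiK sK).
have [h1 h2 h0] := acA cs.
have MC F : real_poly F -> pspan (@cpoly R n) E (complexify F).
  move=> pF; apply: (coef_pspan sD Qu Qd Pu Pd) => l.
  apply: polyfun_complexify (pF l) => _ [[f [i ->] ->]|[f [i ->] ->]]; apply: polyfun_gen.
    by left; exists (fun x => (x 0 i)%:C%C) => //; exists i.
  by right; exists (fun x => (x 0 i)%:C%C) => //; exists i.
have MR F : pspan (@cpoly R n) E F -> real_poly (real_part F).
  move=> /pspan_coef pF l; apply: polyfun_real_part (pF l) => _ [[_ [i ->] ->]|[_ [i ->] ->]].
    by exists (fun x : 'rV[R]_n * 'rV[R]_m => x.1 0 i) => //; left; exists (fun x : 'rV[R]_n => x 0 i) => //; exists i.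
  by exists (fun x : 'rV[R]_n * 'rV[R]_m => x.2 0 i) => //; right; exists (fun x : 'rV[R]_m => x 0 i) => //; exists i.
have fC L F : fixed_by real_act L F -> fixed_by cact L (complexify F).
  by move=> fF g Lg; rewrite complexify_act fF.
split.
- move=> d dM dD dK.
  have [||k' Kk'|m' Mm em] := h1 (fun g => complexify (d g)).
  + by move=> g _; exact: MC (dM g _).
  + by move=> g h _ _; rewrite dD // complexifyD -complexify_act.
  + by rewrite dK //; apply/funext => x; exact: rmorph0.
  exists (real_part m'); first exact: MR.
  move=> g _; rewrite -[LHS]complexifyK em // real_partD real_partN; by rewrite -real_part_act.
- move=> z [zM zK zD].
  have [|c [cM cK] ec] := h2 (fun g h => complexify (z g h)).
    split=> [g h _ _|g h w _ _ Kw|g h w _ _ _].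
    + by have [Mz fz] := zM g h I I; split; [exact: MC|exact: fC].
    + by have [-> ->] := zK g h w I I Kw.
    + by rewrite zD // complexifyD complexifyD complexifyN -complexify_act.
  exists (fun g => real_part (c g)).
    split=> [g _|g w _ Kw]; last by rewrite cK.
    have [Mc fc] := cM g I; split; first exact: MR.
    by move=> h Kh; rewrite -real_part_act; congr real_part; exact: fc.
  move=> g h _ _; rewrite -[LHS]complexifyK ec // /cobound !real_partD real_partN.
  by rewrite -real_part_act.
- move=> F MF fF x y z.
  have := h0 _ (MC _ MF) (fC _ _ fF) x y z.
  by move=> /(congr1 (@complex.Re R)).
Qed.
End RealCoefficients.
End AffineRepresentations.

Section DiagonalBlocks.
Local Open Scope ring_scope.
Lemma simul_diag_block (R : realType) (G : groupType) (D : set G) n m (t : G -> 'M[R]_n) (u : G -> 'M[R]_m) :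
  simul_diag D t -> simul_diag D u -> simul_diag D (fun g => block_mx (t g) 0%R 0%R (u g)).
Proof.
move=> [P Pu Pd] [Q Qu Qd].
have e : block_mx P 0 0 Q *m block_mx (invmx P) 0 0 (invmx Q) = 1%:M.
  by rewrite mulmx_block !mulmx0 !mul0mx !addr0 add0r !mulmxV // -scalar_mx_block.
have [Bu _] := mulmx1_unit e.
exists (block_mx P 0%R 0%R Q) => // d Dd.
have -> : invmx (block_mx P 0 0 Q) = block_mx (invmx P) 0 0 (invmx Q).
  by rewrite -[LHS]mulmx1 -e mulKmx.
rewrite map_block_mx !map_mx0 !mulmx_block !(mulmx0, mul0mx, addr0, add0r).
by rewrite is_diag_block_mx // Pd // Qd // !eqxx.
Qed.
End DiagonalBlocks.

Section ExtensionData.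
Local Open Scope ring_scope.
Variables (R : realType) (G : groupType) (A : affine_rep R G) (D K : set G) (k : nat) (phi : G -> 'M[R]_k).
Hypotheses (acA : acyclic D K A) (sD : subgroup D) (nD : normalizes [set: G] D)
  (sK : subgroup K) (nK : normalizes [set: G] K)
  (phi1 : phi 1%g = 1%:M) (phiM : forall g h, phi (g * h)%g = phi h *m phi g) (phiD : simul_diag D phi)
  (phiK : forall g, K g -> phi g = 1%:M) (KA : trivial_on K A) (linD : simul_diag D (ar_lin A)).
Local Notation n := (pg_dim A).
Local Notation coord2 m := (coords2 (@coords R n) (@coords R m)).
Local Notation t := (ar_lin A).
Local Notation tr := (ar_trans A).

Section Vectors.
Variables (m : nat) (tau : G -> 'M[R]_m).
Hypotheses (tau1 : tau 1%g = 1%:M) (tauM : forall g h, tau (g * h)%g = tau h *m tau g) (tauD : simul_diag D tau)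
  (tauK : forall g, K g -> tau g = 1%:M).

(** A vector-valued function becomes a scalar one by moving its index into the auxiliary
    variable. *)
Let vec (F : A * 'rV[R]_m -> 'rV[R]_k) : A * ('rV[R]_m * 'I_k) -> R := fun x => F (x.1, x.2.1) 0 x.2.2.
Let unvec (F : A * ('rV[R]_m * 'I_k) -> R) : A * 'rV[R]_m -> 'rV[R]_k := fun x => \row_l F (x.1, (x.2, l)).

Let unvecK F : vec (unvec F) = F.
Proof. by apply/funext => [[x [z l]]]; rewrite /vec mxE. Qed.

Let vec_act g F : real_act tau phi g (vec F) =
  vec (fun x => F (ar_act g^-1%g x.1, x.2 *m tau g^-1%g) *m phi g).
Proof. by apply/funext => [[x [z l]]]; rewrite /vec mxE. Qed.

Let vec_poly F : polymap (coord2 m) F -> real_poly (vec F).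
Proof. by move=> pF l; have := pF l; congr polyfun; apply/funext => [[]]. Qed.

Let unvec_poly F : real_poly F -> polymap (coord2 m) (unvec F).
Proof. by move=> pF l; have := pF l; congr polyfun; apply/funext => x; rewrite mxE. Qed.

Lemma vector_H1 (d : G -> A * 'rV[R]_m -> 'rV[R]_k) : (forall g, polymap (coord2 m) (d g)) ->
  (forall g h x, d (g * h)%g x = d g x + d h (ar_act g^-1%g x.1, x.2 *m tau g^-1%g) *m phi g) ->
  (forall g x, K g -> d g x = 0) ->
  exists2 F : A * 'rV[R]_m -> 'rV[R]_k, polymap (coord2 m) F &
    forall g x, d g x = F (ar_act g^-1%g x.1, x.2 *m tau g^-1%g) *m phi g - F x.
Proof.
move=> dP dM dK.
have [h1 _ _] := real_cohomology acA sD nD sK tau1 tauM tauD phi1 phiM phiD tauK phiK.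
have [||g Kg|F pF eF] := h1 (fun g => vec (d g)).
- by move=> g _; exact: vec_poly.
- by move=> g h _ _; rewrite vec_act; apply/funext => x; rewrite /vec dM mxE.
- by apply/funext => x; rewrite /vec dK // mxE.
exists (unvec F); first exact: unvec_poly.
move=> g [x z]; apply/rowP => l.
have := congr1 (fun f => f (x, (z, l))) (eF g I); rewrite -{1}(unvecK F) vec_act /vec /= => ->.
by rewrite [RHS]mxE [X in _ = _ + X]mxE [unvec F (x, z) 0 l]mxE.
Qed.

Lemma vector_H0 (F : A * 'rV[R]_m -> 'rV[R]_k) : polymap (coord2 m) F ->
  (forall g x, F (ar_act g^-1%g x.1, x.2 *m tau g^-1%g) *m phi g = F x) ->
  forall x y z, F (x, z) = F (y, z).
Proof.
move=> pF fF x y z; apply/rowP => l.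
have [_ _ h0] := real_cohomology acA sD nD sK tau1 tauM tauD phi1 phiM phiD tauK phiK.
apply: (h0 (vec F) (vec_poly pF) _ x y (z, l)).
by move=> g _; rewrite vec_act; apply/funext => w; rewrite /vec fF; case: w => ? [].
Qed.

Lemma vector_H2 (z : G -> G -> 'rV[R]_k) :
  (forall g h w, K w -> z (g * w)%g h = z g h /\ z g (h * w)%g = z g h) ->
  (forall g h w, z g (h * w)%g = z g h + z (g * h)%g w - z h w *m phi g) ->
  exists c : G -> A * 'rV[R]_m -> 'rV[R]_k,
  [/\ forall g, polymap (coord2 m) (c g), forall g w, K w -> c (g * w)%g = c g &
      forall g h x, z g h = c h (ar_act g^-1%g x.1, x.2 *m tau g^-1%g) *m phi g - c (g * h)%g x + c g x].
Proof.
move=> zK zD.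
have [_ h2 _] := real_cohomology acA sD nD sK tau1 tauM tauD phi1 phiM phiD tauK phiK.
have [|c [cM cK] ec] := h2 (fun g h => vec (fun=> z g h)).
  split=> [g h _ _|g h w _ _ Kw|g h w _ _ _].
  - split; first by apply: vec_poly; exact: polymap_cst.
    by move=> w Kw; rewrite vec_act phiK //; apply/funext => x; rewrite /vec mulmx1.
  - by have [-> ->] := zK g h w Kw.
  - by rewrite vec_act; apply/funext => x; rewrite /vec zD [LHS]mxE [X in X + _ = _]mxE [X in _ + X = _]mxE.
exists (fun g => unvec (c g)); split.
- by move=> g; apply: unvec_poly; have [] := cM g I.
- by move=> g w Kw; rewrite cK.
- move=> g h [x y]; apply/rowP => l.
  have := congr1 (fun f => f (x, (y, l))) (ec g h I I).
  rewrite /cobound -{1}(unvecK (c h)) vec_act /vec /= => ->.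
  by rewrite [RHS]mxE [X in _ = X + _]mxE [X in _ = _ + X + _]mxE [unvec (c (g * h)%g) _ 0 l]mxE [unvec (c g) _ 0 l]mxE.
Qed.
End Vectors.

Variable eps : G -> 'rV[R]_k.
Hypotheses (epsM : forall g h, K g -> K h -> eps (g * h)%g = eps g + eps h)
  (epsJ : forall g x, K x -> eps (g * x * g^-1)%g = eps x *m phi g).

Let coset_section : exists s : G -> G, (forall g, K (g * (s g)^-1)%g) /\ forall g w, K w -> s (g * w)%g = s g.
Proof.
have ex g : exists y, K (y^-1 * g)%g by exists g; rewrite mulVg; exact: subgroup1.
pose s g := xget 1%g [set y | K (y^-1 * g)%g].
exists s; split=> [g|g w Kw].
  have : K ((s g)^-1 * g)%g by exact: (@xgetPex _ 1%g [set y | K (y^-1 * g)%g] (ex g)).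
  by move=> /(nK (g := s g) I); rewrite !gs.
rewrite /s; congr xget; apply/seteqP; split=> y /=.
  by move=> h; have := subgroupM sK h (subgroupV sK Kw); rewrite !gs.
by move=> h; rewrite mulgA; exact: subgroupM.
Qed.

(* eps defines a 2-cocycle of G / K with constant values. It is a coboundary in polynomial functions, so eps extends
   to G as a crossed homomorphism h with polynomial values. *)
Lemma extended_hom : exists h : G -> A -> 'rV[R]_k, [/\ forall g, polymap (@coords R n) (h g),
  forall g d x, h (g * d)%g x = h g x + h d (ar_act g^-1%g x) *m phi g &
  forall g x, K g -> h g x = - eps g].
Proof.
have [s [sP sK']] := coset_section.
(* [kk] is the factor set of G over G / K for the section s, and [e1] its cocycle identity after
   [eps]. By [e2], [eps (ka g)] fails to be a crossed homomorphism exactly by [eps (kk g h)], which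
   the primitive c of this cocycle compensates. *)
pose ka g := (g * (s g)^-1)%g.
pose kk g h := (s g * s h * (s (g * h))^-1)%g.
have Kka g : K (ka g) by exact: sP.
have phis g : phi (s g) = phi g.
  by rewrite -[in RHS](mulgVK (s g) g) phiM (phiK (sP g)) mulmx1.
have Kkk g h : K (kk g h).
  have -> : kk g h = ((ka g)^-1 * (g * (ka h)^-1 * g^-1) * ka (g * h))%g by rewrite /kk /ka !gs.
  by do 2?[apply: subgroupM => //]; [exact: subgroupV|apply: nK => //; exact: subgroupV].
have e1 g h w : eps (kk g h) + eps (kk (g * h)%g w) = eps (kk h w) *m phi g + eps (kk g (h * w)%g).
  rewrite -(phis g) -epsJ // -!epsM //; last by apply: nK.
  by congr eps; rewrite /kk !gs.
have e2 g h : eps (ka (g * h)%g) = eps (ka g) + eps (ka h) *m phi g + eps (kk g h).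
  rewrite -(phis g) -epsJ // -!epsM //; [|by apply: subgroupM => //; exact: nK|exact: nK].
  by congr eps; rewrite /ka /kk !gs.
(* There is no auxiliary point here, hence a zero-dimensional representation. *)
pose tau (_ : G) : 'M[R]_0 := 1%:M.
have t0 : simul_diag D tau.
  by exists 1%:M; [exact: unitmx1|move=> d _; apply/is_diag_mxP => -[]].
have tM g h : tau (g * h)%g = tau h *m tau g by rewrite mulmx1.
have [||c [cP cK ec]] := vector_H2 (tau := tau) erefl tM t0 (fun _ _ => erefl) (z := fun g h => eps (kk g h)).
- move=> g h w Kw; rewrite /kk; split; last by rewrite (sK' h w Kw) [(g * (h * w))%g]mulgA (sK' _ w Kw).
  have -> : (g * w * h = g * h * (h^-1 * w * h))%g by rewrite !gs.
  by rewrite (sK' g w Kw) (sK' _ _ (normalizesV (subgroupT _) nK I Kw)).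
- by move=> g h w; rewrite e1 addrAC subrr add0r.
have c1 x : c 1%g x = eps (s 1%g).
  have := ec 1%g 1%g x; rewrite /kk mulg1 !gs => ->.
  rewrite ar_act1 phi1 !mulmx1; case: x => x y /=.
  by rewrite subrK.
exists (fun g x => - (eps (ka g) + c g (x, 0))); split.
- move=> g; apply: polymapN; apply: polymapD => //.
  by apply: (polymap_at2 (f := fun x => x) (f' := fun=> 0) _ _ (cP g)).
- move=> g d x; have := ec g d (x, 0); rewrite /= mul0mx => h.
  have E (u v a b w : 'rV[R]_k) : u + v + (a - b + w) + b = u + w + (v + a).
    by apply/rowP => i; rewrite !mxE; ring.
  by rewrite e2 mulNmx -opprD mulmxDl h E.
- move=> g x Kg.
  have s1 : s g = s 1%g by rewrite -[g in LHS]mul1g sK'.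
  have -> : c g = c 1%g by rewrite -[g in LHS]mul1g cK.
  have h1 : K (s 1%g) by have := subgroupV sK (Kka 1%g); rewrite /ka !gs.
  by rewrite c1 -epsM // /ka s1 !gs.
Qed.

(* The cocycle g |-> h g y - h g x, read in the coordinates (x, z = x^-1 y), is the coboundary of psi. *)
Lemma equivariant_potential (h : G -> A -> 'rV[R]_k) : (forall g, polymap (@coords R n) (h g)) ->
  (forall g d x, h (g * d)%g x = h g x + h d (ar_act g^-1%g x) *m phi g) ->
  (forall g x y, K g -> h g x = h g y) ->
  exists psi : A -> A -> 'rV[R]_k, [/\ polymap (coord2 n) (fun x => psi x.1 x.2), forall x, psi x 1%g = 0 &
    forall g x z, h g (ar_act g x * (z *m t g : A))%g - h g (ar_act g x) =
      psi x z *m phi g - psi (ar_act g x) (z *m t g)].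
Proof.
move=> hP hM hK.
have tK g : K g -> t g = 1%:M by move=> /KA [].
have [||g [x z] Kg|F pF eF] := vector_H1 (ar_lin1 A) (ar_linM A) linD tK
    (d := fun g x => h g (x.1 * x.2 : A)%g - h g x.1).
- move=> g; apply: polymapD.
    exact: (polymap_at (@pg_mul_poly R A) (hP g)).
  by apply: polymapN; exact: (polymap_at (@polymap_fst _ n n) (hP g)).
- move=> g d [x z] /=; rewrite !hM ar_actMl mulmxBl.
  by apply/rowP => i; rewrite !mxE; ring.
- by rewrite (hK g _ x) // subrr.
(* Normalisation at z = 1. The subtracted function of x transforms equivariantly because the cocycle
   vanishes for z = 1. *)
exists (fun x z => F (x, z) - F (x, 0)); split.
- apply: polymapD; first by rewrite (_ : (fun x => _) = F) //; apply/funext => [[]].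
  by apply: polymapN; apply: (polymap_at2 _ _ pF) => //; exact: polymap_fst.
- by move=> x; rewrite subrr.
- move=> g x z.
  have := eF g (ar_act g x, z *m t g); rewrite /= ar_actK ar_linK => ->.
  have := eF g (ar_act g x, 0); rewrite /= ar_actK mul0mx (mulg1 (ar_act g x)) subrr => e0.
  by rewrite mulmxBl -[F (ar_act g x, 0)]add0r e0; apply/rowP => i; rewrite !mxE; ring.
Qed.

(* With h and psi as above, C3 is the coboundary of psi. It is G-invariant, hence independent of its base point x,
   and this independence is what makes f := C3 1 a 2-cocycle. *)
Theorem extension_data : exists (f : A -> A -> 'rV[R]_k) (nu : G -> 'rV[R]_k),
  [/\ polymap (coord2 n) (fun x => f x.1 x.2),
      forall x, f 1%g x = 0 /\ f x 1%g = 0,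
      forall x y z, f x y + f (x * y)%g z = f y z + f x (y * z)%g,
      forall g (x y : A), f (x *m t g) (y *m t g) = f x y *m phi g &
      (forall g d, nu (g * d)%g = nu g + nu d *m phi g + f (tr g) (tr d *m t g)) /\
      forall g, K g -> nu g = eps g].
Proof.
have [h [hP hM hK]] := extended_hom.
have [|psi [pP p0 pE]] := equivariant_potential hP hM; first by move=> g x y Kg; rewrite !hK.
(* In the coordinates (x, x^-1 y) of psi, this is its coboundary on the triple x, x a, x a b. *)
pose C3 (x a b : A) := psi (x * a)%g b - psi x (a * b)%g + psi x a.
have C3_inv g (x a b : A) : C3 (ar_act g x) (a *m t g) (b *m t g) = C3 x a b *m phi g.
  have E (h1 h2 h3 u u' v v' w w' : 'rV[R]_k) : h1 - h2 = u - u' -> h1 - h3 = v - v' -> h2 - h3 = w - w' ->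
      u' - v' + w' = u - v + w.
    move=> e1 e2 e3.
    have -> : u' = u - (h1 - h2) by rewrite e1 opprB addrC subrK.
    have -> : v' = v - (h1 - h3) by rewrite e2 opprB addrC subrK.
    have -> : w' = w - (h2 - h3) by rewrite e3 opprB addrC subrK.
    by apply/rowP => i; rewrite !mxE; ring.
  have e1 := pE g (x * a)%g b; have e2 := pE g x (a * b)%g; have e3 := pE g x a.
  rewrite -!ar_actMl in e1 e2 e3; rewrite mulgA in e2.
  by rewrite /C3 -ar_linP -ar_actMl mulmxDl mulmxBl; exact: E e1 e2 e3.
have C3_poly : polymap (coord2 (n + n)) (fun x => C3 x.1 (lsubmx x.2) (rsubmx x.2)).
  have l1 := polymap_lsub (@polymap_snd R n (n + n)); have l2 := polymap_rsub (@polymap_snd R n (n + n)).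
  have l0 := @polymap_fst R n (n + n).
  apply: polymapD; first apply: polymapD.
  - exact: (polymap_at2 (polymap_at2 l0 l1 (@pg_mul_poly R A)) l2 pP).
  - by apply: polymapN; exact: (polymap_at2 l0 (polymap_at2 l1 l2 (@pg_mul_poly R A)) pP).
  - exact: (polymap_at2 l0 l1 pP).
have C3_const x y a b : C3 x a b = C3 y a b.
  (* The pair (a, b) is the auxiliary variable, on which G acts by two copies of its linear part. *)
  pose tau g := block_mx (t g) 0 0 (t g).
  have tau1 : tau 1%g = 1%:M by rewrite /tau ar_lin1 -scalar_mx_block.
  have tauM g d : tau (g * d)%g = tau d *m tau g.
    by rewrite /tau ar_linM mulmx_block !(mulmx0, mul0mx, addr0, add0r).
  have tauK g : K g -> tau g = 1%:M.
    by move=> /KA [tg1 _]; rewrite /tau tg1 -scalar_mx_block.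
  have := vector_H0 tau1 tauM (simul_diag_block linD linD) tauK C3_poly _ x y (row_mx a b).
  rewrite /= row_mxKl row_mxKr; apply=> g [u z] /=.
  rewrite -(hsubmxK z) /tau mul_row_block !mulmx0 addr0 add0r !row_mxKl !row_mxKr -C3_inv.
  by rewrite ar_actVK !ar_linVK.
have act1 g : ar_act g 1%g = tr g by rewrite /ar_act mul0mx mulg1.
(* The translation part comes from psi + h at the point g 1. The sign makes it equal to [eps] on K,
   where h is - [eps] and psi(1, 1) = 0. *)
exists (C3 1%g), (fun g => - (psi 1%g (tr g) + h g (tr g))); split.
- have p1 := @polymap_fst R n n; have p2 := @polymap_snd R n n.
  apply: polymapD; first apply: polymapD.
  + exact: (polymap_at2 (polymap_at2 (polymap_cst _ 0) p1 (@pg_mul_poly R A)) p2 pP).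
  + by apply: polymapN; exact: (polymap_at2 (polymap_cst _ 0) (@pg_mul_poly R A) pP).
  + exact: (polymap_at2 (polymap_cst _ 0) p1 pP).
- by move=> x; split; rewrite /C3 !(mul1g, mulg1) !p0 ?subrr ?addr0 // sub0r addNr.
- move=> x y z; rewrite (C3_const 1%g x y z) /C3 !mul1g !mulgA.
  by apply/rowP => i; rewrite !mxE; ring.
- by move=> g x y; rewrite -C3_inv; exact: C3_const.
split=> [g d|g Kg]; last first.
  by have [tg1 ->] := KA Kg; rewrite hK // p0 add0r opprK.
have e := pE g 1%g (tr d); rewrite act1 -ar_transM in e.
have e2 : h (g * d)%g (tr (g * d)%g) = h g (tr (g * d)%g) + h d (tr d) *m phi g.
  by rewrite hM; congr (_ + h d _ *m _); rewrite ar_transM; exact: ar_actK.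
rewrite e2 /C3 !mul1g -ar_transM mulNmx mulmxDl.
have -> : h g (tr (g * d)%g) = psi 1%g (tr d) *m phi g - psi (tr g) (tr d *m t g) + h g (tr g) by rewrite -e subrK.
by apply/rowP => i; rewrite !mxE; ring.
Qed.
End ExtensionData.

Section Pullback.
Local Open Scope ring_scope.
Variables (C : numFieldType) (G : groupType) (X X' : Type) (act : G -> (X -> C) -> X -> C)
  (act' : G -> (X' -> C) -> X' -> C) (M : set (X -> C)) (M' : set (X' -> C)) (K : set G)
  (pi : X' -> X) (sec : X -> X').
Hypotheses (secK : cancel sec pi) (pull : forall g F, act' g (F \o pi) = act g F \o pi)
  (act'D : forall g a b, act' g (a + b) = act' g a + act' g b)
  (MM' : forall F, M F -> M' (F \o pi))
  (desc : forall F, M' F -> fixed_by act' K F -> M (F \o sec) /\ F = F \o sec \o pi)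
  (sK : subgroup K) (nK : normalizes [set: G] K).

Let pi_inj (F F' : X -> C) : F \o pi = F' \o pi -> F = F'.
Proof. by move=> e; apply/funext => x; rewrite -(secK x); exact: (congr1 (fun f => f (sec x)) e). Qed.

Let fixed_sec F : M' F -> fixed_by act' K F -> fixed_by act K (F \o sec).
Proof.
move=> MF fF g Kg; apply: pi_inj; have [_ eF] := desc MF fF.
by rewrite -pull -[in LHS]eF fF.
Qed.

Let act_sec g F : M' F -> fixed_by act' K F -> act' g F \o sec = act g (F \o sec).
Proof.
move=> MF fF; have [_ eF] := desc MF fF.
by rewrite {1}eF pull; apply/funext => x /=; rewrite secK.
Qed.

(** A cocycle vanishing on K takes K-invariant values. By [desc] these are functions on the base X,
    so the cocycle descends along [sec]. *)
Lemma H1_trivial_pull : H1_trivial act M [set: G] K -> H1_trivial act' M' [set: G] K.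
Proof.
move=> h d dM dD dK.
have fd g : fixed_by act' K (d g).
  move=> k Kk; have Kk' := normalizesV (subgroupT _) nK I Kk : K (g^-1 * k * g)%g.
  have := dD k g I I; rewrite (dK k Kk) add0r => <-.
  have -> : (k * g = g * (g^-1 * k * g))%g by rewrite !gs.
  rewrite dD // (dK _ Kk') (_ : act' g 0 = 0) ?addr0 //.
  by apply: (addrI (act' g 0)); rewrite -act'D !addr0.
have [g _|g g' _ _|g Kg|m Mm em] := h (fun g => d g \o sec).
- by have [] := desc (dM g I) (@fd g).
- by rewrite dD //= -(act_sec _ (dM _ I) (@fd _)).
- by rewrite dK.
exists (m \o pi); first exact: MM'.
move=> g _; have [_ ->] := desc (dM g I) (@fd g).
by rewrite em // pull.
Qed.

Lemma H2_trivial_pull : H2_trivial act M [set: G] K -> H2_trivial act' M' [set: G] K.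
Proof.
move=> h z [zM zK zD].
have [|c [cM cK] ec] := h (fun g g' => z g g' \o sec).
  split=> [g g' _ _|g g' k _ _ Kk|g g' w _ _ _].
  - by have [Mz fz] := zM g g' I I; split; [have [] := desc Mz fz|exact: fixed_sec].
  - by have [-> ->] := zK g g' k I I Kk.
  - by have [Mz fz] := zM g' w I I; rewrite zD //= -(act_sec _ Mz fz).
exists (fun g => c g \o pi).
  split=> [g _|g k _ Kk]; last by rewrite cK.
  have [Mc fc] := cM g I; split; first exact: MM'.
  by move=> k Kk; rewrite pull fc.
move=> g g' _ _; have [Mz fz] := zM g g' I I; have [_ ->] := desc Mz fz.
by rewrite ec // /cobound pull.
Qed.
End Pullback.

Section FunctionAction.
Local Open Scope ring_scope.
Variables (R : realType) (G : groupType) (A : affine_rep R G) (D K : set G) (Z : Type).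
Local Notation C := R[i].
Variables (aw : G -> (Z -> C) -> Z -> C) (E : set (Z -> C)).
Hypothesis cs : coef_system D K aw E.

Lemma fun_act1 F : fun_act (A := A) aw 1%g F = F.
Proof.
apply/funext => [[x z]]; rewrite /fun_act /= invg1 (cs_1 cs); by rewrite ar_act1.
Qed.

Lemma fun_actM g h F : fun_act (A := A) aw (g * h)%g F = fun_act aw g (fun_act aw h F).
Proof.
apply/funext => [[x z]]; rewrite /fun_act /= (cs_M cs); congr (aw g (aw h _) z).
by apply/funext => w; rewrite invgM ar_actM.
Qed.

Lemma fun_actD g F F' : fun_act (A := A) aw g (F + F') = fun_act aw g F + fun_act aw g F'.
Proof.
apply/funext => [[x z]].
exact: (congr1 (fun f => f z) (cs_D cs g (fun z => F (ar_act g^-1%g x, z)) (fun z => F' (ar_act g^-1%g x, z)))).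
Qed.

Lemma fun_actZ g a F : fun_act (A := A) aw g (fun x => a * F x) = fun x => a * fun_act aw g F x.
Proof.
by apply/funext => [[x z]]; rewrite /fun_act /= (cs_Z cs).
Qed.

Lemma fun_act_pspan g F : pspan (@cpoly R (pg_dim A)) E F -> pspan (@cpoly R (pg_dim A)) E (fun_act aw g F).
Proof.
move=> [m [u [w [pu Ew eF]]]].
exists m, (fun i x => u i (ar_act g^-1%g x)), (fun i => aw g (w i)); split=> [i|i|x].
- apply: (polyfun_comp (h := @ar_act _ _ A g^-1%g) _ (pu i)) => _ [j ->].
  by apply: (cpoly_complexify (f := fun x => (ar_act g^-1%g x) 0 j)); exact: ar_act_poly.
- exact: (cs_E cs).
- rewrite /fun_act (_ : (fun z => _) = fun z => \sum_i u i (ar_act g^-1%g x.1) * w i z).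
    by rewrite (aw_sum (cs_D cs g) (cs_Z cs g)).
  by apply/funext => z; rewrite eF.
Qed.
End FunctionAction.

Section Extension.
Local Open Scope ring_scope.
Variable R : realType.

Record factor_set (N : polygroup R) k := FactorSet {
  fs_fun :> N -> N -> 'rV[R]_k;
  fs_poly : polymap (coords2 (@coords R (pg_dim N)) (@coords R (pg_dim N))) (fun x => fs_fun x.1 x.2);
  fs_0 : forall x, fs_fun 1%g x = 0 /\ fs_fun x 1%g = 0;
  fs_cocycle : forall x y z, fs_fun x y + fs_fun (x * y)%g z = fs_fun y z + fs_fun x (y * z)%g }.

Section ExtensionGroup.
Variables (N : polygroup R) (k : nat) (f : factor_set N k).
Local Notation n := (pg_dim N).

Definition ext_mul (x y : 'rV[R]_(k + n)) : 'rV[R]_(k + n) :=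
  row_mx (lsubmx x + lsubmx y + f (rsubmx x) (rsubmx y)) ((rsubmx x : N) * (rsubmx y : N))%g.
Definition ext_inv (x : 'rV[R]_(k + n)) : 'rV[R]_(k + n) :=
  row_mx (- lsubmx x - f (rsubmx x) (rsubmx x : N)^-1%g) (rsubmx x : N)^-1%g.

Let ext_mulA : associative ext_mul.
Proof.
move=> x y z; rewrite /ext_mul !row_mxKl !row_mxKr mulgA; congr row_mx.
have E (u v w p q r s : 'rV[R]_k) : p + s = q + r -> u + (v + w + q) + r = u + v + p + w + s.
  move=> h; transitivity (u + v + w + (q + r)); first by apply/rowP => i; rewrite !mxE; ring.
  by rewrite -h; apply/rowP => i; rewrite !mxE; ring.
exact: E (fs_cocycle f (rsubmx x) (rsubmx y) (rsubmx z)).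
Qed.
Let ext_mul0x : left_id 0 ext_mul.
Proof.
move=> x; rewrite /ext_mul !linear0 add0r (fs_0 f (rsubmx x)).1 addr0.
by rewrite (mul1g (rsubmx x : N)) hsubmxK.
Qed.
Let ext_mulx0 : right_id 0 ext_mul.
Proof.
move=> x; rewrite /ext_mul !linear0 addr0 (fs_0 f (rsubmx x)).2 addr0.
by rewrite (mulg1 (rsubmx x : N)) hsubmxK.
Qed.
Let ext_mulVx : left_inverse 0 ext_inv ext_mul.
Proof.
move=> x; rewrite /ext_mul /ext_inv !row_mxKl !row_mxKr (mulVg (rsubmx x : N)).
have := fs_cocycle f (rsubmx x) (rsubmx x : N)^-1%g (rsubmx x).
rewrite (mulgV (rsubmx x : N)) (mulVg (rsubmx x : N)) (fs_0 f _).1 (fs_0 f _).2 !addr0 => ->.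
by rewrite addrAC subrK addNr row_mx0.
Qed.
Let ext_mulxV : right_inverse 0 ext_inv ext_mul.
Proof.
move=> x; rewrite /ext_mul /ext_inv !row_mxKl !row_mxKr (mulgV (rsubmx x : N)).
by rewrite addrA addrN sub0r addNr row_mx0.
Qed.
Let ext_mul_poly : polymap (coords2 (@coords R (k + n)) (@coords R (k + n))) (fun x => ext_mul x.1 x.2).
Proof.
have p1 := @polymap_fst R (k + n) (k + n); have p2 := @polymap_snd R (k + n) (k + n).
have r1 := polymap_rsub p1; have r2 := polymap_rsub p2.
apply: polymap_row; last exact: (polymap_at2 r1 r2 (@pg_mul_poly R N)).
by apply: polymapD; [apply: polymapD; exact: polymap_lsub|exact: (polymap_at2 r1 r2 (fs_poly f))].
Qed.
Let ext_inv_poly : polymap (@coords R (k + n)) ext_inv.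
Proof.
have p1 := @polymap_id R (k + n); have r1 := polymap_rsub p1.
have i1 := polymap_at r1 (@pg_inv_poly R N).
apply: polymap_row => //; apply: polymapD; apply: polymapN; first exact: polymap_lsub.
exact: (polymap_at2 r1 i1 (fs_poly f)).
Qed.
Definition pg_ext : polygroup R :=
  Polygroup ext_mulA ext_mul0x ext_mulx0 ext_mulVx ext_mulxV ext_mul_poly ext_inv_poly.
End ExtensionGroup.

(** Successive central extensions starting from a point. This structure is remembered because it
    yields both nilpotency and the uniqueness of homomorphisms with a given differential. *)
Inductive iterated_extension : polygroup R -> Prop :=
| iterated0 N : pg_dim N = 0%N -> iterated_extension N
| iteratedS N k (f : factor_set N k) : iterated_extension N -> iterated_extension (pg_ext f).

Section ExtensionRepresentation.
Variables (G : groupType) (A : affine_rep R G) (k : nat) (f : factor_set A k)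
  (phi : G -> 'M[R]_k) (nu : G -> 'rV[R]_k).
Local Notation n := (pg_dim A).
Hypotheses (phi1 : phi 1%g = 1%:M) (phiM : forall g h, phi (g * h)%g = phi h *m phi g)
  (f_eqv : forall g (x y : A), f (x *m ar_lin A g) (y *m ar_lin A g) = f x y *m phi g)
  (nuM : forall g d, nu (g * d)%g = nu g + nu d *m phi g + f (ar_trans A g) (ar_trans A d *m ar_lin A g)).

Let lin g : 'M[R]_(k + n) := block_mx (phi g) 0 0 (ar_lin A g).
Let tr g : pg_ext f := row_mx (nu g) (ar_trans A g).

Let lin_row g (v : 'rV[R]_k) (x : A) : row_mx v x *m lin g = row_mx (v *m phi g) (x *m ar_lin A g).
Proof. by rewrite mul_row_block !mulmx0 addr0 add0r. Qed.

Let lin1 : lin 1%g = 1%:M.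
Proof. by rewrite /lin phi1 ar_lin1 -scalar_mx_block. Qed.

Let linM g h : lin (g * h)%g = lin h *m lin g.
Proof. by rewrite /lin phiM ar_linM mulmx_block !(mulmx0, mul0mx, addr0, add0r). Qed.

Let linP g (x y : pg_ext f) : ((x * y)%g : 'rV_(_)) *m lin g =
  ((x *m lin g : pg_ext f) * (y *m lin g : pg_ext f))%g.
Proof.
change (ext_mul f x y *m lin g = ext_mul f (x *m lin g) (y *m lin g)).
have e (u : 'rV[R]_(k + n)) : u *m lin g = row_mx (lsubmx u *m phi g) (rsubmx u *m ar_lin A g).
  by rewrite -{1}(hsubmxK u) lin_row.
by rewrite !e /ext_mul !row_mxKl !row_mxKr !mulmxDl ar_linP f_eqv.
Qed.

Let trM g h : tr (g * h)%g = (tr g * (tr h *m lin g : pg_ext f))%g.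
Proof.
change (tr (g * h)%g = ext_mul f (tr g) (tr h *m lin g)).
by rewrite /tr lin_row /ext_mul !row_mxKl !row_mxKr nuM ar_transM.
Qed.

Definition ext_rep : affine_rep R G :=
  @AffineRep R G (pg_ext f) lin tr lin1 linM linP trM.

Lemma ext_actE g (v : 'rV[R]_k) (x : A) : ar_act g (row_mx v x : ext_rep) =
  row_mx (nu g + v *m phi g + f (ar_trans A g) (x *m ar_lin A g)) (ar_act g x) :> 'rV_(k + n).
Proof.
change (ext_mul f (tr g) (row_mx v x *m lin g) =
  row_mx (nu g + v *m phi g + f (ar_trans A g) (x *m ar_lin A g)) (ar_act g x)).
by rewrite lin_row /ext_mul !row_mxKl !row_mxKr.
Qed.

Lemma rsub_ext_act g (x : ext_rep) : rsubmx (ar_act g x : 'rV_(k + n)) = ar_act g (rsubmx (x : 'rV_(k + n)) : A).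
Proof. by rewrite -{1}(hsubmxK (x : 'rV_(k + n))) ext_actE row_mxKr. Qed.

Lemma ext_trivial K' : trivial_on K' A -> (forall g, K' g -> phi g = 1%:M) -> (forall g, K' g -> nu g = 0) ->
  trivial_on K' ext_rep.
Proof.
move=> tA tp tn g Kg; have [l t] := tA g Kg; split.
  by rewrite /= /lin l tp // -scalar_mx_block.
by rewrite /= /tr tn // t row_mx0.
Qed.

Variables (D K K' : set G) (e : G -> 'rV[int]_k).
Hypotheses (acA : acyclic D K A) (sK : subgroup K) (nK : normalizes [set: G] K) (KD : K `<=` D)
  (sK' : subgroup K') (nK' : normalizes [set: G] K') (KK' : K' `<=` K)
  (eM : hom_on K e) (eK : forall x, K x -> (e x = 0 <-> K' x)) (esur : forall v, exists2 a, K a & e a = v)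
  (KA : trivial_on K A) (phiK : forall g, K g -> phi g = 1%:M)
  (nuK : forall g, K g -> nu g = map_mx intr (e g)).

Lemma ext_act_lattice g (x : ext_rep) : K g -> ar_act g x = x + row_mx (map_mx intr (e g)) 0 :> 'rV_(k + n).
Proof.
move=> Kg; have [l t] := KA Kg.
rewrite -[x in LHS](hsubmxK (x : 'rV_(k + n))) ext_actE phiK // nuK // /ar_act t l !mulmx1.
rewrite (mul1g (rsubmx (x : 'rV_(k + n)) : A)) (fs_0 f _).1 addr0.
by rewrite -{3}(hsubmxK (x : 'rV_(k + n))) add_row_mx addr0 addrC.
Qed.

(** Over the lattice K / K' the vanishing comes from finite differences along the new coordinates.
    For G / K, the K-invariant functions are functions on A with K-fixed coefficients, where the
    induction hypothesis holds. Transitivity combines the two. *)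
Theorem ext_acyclic : acyclic D K' ext_rep.
Proof.
move=> Z aw E cs M.
(* The coefficients for the old stage: K acts trivially on them, as [acA] requires. *)
pose EK := [set w | E w /\ forall g, K g -> aw g w = w].
have csK : coef_system D K aw EK.
  split; [exact: cs_1 cs|exact: cs_M cs|exact: cs_D cs|exact: cs_Z cs| | |].
  - move=> g w [Ew fw]; split; first exact: (cs_E cs).
    move=> h Kh; rewrite -(cs_M cs); have -> : (h * g = g * (g^-1 * h * g))%g by rewrite !gs.
    by rewrite (cs_M cs) fw //; exact: (normalizesV (subgroupT _) nK I Kh).
  - by move=> d w Dd [Ew _]; exact: (cs_diag cs Dd Ew).
  - by move=> g w Kg [_ fw]; exact: fw.
have [a1 a2 a0] := acA csK.
have MD := @pspanD R (k + n) Z (@cpoly R (k + n)) E.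
have M0 := @pspan0 R (k + n) Z (@cpoly R (k + n)) E.
have MZ a F : M F -> M (fun x => a * F x) by apply: pspanZ => g; exact: polyfun_scale.
have Mact := fun_act_pspan (A := ext_rep) cs.
have f1 := fun_act1 (A := ext_rep) cs; have fM := fun_actM (A := ext_rep) cs.
have fD := fun_actD (A := ext_rep) cs; have fZ := fun_actZ (A := ext_rep) cs.
have actK g F : K g -> fun_act (A := ext_rep) aw g F = translate_act (aw g) (row_mx (map_mx intr (e g)) 0) F.
  move=> Kg; apply/funext => x; rewrite /fun_act /translate_act; congr (aw g _ x.2); apply/funext => z.
  congr (F (_, z)); rewrite ext_act_lattice; last exact: subgroupV.
  by rewrite (hom_onV sK eM Kg) map_mxN -[X in row_mx _ X]oppr0 -opp_row_mx.
have [|g w K'g Ew|c1 c2 c0] := lattice_cohomology f1 fM fD fZ (cs_1 cs) (cs_M cs) (cs_D cs) (cs_Z cs)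
   (E := E) Mact sK sK' KK' nK' eM eK esur actK.
- by move=> g w Kg Ew; apply: (cs_diag cs) => //; exact: KD.
- exact: (cs_fix cs).
pose pi (x : 'rV[R]_(k + n) * Z) : 'rV[R]_n * Z := (rsubmx x.1, x.2).
pose sec (x : 'rV[R]_n * Z) : 'rV[R]_(k + n) * Z := (row_mx 0 x.1, x.2).
have secK : cancel sec pi by case=> x z; rewrite /pi /= row_mxKr.
have pull g F : fun_act (A := ext_rep) aw g (F \o pi) = fun_act (A := A) aw g F \o pi.
  apply/funext => x; rewrite /fun_act /=; congr (aw g _ x.2); apply/funext => z.
  by congr (F (_, z)); exact: rsub_ext_act.
have MM F : pspan (@cpoly R n) EK F -> M (F \o pi).
  move=> [m [u [w [pu Ew eF]]]].
  exists m, (fun i x => u i (rsubmx x)), w; split=> [i|i|x]; [|by have [] := Ew i|exact: eF].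
  apply: (polyfun_comp (h := @rsubmx R 1 k n) _ (pu i)) => _ [j ->].
  apply: (cpoly_complexify (f := fun x : 'rV[R]_(k + n) => (rsubmx x) 0 j)).
  exact: (polymap_rsub (@polymap_id R (k + n))).
have desc F : M F -> fixed_by (fun_act (A := ext_rep) aw) K F ->
    pspan (@cpoly R n) EK (F \o sec) /\ F = F \o sec \o pi.
  move=> MF fF; have [m [u [w [pu Ew eF]]]] := c0 F MF fF; split.
    exists m, (fun i x => u i (row_mx 0 x)), w; split=> [i|i|x]; [|exact: Ew|exact: eF].
    apply: (polyfun_comp (h := fun x : 'rV[R]_n => row_mx 0 x) _ (pu i).1) => _ [j ->].
    apply: (cpoly_complexify (f := fun x : 'rV[R]_n => (row_mx 0 x : 'rV[R]_(k + n)) 0 j)).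
    apply: polymap_row; [exact: polymap_cst|exact: polymap_id].
  apply/funext => [[x z]]; rewrite /= !eF /=; apply: eq_bigr => i _; congr (_ * _).
  apply: (pu i).2 => l; rewrite -{1}(hsubmxK x); case: (splitP l) => j lj; first by rewrite lj leqNgt ltn_ord.
  by move=> _; have -> : l = rshift k j by [exact: ord_inj]; rewrite !row_mxEr.
have b1 := H1_trivial_pull secK pull fD MM desc nK a1.
have b2 := H2_trivial_pull secK pull MM desc a2.
split.
- exact: (H1_trivial_trans fM fD MD MZ Mact (@subsetT _ K) KK' c1 b1).
- exact: (H2_trivial_trans fM fD MD MZ Mact M0 sK' sK (subgroupT G) KK' (@subsetT _ K) nK' nK c1 c2 b2).
- move=> F MF fF x y z.
  have [MF' eF] := desc F MF (fun g _ => fF g I).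
  have fF' : fixed_by (fun_act (A := A) aw) [set: G] (F \o sec).
    move=> g _; apply/funext => u; rewrite -(secK u).
    by have := congr1 (fun h => h (sec u)) (pull g (F \o sec)); rewrite -eF fF //= => <-; rewrite secK.
  by rewrite eF /pi /=; exact: (a0 _ MF' fF' (rsubmx x) (rsubmx y) z).
Qed.
End ExtensionRepresentation.
End Extension.

(** * Properness, cocompactness and the inductive construction of the action *)

Section Boundedness.
Local Open Scope ring_scope.
Variable R : realType.

Definition bounded_by n (r : R) (x : 'rV[R]_n) := forall i, `|x 0 i| <= r.

Lemma polyfun_bounded n (g : 'rV[R]_n -> R) : polyfun (@coords R n) g ->
  forall r, exists b, forall x, bounded_by r x -> `|g x| <= b.
Proof.
move=> pg r; elim: pg => [a|_ [i ->]|f1 f2 _ [b1 h1] _ [b2 h2]|f1 f2 _ [b1 h1] _ [b2 h2]].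
- by exists `|a|.
- by exists r => x; apply.
- exists (b1 + b2) => x hx; apply: le_trans (ler_normD _ _) _.
  by apply: lerD; [exact: h1|exact: h2].
- by exists (b1 * b2) => x hx; rewrite normrM; apply: ler_pM => //; [exact: h1|exact: h2].
Qed.

Lemma polymap_bounded n m (g : 'rV[R]_n -> 'rV[R]_m) : polymap (@coords R n) g ->
  forall r, exists b, forall x, bounded_by r x -> bounded_by b (g x).
Proof.
move=> pg r; have /choice [b hb] := fun i => polyfun_bounded (pg i) r.
exists (\sum_i `|b i|) => x hx i; apply: le_trans (hb i x hx) _.
by rewrite (bigD1 i) //=; apply: ler_wpDr; [exact: sumr_ge0|exact: ler_norm].
Qed.

Lemma integer_box k (b : R) : exists s : seq 'rV[int]_k,
  forall v : 'rV[int]_k, bounded_by b (map_mx intr v) -> v \in s.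
Proof.
pose B := Num.truncn `|b|.
exists [seq \row_i ((f i : nat)%:Z - B%:Z) | f : {ffun 'I_k -> 'I_(B + B).+1}] => v hv.
have vB i : (`|v 0 i| <= B%:Z).
  have h : (`|v 0 i|%:~R : R) <= `|b|.
    by have := hv i; rewrite mxE -intr_norm => h; apply: le_trans h _; exact: ler_norm.
  rewrite -(ler_int R); move: h; rewrite -(gez0_abs (normr_ge0 (v 0 i))) => h.
  by rewrite ler_int lez_nat /B truncn_ge_nat.
move: vB; move: B => B vB; apply/mapP; exists [ffun i => inord (absz (v 0 i + B%:Z))]; first by rewrite mem_enum.
apply/rowP => i; rewrite mxE ffunE inordK; by have := vB i; move: (v 0 i) => z; lia.
Qed.
End Boundedness.

Section Hull.
Local Open Scope ring_scope.
Variables (R : realType) (G : groupType).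
Local Notation C := R[i].
Implicit Types (A : affine_rep R G) (K D : set G).

(** At an intermediate stage K acts trivially, so properness can only be asked modulo K. For K = 1
    it implies proper discontinuity. *)
Definition proper_mod K A := forall r, exists s : seq G, forall g (x : A),
  bounded_by r x -> bounded_by r (ar_act g x) -> exists2 h, h \in s & K (h^-1 * g)%g.

Definition cobounded A := exists r, forall x : A, exists g, bounded_by r (ar_act g x).

Section Base.
Variables (D : set G).
Hypotheses (sD : subgroup D) (nD : normalizes [set: G] D) (fD : finite_index D [set: G]).

Let mul0 (x y : 'rV[R]_0) : 'rV[R]_0 := 0.
Let inv0 (x : 'rV[R]_0) : 'rV[R]_0 := 0.
Let eq0 (x y : 'rV[R]_0) : x = y.
Proof. by rewrite [x]thinmx0 [y]thinmx0. Qed.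

Definition point_group : polygroup R :=
  @Polygroup R 0 mul0 inv0 (fun _ _ _ => eq0 _ _) (fun _ => eq0 _ _) (fun _ => eq0 _ _)
    (fun _ => eq0 _ _) (fun _ => eq0 _ _) (polymap_cst _ 0) (polymap_cst _ 0).

Definition point_rep : affine_rep R G :=
  @AffineRep R G point_group (fun=> 1%:M) (fun=> 0) erefl (fun _ _ => esym (mulmx1 _))
    (fun _ _ _ => eq0 _ _) (fun _ _ => eq0 _ _).

(** Since G / D is finite, averaging kills degrees 1 and 2, and in degree 0 there is only one point
    to compare. *)
Lemma point_acyclic : acyclic D D point_rep.
Proof.
move=> Z aw E cs M.
have MD := @pspanD R 0 Z (@cpoly R 0) E.
have M0 := @pspan0 R 0 Z (@cpoly R 0) E.
have MZ a F : M F -> M (fun x => a * F x) by apply: pspanZ => g; exact: polyfun_scale.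
have aD := fun_actD (A := point_rep) cs; have aZ := fun_actZ (A := point_rep) cs.
split.
- exact: (finite_H1_trivial aD aZ MD MZ M0 sD (subgroupT G) (@subsetT _ D) nD fD).
- exact: (finite_H2_trivial aD aZ MD MZ M0 sD (subgroupT G) (@subsetT _ D) nD fD).
- by move=> F _ _ x y z; rewrite (eq0 x y).
Qed.

Lemma point_proper : proper_mod D point_rep.
Proof.
move=> r; have [s [_ hs]] := finite_index_reps fD.
by exists s => g x _ _; exact: hs.
Qed.

Lemma point_cobounded : cobounded point_rep.
Proof. by exists 0 => x; exists 1%g => -[]. Qed.
End Base.

Section Step.
Variables (A : affine_rep R G) (k : nat) (f : factor_set A k) (phi : G -> 'M[R]_k) (nu : G -> 'rV[R]_k).
Hypotheses (phi1 : phi 1%g = 1%:M) (phiM : forall g h, phi (g * h)%g = phi h *m phi g)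
  (f_eqv : forall g (x y : A), f (x *m ar_lin A g) (y *m ar_lin A g) = f x y *m phi g)
  (nuM : forall g d, nu (g * d)%g = nu g + nu d *m phi g + f (ar_trans A g) (ar_trans A d *m ar_lin A g)).
Variables (K K' : set G) (e : G -> 'rV[int]_k).
Hypotheses (sK : subgroup K) (eM : hom_on K e) (eK : forall x, K x -> (e x = 0 <-> K' x))
  (esur : forall v, exists2 a, K a & e a = v)
  (KA : trivial_on K A) (phiK : forall g, K g -> phi g = 1%:M)
  (nuK : forall g, K g -> nu g = map_mx intr (e g)).
Local Notation n := (pg_dim A).
Local Notation B := (ext_rep phi1 phiM f_eqv nuM).

Let bounded_row r (x : 'rV[R]_(k + n)) : bounded_by r (lsubmx x) -> bounded_by r (rsubmx x) -> bounded_by r x.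
Proof.
move=> h1 h2 l; rewrite -(hsubmxK x) mxE; case: (fintype.split l) => j; [exact: h1|exact: h2].
Qed.

Let bounded_lsub r (x : 'rV[R]_(k + n)) : bounded_by r x -> bounded_by r (lsubmx x).
Proof. by move=> h l; rewrite mxE. Qed.

Let bounded_rsub r (x : 'rV[R]_(k + n)) : bounded_by r x -> bounded_by r (rsubmx x).
Proof. by move=> h l; rewrite mxE. Qed.

Let lattice_act g (x : B) : K g -> ar_act g x = x + row_mx (map_mx intr (e g)) 0 :> 'rV_(k + n).
Proof. exact: ext_act_lattice. Qed.

(** Properness on A gives h from a finite list with h^-1 g in K, which translates x to h^-1 (g x).
    Both ends are bounded, since h^-1 is a polynomial map, so e(h^-1 g) is an integer vector in a
    box. It determines h^-1 g modulo K'. *)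
Lemma ext_proper : proper_mod K A -> proper_mod K' B.
Proof.
move=> pA r; have [s hs] := pA r.
have /choice [b hb] : forall g, exists b, forall x : B, bounded_by r x -> bounded_by b (ar_act g^-1%g x).
  by move=> g; exact: (polymap_bounded (@ar_act_poly R G B g^-1%g)).
have /choice [bx hbx] := fun g => integer_box k (b g + r).
have /choice [rep hrep] : forall v, exists a, K a /\ e a = v.
  by move=> v; have [a Ka ea] := esur v; exists a.
have repK v := (hrep v).1; have repE v := (hrep v).2.
exists [seq (g * rep v)%g | g <- s, v <- bx g] => g x bxr bgr.
have [] := hs g (rsubmx (x : 'rV_(k + n))).
- exact: bounded_rsub.
- by have := bounded_rsub bgr; rewrite rsub_ext_act.
move=> h hs' Kh.
exists (h * rep (e (h^-1 * g)%g))%g.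
  apply: allpairs_f_dep => //; apply: hbx => i.
  have := hb h _ bgr; rewrite -ar_actM lattice_act //.
    move=> /bounded_lsub /(_ i); rewrite mxE [in X in X -> _]mxE row_mxEl => h1.
    rewrite -[X in `|X|](addrK (x 0 (lshift n i))) [X in `|X - _|]addrC.
    by apply: le_trans (ler_normB _ _) _; apply: lerD => //; exact: bxr.
have Kr := repK (e (h^-1 * g)%g); have Kr' := subgroupV sK Kr.
rewrite invgM -mulgA; apply/eK; first exact: subgroupM.
by rewrite eM // (hom_onV sK eM Kr) repE addNr.
Qed.

(** After the base coordinates are bounded, the lattice brings the new ones into [0, 1) by
    subtracting integer parts; hence the radius max(1, r). *)
Lemma ext_cobounded : cobounded A -> cobounded B.
Proof.
move=> [r hr]; exists (Num.max 1 r) => x.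
have [g hg] := hr (rsubmx (x : 'rV_(k + n))).
set y := ar_act g x : 'rV[R]_(k + n).
have [a Ka ea] := esur (\row_i - Num.floor (lsubmx y 0 i)).
exists (a * g)%g; rewrite ar_actM lattice_act //; apply: bounded_row => i.
  rewrite linearD /= row_mxKl ea mxE; move: (lsubmx y) => u; rewrite 2!mxE rmorphN /=.
  apply: (@le_trans _ _ 1); last by rewrite le_max lexx.
  rewrite ger0_norm ?subr_ge0 ?floor_le // lerBlDl.
  by have := ltW (floorD1_gt (u 0 i)); rewrite intrD.
rewrite linearD /= row_mxKr addr0 rsub_ext_act le_max.
by rewrite (hg i) orbT.
Qed.
End Step.

Record hull (D K : set G) (A : affine_rep R G) : Prop := Hull {
  hull_iterated : iterated_extension A;
  hull_acyclic : acyclic D K A;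
  hull_trivial : trivial_on K A;
  hull_diag : simul_diag D (ar_lin A);
  hull_proper : proper_mod K A;
  hull_cobounded : cobounded A }.

(** The tower supplies [phi] only through conjugation on K / K'. Surjectivity of e makes it a
    representation, trivial on K because K / K' is abelian. It then serves both as linear part on
    the new coordinates and as twist of the cohomology. *)
Theorem hull_exists D K : subgroup D -> normalizes [set: G] D -> finite_index D [set: G] ->
  @tower C G D K -> [/\ subgroup K, normalizes [set: G] K, K `<=` D & exists A, hull D K A].
Proof.
move=> sD nD fD; elim=> [|K1 K' k e phi P _ [sK nK KD [A hA]] sK' nK' KK' eM eK esur ephi Pu Pd].
  split=> //; exists point_rep; split.
  - exact: iterated0.
  - exact: point_acyclic.
  - by move=> g _.
  - by exists 1%:M; [exact: unitmx1|move=> d _; apply/is_diag_mxP => -[]].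
  - exact: point_proper.
  - exact: point_cobounded.
split=> //; first exact: subset_trans KK' KD.
pose ph g : 'M[R]_k := map_mx intr (phi g).
pose ep g : 'rV[R]_k := map_mx intr (e g).
have mx_ext (S T : 'M[int]_k) : (forall v : 'rV_k, v *m S = v *m T) -> S = T.
  by move=> h; apply/row_matrixP => i; rewrite !rowE h.
have phi1 : phi 1%g = 1%:M.
  apply: mx_ext => v; have [a Ka <-] := esur v.
  by rewrite -ephi // mulmx1 !gs.
have phiM g h : phi (g * h)%g = phi h *m phi g.
  apply: mx_ext => v; have [a Ka <-] := esur v.
  rewrite mulmxA -!ephi //; last exact: nK.
  by congr e; rewrite !gs.
have phiK g : K1 g -> phi g = 1%:M.
  move=> Kg; apply: mx_ext => v; have [a Ka <-] := esur v; have Kg' := subgroupV sK Kg.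
  rewrite -ephi // mulmx1 !eM ?(hom_onV sK eM Kg) //; last exact: subgroupM.
  by rewrite addrAC subrr add0r.
have p1 : ph 1%g = 1%:M by rewrite /ph phi1 map_mx1.
have pM g h : ph (g * h)%g = ph h *m ph g by rewrite /ph phiM map_mxM.
have pK g : K1 g -> ph g = 1%:M by move=> Kg; rewrite /ph phiK // map_mx1.
have pD : simul_diag D ph.
  exists P; [exact: Pu|move=> d Dd].
  suff -> : map_mx (real_complex R) (ph d) = map_mx intr (phi d) by exact: Pd.
  by apply/matrixP => i j; rewrite !mxE; exact: rmorph_int.
have epM g h : K1 g -> K1 h -> ep (g * h)%g = ep g + ep h by move=> Kg Kh; rewrite /ep eM // map_mxD.
have epJ g x : K1 x -> ep (g * x * g^-1)%g = ep x *m ph g by move=> Kx; rewrite /ep ephi // map_mxM.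
have [f [nu [fP f0 fC fE [nuM nuK]]]] := extension_data (hull_acyclic hA) sD nD sK nK p1 pM pD pK (hull_trivial hA)
  (hull_diag hA) epM epJ.
pose fs := FactorSet fP f0 fC.
exists (ext_rep (f := fs) p1 pM fE nuM); split.
- by apply: iteratedS; exact: hull_iterated hA.
- exact: (ext_acyclic (f := fs) p1 pM fE nuM (hull_acyclic hA) sK nK KD sK' nK' KK' eM eK esur (hull_trivial hA) pK nuK).
- apply: ext_trivial => g Kg; [|exact: pK (KK' _ Kg)|].
    exact: (hull_trivial hA (KK' _ Kg)).
  by rewrite nuK ?/ep; [rewrite (eK _ (KK' _ Kg)).2 // map_mx0|exact: KK'].
- exact: simul_diag_block pD (hull_diag hA).
- exact: (ext_proper (f := fs) p1 pM fE nuM sK eM eK esur (hull_trivial hA) pK nuK (hull_proper hA)).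
- exact: (ext_cobounded (f := fs) p1 pM fE nuM esur (hull_trivial hA) pK nuK (hull_cobounded hA)).
Qed.
End Hull.

(** * Lie groups with polynomial law *)

Section PolynomialSmoothness.
Local Open Scope ring_scope.
Variables (R : realType).

Lemma derive_linear (V : normedModType R) (f : V -> R) (v x : V) :
  (forall x y, f (x + y) = f x + f y) -> (forall a x, f (a *: x) = a * f x) -> 'D_v f x = f v.
Proof.
move=> fD fZ; rewrite /derive; apply: cvg_lim => //=.
apply: cvg_near_cst; near=> h.
have h0 : h != 0 by near: h; exact: nbhs_dnbhs_neq.
by rewrite /= /shift /= fD addrK fZ; change (h^-1 * (h * f v) = f v); rewrite mulKf.
Unshelve. all: by end_near. Qed.

Section Generators.
Variables (V : normedModType R) (S : set (V -> R)).
Hypothesis SP : forall f, S f -> [/\ forall x, differentiable f x,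
  forall x y, f (x + y) = f x + f y & forall a x, f (a *: x) = a * f x].

Lemma polyfun_differentiable f x : polyfun S f -> differentiable f x.
Proof.
elim=> [a|g /SP[]//|f1 f2 _ d1 _ d2|f1 f2 _ d1 _ d2].
- exact: differentiable_cst.
- exact: differentiableD.
- exact: differentiableM.
Qed.

Lemma polyfun_derive f v : polyfun S f -> polyfun S ('D_v f).
Proof.
elim=> [a|g Sg|f1 f2 p1 d1 p2 d2|f1 f2 p1 d1 p2 d2].
- rewrite (_ : 'D_v _ = fun=> 0); first exact: polyfun_cst.
  by apply/funext => x; exact: derive_cst.
- rewrite (_ : 'D_v _ = fun=> g v); first exact: polyfun_cst.
  by have [_ gD gZ] := SP Sg; apply/funext => x; exact: derive_linear.
- have := polyfun_add d1 d2; congr polyfun; apply/funext => x.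
  by rewrite deriveD //; apply: diff_derivable; exact: polyfun_differentiable.
- have := polyfun_add (polyfun_mul p1 d2) (polyfun_mul p2 d1); congr polyfun; apply/funext => x.
  by rewrite deriveM //; apply: diff_derivable; exact: polyfun_differentiable.
Qed.

Lemma polymap_differentiable n (h : V -> 'rV[R]_n) x : polymap S h -> differentiable h x.
Proof.
move=> ph; rewrite (_ : h = \sum_i fun x => h x 0 i *: delta_mx 0 i); last first.
  apply/funext => y; rewrite fct_sumE [LHS](row_sum_delta (h y)).
  by apply: eq_bigr => i _.
by apply: differentiable_sum => i; apply: differentiableZl; exact: polyfun_differentiable.
Qed.

Lemma polymap_derive n (h : V -> 'rV[R]_n) v : polymap S h -> polymap S ('D_v h).
Proof.
move=> ph i; rewrite (_ : (fun x => _) = 'D_v (fun x => h x 0 i)); first exact: polyfun_derive.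
apply/funext => x; rewrite derive_mx ?mxE //.
by apply: diff_derivable; exact: polymap_differentiable.
Qed.

(** Polynomial maps are stable under directional derivatives, which is what the recursion in [Ck_on]
    asks for. *)
Lemma polymap_smooth n (h : V -> 'rV[R]_n) U : polymap S h -> smooth_on U h.
Proof.
move=> ph k; elim: k h ph => [|k IH] h ph /=.
  by move=> x _; apply: differentiable_continuous; exact: polymap_differentiable.
by split=> [x _|v]; [exact: polymap_differentiable|apply: IH; exact: polymap_derive].
Qed.
End Generators.

Lemma coords_linear n f : @coords R n f -> [/\ forall x, differentiable f x,
  forall x y, f (x + y) = f x + f y & forall a x, f (a *: x) = a * f x].
Proof.
move=> [i ->]; split=> [x|x y|a x]; rewrite ?mxE //.
exact: (@differentiable_coord _ 1 n).
Qed.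

Lemma coords2_linear n m f : coords2 (@coords R n) (@coords R m) f -> [/\ forall x, differentiable f x,
  forall x y, f (x + y) = f x + f y & forall a x, f (a *: x) = a * f x].
Proof.
case=> [[u /coords_linear [d fD fZ] ->]|[u /coords_linear [d fD fZ] ->]]; split=> [x|x y|a x]; rewrite /= ?fD ?fZ //.
  by apply: differentiable_comp => //; apply: linear_differentiable => y; exact: cvg_fst.
by apply: differentiable_comp => //; apply: linear_differentiable => y; exact: cvg_snd.
Qed.

Lemma polymap_continuous n m (h : 'rV[R]_n -> 'rV[R]_m) : polymap (@coords R n) h -> continuous h.
Proof.
by move=> ph x; apply: differentiable_continuous; exact: (polymap_differentiable (@coords_linear n) _ ph).
Qed.
End PolynomialSmoothness.

Section Topology.
Local Open Scope ring_scope.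
Variables (R : realType) (n : nat).
Local Notation I := `[(0 : R), 1]%classic.

Lemma rV_second_countable : @second_countable 'rV[R]_n.
Proof.
pose B (p : 'rV[rat]_n * nat) : set 'rV[R]_n := ball (map_mx ratr p.1 : 'rV[R]_n) (p.2.+1%:R^-1).
exists (range B); first exact: (sub_countable (card_image_le _ _) (countableP _)).
split=> [_ [p _ <-]|x P /nbhs_ballP [e /= e0 eP]]; first exact: ball_open.
have [m me] : exists m : nat, m.+1%:R^-1 + m.+1%:R^-1 <= e.
  exists (Num.truncn (2 / e)); set m := Num.truncn _.
  have : 2 / e < m.+1%:R by exact: truncnS_gt.
  rewrite ltr_pdivrMr // => h; rewrite -[m.+1%:R^-1]div1r -mulrDl ler_pdivrMr ?ltr0Sn //.
  by rewrite mulrC; exact: ltW.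
have d0 : 0 < m.+1%:R^-1 :> R by rewrite invr_gt0 ltr0Sn.
have /choice [q hq] : forall i : 'I_n, exists q : rat, ball (ratr q : R) m.+1%:R^-1 (x 0 i).
  move=> i; have [|q] := @rat_in_itvoo R (x 0 i - m.+1%:R^-1) (x 0 i + m.+1%:R^-1).
    by apply: (@lt_trans _ _ (x 0 i)); rewrite ?ltrDl // gtrBl.
  by rewrite in_itv /= => h; exists q; rewrite /ball /= ltr_distl.
have hx : B (\row_i q i, m) x by split=> // i j; rewrite ord1 !mxE.
exists (B (\row_i q i, m)); first by split; [exists (\row_i q i, m)|].
by move=> y hy; apply: eP; apply: le_ball me _ _; apply: ball_triangle (ball_sym hx) hy.
Qed.

Lemma continuous_line (x v : 'rV[R]_n) : continuous (fun t : R => x + t *: v).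
Proof. by move=> t; apply: cvgD; [exact: cvg_cst|apply: cvgZr_tmp; exact: cvg_id]. Qed.

Lemma rV_connected : connected [set: 'rV[R]_n].
Proof.
rewrite (_ : [set: _] = \bigcup_(v in [set: 'rV[R]_n]) ((fun t : R => 0 + t *: v) @` I)).
  apply: bigcup_connected.
    by exists 0 => v _; exists 0; rewrite ?scale0r ?addr0 //= in_itv /= lexx ler01.
  move=> v _; apply: connected_continuous_connected; first exact: segment_connected.
  by apply: continuous_subspaceT; exact: continuous_line.
apply/seteqP; split=> v // _; exists v => //; exists 1; last by rewrite scale1r add0r.
by rewrite /= in_itv /= ler01 lexx.
Qed.

Lemma rV_simply_connected : simply_connected R 'rV[R]_n.
Proof.
split=> [J x y|g gc g01].
  exists (fun t => x + t *: (y - x)); split.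
  - by apply: continuous_subspaceT; exact: continuous_line.
  - by rewrite scale0r addr0.
  - by rewrite scale1r addrC subrK.
(* The loop g is continuous only within [0, 1]. The retraction of R onto [0, 1] extends it to a
   continuous map, so that the straight-line contraction H is continuous on the plane. *)
pose clamp (x : R) := Num.max 0 (Num.min 1 x).
have clampI x : I (clamp x) by rewrite /= in_itv /= /clamp le_max lexx /= ge_max ler01 ge_min lexx.
have clampE x : I x -> clamp x = x.
  by rewrite /= in_itv /= /clamp => /andP [x0 x1]; rewrite min_r // max_r.
have clampC : continuous clamp.
  move=> x; apply: continuous_max; first exact: cvg_cst.
  by apply: continuous_min; [exact: cvg_cst|exact: cvg_id].
have gC : continuous (g \o clamp).
  move=> x P /(gc (clamp x)); rewrite nbhs_simpl /= => hP.
  have hW : (within I (nbhs (clamp x))) (g @^-1` P) by rewrite (nbhs_subspace_in (clampI x)).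
  have h : nbhs x (clamp @^-1` [set y | I y -> P (g y)]) := clampC x _ hW.
  by apply: (@filterS _ (nbhs x) _ _ _ _ h) => y hy; exact: hy (clampI y).
pose H (p : R * R) := g (clamp p.2) + p.1 *: (g 0 - g (clamp p.2)).
have HC : continuous H.
  move=> p; apply: cvgD; first by apply: (continuous_comp cvg_snd (gC _)).
  apply: cvgZ; first exact: cvg_fst.
  by apply: cvgB; [exact: cvg_cst|apply: (continuous_comp cvg_snd (gC _))].
have I0 : I 0 by rewrite /= in_itv /= lexx ler01.
have I1 : I 1 by rewrite /= in_itv /= lexx ler01.
exists H; split.
- exact: continuous_subspaceT.
- by move=> s Is; rewrite /H /= clampE // scale0r addr0.
- by move=> s Is; rewrite /H /= scale1r addrC subrK.
- by move=> t It; rewrite /H /= !clampE // -g01 subrr scaler0 addr0.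
Qed.
End Topology.

HB.instance Definition _ (R : realType) (N : polygroup R) := Topological.copy (pg_sort N) 'rV[R]_(pg_dim N).

Section LieGroup.
Local Open Scope ring_scope.
Variables (R : realType) (N : polygroup R).
Local Notation n := (pg_dim N).

Let global_cod_open : open ((fun x : 'rV[R]_n => x) @` [set: N]).
Proof. by rewrite image_id; exact: openT. Qed.

Definition global_chart : chart R n N :=
  @Chart R n N [set: N] (fun x => x) (fun x => x) openT global_cod_open
    (fun _ _ => erefl) (fun x _ => @cvg_id _ (nbhs x)) (fun x _ => @cvg_id _ (nbhs x)).

Let global_atlasP : smooth_atlas [set global_chart].
Proof.
split=> [x|_ _ -> ->]; first by exists global_chart.
exact (polymap_smooth (@coords_linear R n) _ (@polymap_id R n)).
Qed.

Let pg_mul_continuous : continuous (fun z : N * N => (z.1 * z.2)%g).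
Proof.
move=> z; exact: (differentiable_continuous
  (polymap_differentiable (@coords2_linear R n n) _ (@pg_mul_poly R N))).
Qed.

Let pg_inv_continuous : continuous (fun x : N => x^-1%g).
Proof. exact: polymap_continuous (@pg_inv_poly R N). Qed.

Let pg_mul_smooth (a b c : chart R n N) :
  [set global_chart] a -> [set global_chart] b -> [set global_chart] c ->
  smooth_on [set z : 'rV[R]_n * 'rV[R]_n | [/\ chart_cod a z.1,
               chart_cod b z.2 & chart_dom c (chart_inv a z.1 * chart_inv b z.2)%g]]
            (fun z => c (chart_inv a z.1 * chart_inv b z.2)%g).
Proof. by move=> -> -> ->; exact (polymap_smooth (@coords2_linear R n n) _ (@pg_mul_poly R N)). Qed.

Let pg_inv_smooth (a b : chart R n N) : [set global_chart] a -> [set global_chart] b ->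
  smooth_on [set v | chart_cod a v /\ chart_dom b (chart_inv a v)^-1%g] (fun v => b (chart_inv a v)^-1%g).
Proof. by move=> -> ->; exact (polymap_smooth (@coords_linear R n) _ (@pg_inv_poly R N)). Qed.

Definition pg_lie : lieGroup R n :=
  @LieGroup R n N [set global_chart] (@norm_hausdorff R 'rV[R]_n) (@rV_second_countable R n) global_atlasP
    pg_mul_continuous pg_inv_continuous pg_mul_smooth pg_inv_smooth.

Lemma linear_smooth (A : 'M[R]_n) : @smooth_map R n pg_lie (fun x => x *m A).
Proof.
have p := polymapM A (@polymap_id R n).
split; first exact: polymap_continuous.
by move=> _ _ -> ->; exact (polymap_smooth (@coords_linear R n) _ p).
Qed.
End LieGroup.

Section Nilpotent.
Local Open Scope ring_scope.
Variable R : realType.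

Section Projection.
Variables (N : polygroup R) (k : nat) (f : factor_set N k).
Implicit Types x y : pg_ext f.

Definition ext_proj x : N := rsubmx (x : 'rV[R]_(k + pg_dim N)).

Lemma ext_projM x y : ext_proj (x * y)%g = (ext_proj x * ext_proj y)%g.
Proof. exact: row_mxKr. Qed.

Lemma ext_projV x : ext_proj x^-1%g = (ext_proj x)^-1%g.
Proof. exact: row_mxKr. Qed.

Lemma ext_proj1 : ext_proj 1%g = 1%g.
Proof. exact: linear0. Qed.

Lemma ext_ker_central x y : ext_proj x = 1%g -> (x * y = y * x)%g.
Proof.
move=> x1; change (ext_mul f x y = ext_mul f y x); rewrite /ext_mul.
have -> : rsubmx (x : 'rV[R]_(k + pg_dim N)) = 1%g :> N by [].
by rewrite (fs_0 f _).1 (fs_0 f _).2 mul1g mulg1 [in LHS](addrC (lsubmx _)).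
Qed.
End Projection.

(** A central series of the quotient is pulled back. Its zeroth term pulls back to the kernel, which
    is central, and the trivial group is put below. *)
Lemma iterated_nilpotent (N : polygroup R) : iterated_extension N -> nilpotent_group N.
Proof.
elim=> [{}N n0|{}N k f _ [m [Z [Z0 Zm sZ cZ]]]].
  exists 0%N, (fun=> [set 1%g]); split=> //.
    apply/seteqP; split=> // x _ /=; by apply/rowP => -[j jn]; exfalso; rewrite n0 in jn.
  by move=> i _; exact: subgroup_set1.
exists m.+1, (fun i => if i is i'.+1 then @ext_proj N k f @^-1` Z i' else [set 1%g]); split=> //.
- by rewrite Zm preimage_setT.
- case=> [_|i im]; first exact: subgroup_set1.
  have [z1 zM zV] := sZ i im; split=> [|x y|x] /=; rewrite ?ext_proj1 ?ext_projM ?ext_projV //.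
    exact: zM.
  exact: zV.
- case=> [_|i im].
    split=> [_ -> /=|x y]; first by rewrite ext_proj1 Z0.
    rewrite /= Z0 => x1; rewrite /commg /conjg (ext_ker_central y x1) mulKg; exact: mulVg.
  have [ZZ cc] := cZ i im; split=> [x|x y] /=; first exact: ZZ.
  move=> Zx; have := cc _ (ext_proj y) Zx.
  by rewrite /commg /conjg !(ext_projM, ext_projV).
Qed.
End Nilpotent.

Section AffineAction.
Local Open Scope ring_scope.
Variables (R : realType) (G : groupType) (A : affine_rep R G).
Local Notation N := (pg_lie A).

Let lin_aut_M g : {morph (fun x : A => x *m ar_lin A g : A) : x y / (x * y)%g}.
Proof. by move=> x y; exact: ar_linP. Qed.

Definition lin_aut g : automorphism N :=
  @Automorphism N (fun x => x *m ar_lin A g) (fun x => x *m ar_lin A g^-1%g) (lin_aut_M g)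
    (ar_linK g) (ar_linVK g).

Definition affine_hom g : holomorph N := @Holomorph N (ar_trans A g) (lin_aut g).

Lemma affine_homM : {morph affine_hom : g h / (g * h)%g}.
Proof.
move=> g h; congr Holomorph; first exact: ar_transM.
by apply: aut_eq; apply/funext => x /=; rewrite ar_linM mulmxA.
Qed.

Lemma affine_nil_affine : nil_affine affine_hom.
Proof.
split; first exact: affine_homM.
by move=> _ [g _ <-]; split; exact: linear_smooth.
Qed.

Lemma affine_properly_discontinuous : proper_mod [set 1%g] A -> properly_discontinuous affine_hom.
Proof.
move=> pA S /(@compact_bounded R 'rV[R]_(pg_dim A)) [M [_ hM]].
have bS x : S x -> bounded_by (M + 1) (x : 'rV[R]_(pg_dim A)).
  move=> Sx i; apply: le_trans (hM (M + 1) _ x Sx); last by rewrite ltrDl.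
  by rewrite [leRHS]/Num.Def.normr /= mx_normrE; exact: (le_bigmax _ _ (ord0, i)).
have [s hs] := pA (M + 1).
apply: (@sub_finite_set _ _ [set` s]); last exact: finite_seq.
move=> g [y [[x Sx <-] Sy]] /=.
have [h hh /= e] := hs g x (bS _ Sx) (bS _ Sy).
by rewrite -(mulVKg h g) e mulg1.
Qed.

Lemma affine_cocompact : cobounded A -> cocompact affine_hom.
Proof.
move=> [r hr].
pose box := [set x : 'rV[R]_(pg_dim A) | forall i, x ord0 i \in `[- r, r]].
have cbox : compact box.
  by apply: (@rV_compact R _ (fun=> `[- r, r]%classic)) => _; exact: segment_compact.
pose pi := (\pi_(orbit_space affine_hom))%qT : A -> orbit_space affine_hom.
rewrite /cocompact; have -> : [set: orbit_space affine_hom] = pi @` box.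
  apply/seteqP; split=> // q _; have [g hg] := hr (repr q).
  exists (ar_act g (repr q)); first by move=> i; rewrite in_itv /= -ler_norml.
  rewrite -[RHS]reprK; apply/eqmodP; apply/asboolP.
  apply/seteqP; split=> _ [h _ <-].
    by exists (h * g)%g => //; exact: ar_actM.
  exists (h * g^-1)%g => //.
  by change (ar_act (h * g^-1)%g (ar_act g (repr q)) = ar_act h (repr q)); rewrite ar_actM ar_actK.
apply: continuous_compact cbox; apply: continuous_subspaceT; exact: pi_continuous.
Qed.
End AffineAction.

(** * Unipotent elements of the Zariski closure *)

Section DifferentialUniqueness.
Local Open Scope ring_scope.
Variable R : realType.

(* Translating by the group law moves the vanishing of the derivative at the origin to every point. *)
Lemma additive_deriv0 (M : polygroup R) (d : 'rV[R]_(pg_dim M) -> R) :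
  (forall x y : M, d (x * y)%g = d x + d y) -> differentiable d 0 -> (forall v, 'D_v d 0 = 0) ->
  forall x, d x = 0.
Proof.
move=> dM dd d0.
have d1 : d 0 = 0 by apply: (addrI (d 0)); rewrite -[LHS](dM 1%g 1%g) mulg1 addr0.
have dx (x : M) : differentiable d (x : 'rV[R]_(pg_dim M)) /\ forall v, 'd d (x : 'rV[R]_(pg_dim M)) v = 0.
  pose L (y : 'rV[R]_(pg_dim M)) : 'rV[R]_(pg_dim M) := (x^-1 * (y : M))%g.
  have dL : differentiable L (x : 'rV[R]_(pg_dim M)).
    apply: (polymap_differentiable (@coords_linear R (pg_dim M))).
    exact: (polymap_at2 (polymap_cst _ (x^-1%g : M)) (@polymap_id _ _) (@pg_mul_poly R M)).
  have Lx : L x = 0 by exact: (mulVg x).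
  have e : d = cst (d x) + (d \o L).
    apply/funext => y; change (d y = d x + d (L y)).
    by rewrite -[RHS](dM x (L y)) /L mulVKg.
  have dc : differentiable (d \o L) (x : 'rV[R]_(pg_dim M)).
    by apply: differentiable_comp => //; rewrite Lx.
  split; first by rewrite e; apply: differentiableD => //; exact: differentiable_cst.
  move=> v; have -> : 'd d (x : 'rV[R]_(pg_dim M)) = 'd (cst (d x) + (d \o L)) (x : 'rV[R]_(pg_dim M)) by rewrite -e.
  rewrite (diffD (differentiable_cst _ _) dc) /= diff_cst add0r diff_comp ?Lx //=.
  by rewrite -deriveE.
move=> v.
have h (s : R) : is_derive s (1 : R) (fun s : R => d (s *: v)) 0.
  have dl : differentiable (fun s : R => s *: v) s by apply: differentiableZl; apply/derivable1_diffP; exact: derivable_id.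
  have [ds es] := dx (s *: v).
  have dd' : differentiable (d \o (fun s : R => s *: v)) s by exact: differentiable_comp.
  apply: DeriveDef; first exact: diff_derivable.
  by rewrite deriveE // diff_comp //= es.
have := is_derive_0_is_cst 1 0 h.
by rewrite scale1r scale0r d1.
Qed.

Definition entry (N M : polygroup R) (a : M -> N) i : 'rV[R]_(pg_dim M) -> R :=
  fun x => (a x : 'rV[R]_(pg_dim N)) 0 i.

(** Induction on the extension: modulo the central factor a and b agree. In the difference of their
    central coordinates the cocycle terms therefore cancel, leaving an additive function with zero
    derivative at the origin. *)
Theorem hom_differential_unique (N M : polygroup R) (a b : M -> N) : iterated_extension N ->
  {morph a : x y / (x * y)%g} -> {morph b : x y / (x * y)%g} ->
  (forall i, differentiable (entry a i) 0) -> (forall i, differentiable (entry b i) 0) ->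
  (forall v i, 'D_v (entry a i) 0 = 'D_v (entry b i) 0) -> a =1 b.
Proof.
move=> itN; elim: itN a b => [{}N n0|{}N k f _ IH] a b aM bM da db dab x.
  by apply/rowP => -[j jn]; exfalso; rewrite n0 in jn.
have ent (c : M -> pg_ext f) i : entry (@ext_proj R N k f \o c) i = entry c (rshift k i).
  by apply/funext => z; rewrite /entry /= /ext_proj mxE.
have pe y : ext_proj (a y) = ext_proj (b y).
  apply: (IH (@ext_proj R N k f \o a) (@ext_proj R N k f \o b)) => [z w|z w|i|i|v i]; rewrite ?ent //=.
    by rewrite aM ext_projM.
  by rewrite bM ext_projM.
suff le : lsubmx (a x : 'rV[R]_(k + pg_dim N)) = lsubmx (b x : 'rV[R]_(k + pg_dim N)).
  by rewrite -[LHS](@hsubmxK R 1 k) -[RHS](@hsubmxK R 1 k) le; congr row_mx; exact: pe.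
apply/rowP => i; rewrite !mxE; apply/eqP; rewrite -subr_eq0; apply/eqP.
pose l : 'I_(k + pg_dim N) := lshift _ i.
apply: (additive_deriv0 (d := entry a l - entry b l)) => [y z||v].
- have sub (c : M -> pg_ext f) : {morph c : x y / (x * y)%g} ->
    entry c l (y * z)%g = entry c l y + entry c l z + f (ext_proj (c y)) (ext_proj (c z)) 0 i.
    move=> cM; transitivity (ext_mul f (c y) (c z) 0 l); first by rewrite /entry cM.
    by rewrite row_mxEl !mxE.
  change (entry a l (y * z)%g - entry b l (y * z)%g = (entry a l y - entry b l y) + (entry a l z - entry b l z)).
  by rewrite (sub a) // (sub b) // !pe; ring.
- exact: differentiableB.
- by rewrite deriveB ?dab ?subrr //; exact: diff_derivable.
Qed.
End DifferentialUniqueness.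

Section UnipotentMatrices.
Local Open Scope ring_scope.

(** With P = 1 + N and N^(j+2) = 0 one has N^j P^i = N^j + i N^(j+1). Taking i = m yields m N^(j+1)
    = 0, so the nilpotency exponent drops to 1. *)
Lemma unipotent_root_unity (F : numFieldType) n (P : 'M[F]_n) k m : (0 < m)%N ->
  (P - 1) ^+ k = 0 -> P ^+ m = 1 -> P = 1.
Proof.
move=> m0; set N := P - 1 => Nk Pm.
have eP : P = 1 + N by rewrite /N addrC subrK.
have step j : N ^+ j.+2 = 0 -> N ^+ j.+1 = 0.
  move=> h; have e i : N ^+ j * P ^+ i = N ^+ j + N ^+ j.+1 *+ i.
    elim: i => [|i IH]; first by rewrite expr0 mulr1 mulr0n addr0.
    rewrite exprSr mulrA IH eP mulrDr mulr1 mulrDl -exprSr mulrnAl -exprSr h mul0rn addr0.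
    by rewrite mulrSr addrA.
  have := e m; rewrite Pm mulr1 => /eqP; rewrite eq_sym -subr_eq0 addrC addKr => /eqP h0.
  apply/matrixP => u v; have /matrixP /(_ u v) := h0; rewrite -scaler_nat !mxE => /eqP.
  by rewrite mulf_eq0 pnatr_eq0 eqn0Ngt m0 => /eqP.
suff : N ^+ 1 = 0 by rewrite expr1 => /subr0_eq.
by elim: k Nk => [h|[|k] IH h //]; [rewrite -[N ^+ 1]mul1r -(expr0 N) h mul0r|apply: IH; exact: step].
Qed.

Lemma unipotent_diag (F : fieldType) n (T : 'M[F]_n) k : is_diag_mx T -> (T - 1) ^+ k = 0 -> T = 1.
Proof.
move=> /is_diag_mxP dT Tk; apply/matrixP => i j.
have [<-|ij] := eqVneq i j; last by rewrite dT // mxE (negPf ij).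
have diag m u v : ((T - 1) ^+ m) u v = (T u u - 1) ^+ m *+ (u == v).
  elim: m u v => [|m IH] u v; first by rewrite !expr0 mxE.
  rewrite exprSr mxE (bigD1 u) //= big1 => [|w wu]; last by rewrite IH eq_sym (negPf wu) mulr0n mul0r.
  rewrite IH eqxx mulr1n addr0 !mxE; have [<-|uv] := eqVneq u v; first by rewrite ?eqxx ?mulr1n exprSr.
  by rewrite dT // ?(negPf uv) subr0 mulr0 ?mulr0n.
have /matrixP /(_ i i) := Tk; rewrite diag eqxx mxE mulr1n => /eqP.
by rewrite expf_eq0 => /andP [_ /eqP /subr0_eq ->]; rewrite mxE eqxx.
Qed.
End UnipotentMatrices.

Section TranslationLike.
Local Open Scope ring_scope.
Variables (R : realType) (G : groupType) (A : affine_rep R G).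
Local Notation N := (pg_lie A).
Local Notation n := (pg_dim A).
Local Notation toC := (map_mx (real_complex R)).
Implicit Types p q : holomorph N.

Let c0 : chart R n N := global_chart A.

Let dif q : 'M[R]_n := @lie_differential R n N c0 (hol_lin q).

Lemma regular_polyfun (X : Type) (S : set (X -> R)) (h : holomorph N -> X) g :
  (forall f, S f -> @regular R n N (fun q => f (h q))) -> polyfun S g -> @regular R n N (fun q => g (h q)).
Proof.
move=> hS; elim=> [a|f /hS //|f1 f2 _ r1 _ r2|f1 f2 _ r1 _ r2].
- exact: regular_const.
- exact: regular_add r1 r2.
- exact: regular_mul r1 r2.
Qed.

Lemma regular_sum (I : Type) (r : seq I) (f : I -> holomorph N -> R) :
  (forall i, @regular R n N (f i)) -> @regular R n N (fun q => \sum_(i <- r) f i q).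
Proof.
move=> h; elim: r => [|i r IH].
  rewrite (_ : (fun q => _) = fun=> 0); first exact: regular_const.
  by apply/funext => q; rewrite big_nil.
rewrite (_ : (fun q => _) = fun q => f i q + \sum_(j <- r) f j q); first exact: regular_add.
by apply/funext => q; rewrite big_cons.
Qed.

Lemma regular_dif i j : @regular R n N (fun q => dif q i j).
Proof. exact: regular_lin. Qed.

Lemma regular_dif_exp m i j : @regular R n N (fun q => (dif q ^+ m) i j).
Proof.
elim: m i j => [|m IH] i j.
  rewrite (_ : (fun q => _) = fun=> (1 : 'M[R]_n) i j); first exact: regular_const.
  by apply/funext => q; rewrite expr0.
rewrite (_ : (fun q => _) = fun q => \sum_l dif q i l * (dif q ^+ m) l j).
  by apply: regular_sum => l; apply: regular_mul => //; exact: regular_dif.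
by apply/funext => q; rewrite exprS mxE.
Qed.

Lemma dif_linear q (Q : 'M[R]_n) : (forall x, hol_lin q x = x *m Q) -> dif q = Q.
Proof.
move=> h; rewrite /dif /lie_differential.
have -> : c0 \o hol_lin q \o chart_inv c0 = fun x : 'rV[R]_n => x *m Q.
  by apply/funext => x; exact: h.
have pQ := polymapM Q (@polymap_id R n).
have dQ := polymap_differentiable (@coords_linear R n) (0 : 'rV[R]_n) pQ.
apply/row_matrixP => i; rewrite !rowE -deriveEjacobian //.
rewrite derive_mx; last exact: diff_derivable.
apply/matrixP => u v; rewrite mxE ord1 derive_linear // => [x y|a x]; first by rewrite mulmxDl mxE.
by rewrite -scalemxAl mxE.
Qed.

Lemma linear_Aff q (Q Q' : 'M[R]_n) : (forall x, hol_lin q x = x *m Q) ->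
  (forall x, aut_inv (hol_lin q) x = x *m Q') -> @Aff R n N q.
Proof.
move=> hQ hQ'; split.
  have -> : aut_fun (hol_lin q) = fun x => x *m Q by apply/funext.
  exact: linear_smooth.
have -> : aut_inv (hol_lin q) = fun x => x *m Q' by apply/funext.
exact: linear_smooth.
Qed.

Lemma dif_affine_hom g : dif (affine_hom A g) = ar_lin A g.
Proof. exact: dif_linear. Qed.

Hypothesis itA : iterated_extension A.

(* Being an automorphism is an algebraic condition on the matrix of a linear map, hence inherited from rho(G);
   an automorphism with the same differential must then be that linear map. *)
Lemma closure_linear p : zariski_closure (range (affine_hom A)) p -> forall x, hol_lin p x = x *m dif p.
Proof.
move=> [[[_ sm] _] cl] x.
have dp : differentiable (hol_lin p : 'rV[R]_n -> 'rV[R]_n) (0 : 'rV[R]_n).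
  by have [d _] := sm c0 c0 erefl erefl 1%N; apply: d; split=> //; exists (0 : 'rV[R]_n).
have eD v : 'D_v (hol_lin p : 'rV[R]_n -> 'rV[R]_n) 0 = v *m dif p by rewrite deriveEjacobian.
have dent i : differentiable (entry (hol_lin p : A -> A) i) 0.
  exact (differentiable_comp dp (@differentiable_coord R 1 n _ 0 i)).
apply: (hom_differential_unique (a := hol_lin p) (b := fun x : A => x *m dif p : A) itA) => [|y z|//|i|v i].
- exact: aut_funM.
- apply/rowP => i; apply/eqP; rewrite -subr_eq0; apply/eqP.
  apply: (cl (fun q => ((y * z)%g *m dif q : 'rV_n) 0 i - ((y *m dif q : A) * (z *m dif q : A))%g 0 i)).
    have ent (u : 'rV[R]_n) j : @regular R n N (fun q => (u *m dif q) 0 j).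
      rewrite (_ : (fun q => _) = fun q => \sum_l u 0 l * dif q l j); last by apply/funext => q; rewrite mxE.
      by apply: regular_sum => l; apply: regular_mul; [exact: regular_const|exact: regular_dif].
    apply: regular_add => //.
    have := polyfun_opp (@pg_mul_poly R A i).
    apply: (regular_polyfun (h := fun q => (y *m dif q, z *m dif q))).
    by move=> f [[_ [j ->] ->]|[_ [j ->] ->]]; exact: ent.
  by move=> _ [g _ <-]; rewrite dif_affine_hom ar_linP subrr.
- exact: (polyfun_differentiable (@coords_linear R n) 0 (polymapM (dif p) (@polymap_id R n) i)).
- rewrite [RHS]derive_linear ?/entry => [||a y]; last by rewrite -scalemxAl mxE.
    rewrite -eD derive_mx ?mxE //; exact: diff_derivable.
  by move=> y z; rewrite mulmxDl mxE.
Qed.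

Lemma linear_automorphism_unit p Q : (forall x, hol_lin p x = x *m Q) -> Q \in unitmx.
Proof.
move=> h; rewrite -row_free_unit; apply: inj_row_free => v v0.
apply: (can_inj (aut_funK (hol_lin p))); rewrite (h v) v0.
exact: esym (etrans (h (0 : 'rV[R]_n)) (mul0mx _ Q)).
Qed.

Lemma linear_expg p Q j : (forall x, hol_lin p x = x *m Q) ->
  (forall x, hol_lin (p ^+ j)%g x = x *m (Q ^+ j)) /\ @Aff R n N (p ^+ j)%g.
Proof.
move=> h; have uQ := linear_automorphism_unit h.
have h' x : aut_inv (hol_lin p) x = x *m invmx Q.
  by apply: (can_inj (aut_funK (hol_lin p))); rewrite aut_invK h mulmxKV.
have e : (forall x, hol_lin (p ^+ j)%g x = x *m (Q ^+ j)) /\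
    forall x, aut_inv (hol_lin (p ^+ j)%g) x = x *m (invmx Q ^+ j).
  elim: j => [|j [IH IH']]; first by split=> x; rewrite expr0 mulmx1.
  rewrite expgSr; split=> x.
    by change (hol_lin (p ^+ j)%g (hol_lin p x) = x *m Q ^+ j.+1); rewrite h IH exprS mulmxA.
  change (aut_inv (hol_lin p) (aut_inv (hol_lin (p ^+ j)%g) x) = x *m invmx Q ^+ j.+1).
  by rewrite h' IH' exprSr mulmxA.
by split; [exact: e.1|exact: linear_Aff e.1 e.2].
Qed.

(** Unipotence is tested on the matrix entries of the differential: along the powers p^j, their
    k-fold difference is the corresponding entry of (Q - 1)^k Q^j. *)
Lemma unipotent_dif p Q : (forall x, hol_lin p x = x *m Q) -> @unipotent R n N p ->
  exists k, (Q - 1) ^+ k = 0.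
Proof.
move=> h [_ un]; pose U := Q - 1.
have eU k j : U ^+ k * Q ^+ j.+1 - U ^+ k * Q ^+ j = U ^+ k.+1 * Q ^+ j.
  by rewrite exprS mulrA -mulrBl -[X in _ - X]mulr1 -mulrBr exprSr.
have /choice [k hk] : forall ij : 'I_n * 'I_n, exists k, forall j, (U ^+ k * Q ^+ j) ij.1 ij.2 = 0.
  move=> [u v]; have [k uk] := un _ (regular_dif u v); exists k => j /=.
  rewrite -(uk (p ^+ j)%g); last by have [] := linear_expg j h.
  elim: k j {uk} => [|k IH] j; first by rewrite expr0 mul1r /= (dif_linear (linear_expg j h).1).
  rewrite /= -expgSr -!IH -eU; by rewrite !mxE.
(* Vanishing for all j at one exponent propagates to larger exponents by [eU], so the sum of the
   exponents serves every entry. *)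
exists (\sum_ij k ij)%N; apply/matrixP => u v.
have step d j : (U ^+ (k (u, v) + d) * Q ^+ j) u v = 0.
  elim: d j => [|d IH] j; first by rewrite addn0; exact: (hk (u, v)).
  by rewrite addnS -eU mxE [X in _ + X]mxE (IH j.+1) (IH j) subrr.
rewrite (bigD1 (u, v)) //=; have := step (\sum_(i | i != (u, v)) k i)%N 0%N.
by rewrite expr0 mulr1 mxE.
Qed.

Variables (D : set G) (m : nat).
Hypotheses (diagD : simul_diag D (ar_lin A)) (m0 : (0 < m)%N) (expD : forall g, D (g ^+ m)%g).

Lemma lin_expg g j : ar_lin A (g ^+ j)%g = ar_lin A g ^+ j.
Proof. by elim: j => [|j IH]; [exact: ar_lin1|rewrite expgS ar_linM IH exprSr]. Qed.

(** Only the m-th powers of elements of G are known to lie in D. Hence diagonality in the basis Q is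
    transported to the closure for P^m, and the root of unity lemma then recovers P. *)
Theorem affine_translation_like : translation_like (affine_hom A).
Proof.
move=> p [[S [_ [_ _ SG _] _] Sp] un]; have cp := SG _ Sp.
have hp := closure_linear cp; set P := dif p in hp; have [k Nk] := unipotent_dif hp un.
have [Q Qu Qd] := diagD.
suff P1 : P = 1 by move=> x; rewrite hp P1 mulmx1.
apply: (unipotent_root_unity m0 Nk).
have [_ cl] := cp.
have diagP : is_diag_mx (Q *m toC (P ^+ m) *m invmx Q).
  apply/is_diag_mxP => u v uv.
  (* An off-diagonal entry of Q X Q^-1 is a complex linear form in X, with coefficients c. Its real
     and imaginary parts, evaluated at the m-th power of the differential, are regular functions
     vanishing on the image of G. *)
  pose c a b := Q u a * invmx Q b v.
  have eT (X : 'M[R]_n) : (Q *m toC X *m invmx Q) u v = \sum_b \sum_a c a b * (X a b)%:C%C.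
    rewrite mxE; apply: eq_bigr => b _; rewrite mxE mulr_suml; apply: eq_bigr => a _.
    by rewrite mxE mulrAC.
  have reM (z : R[i]) (x : R) : complex.Re (z * x%:C%C) = complex.Re z * x.
    by case: z => a b /=; rewrite mulr0 subr0.
  have imM (z : R[i]) (x : R) : complex.Im (z * x%:C%C) = complex.Im z * x.
    by case: z => a b /=; rewrite mulr0 add0r.
  have reg (w : 'I_n -> 'I_n -> R) : @regular R n N (fun q => \sum_b \sum_a w a b * (dif q ^+ m) a b).
    apply: regular_sum => b; apply: regular_sum => a.
    by apply: regular_mul; [exact: regular_const|exact: regular_dif_exp].
  have zero q : range (affine_hom A) q -> \sum_b \sum_a c a b * ((dif q ^+ m) a b)%:C%C = 0.
    move=> [g _ <-]; rewrite dif_affine_hom -lin_expg -eT.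
    by have /is_diag_mxP := Qd _ (expD g); apply.
  rewrite eT; apply/eqP; rewrite eq_complex; apply/andP; split; apply/eqP.
    rewrite raddf_sum -[RHS](cl _ (reg (fun a b => complex.Re (c a b)))).
      by apply: eq_bigr => b _; rewrite raddf_sum; apply: eq_bigr => a _; exact: reM.
    move=> q /zero /(congr1 (@complex.Re R)); rewrite raddf_sum => h; rewrite -[RHS]h.
    by apply: eq_bigr => b _; rewrite raddf_sum; apply: eq_bigr => a _; rewrite /= reM.
  rewrite raddf_sum -[RHS](cl _ (reg (fun a b => complex.Im (c a b)))).
    by apply: eq_bigr => b _; rewrite raddf_sum; apply: eq_bigr => a _; exact: imM.
  move=> q /zero /(congr1 (@complex.Im R)); rewrite raddf_sum => h; rewrite -[RHS]h.
  by apply: eq_bigr => b _; rewrite raddf_sum; apply: eq_bigr => a _; rewrite /= imM.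
(* P - 1 divides P^m - 1 with a cofactor commuting with it. *)
have Tk : (P ^+ m - 1) ^+ k = 0.
  rewrite subrX1 exprMn_comm ?Nk ?mul0r //.
  apply: commr_sum => i _; apply: commrX; apply: commr_sym; apply: commrB => //; exact: commr1.
have conjX (X : 'M[R[i]]_n) j : (Q *m X *m invmx Q) ^+ j = Q *m X ^+ j *m invmx Q.
  elim: j => [|j IH]; first by rewrite !expr0 mulmx1 mulmxV.
  rewrite !exprS IH; change (Q *m X *m invmx Q *m (Q *m X ^+ j *m invmx Q) = Q *m (X *m X ^+ j) *m invmx Q).
  by rewrite !mulmxA mulmxKV.
have := unipotent_diag diagP (k := k); have -> : Q *m toC (P ^+ m) *m invmx Q - 1 = Q *m toC (P ^+ m - 1) *m invmx Q.
  rewrite map_mxB mulmxBr mulmxBl map_mx1 mulmx1 mulmxV //.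
have toCX (X : 'M[R]_n) j : toC X ^+ j = toC (X ^+ j).
  elim: j => [|j IH]; first by rewrite !expr0 map_mx1.
  by rewrite !exprS IH; exact: (esym (map_mxM _ _ _)).
rewrite conjX toCX Tk map_mx0 mulmx0 mul0mx => /(_ erefl) T1.
apply: (@map_mx_inj _ _ (real_complex R) n n); rewrite map_mx1.
have := congr1 (fun X : 'M[R[i]]_n => invmx Q *m X *m Q) T1.
rewrite !mulmxA mulVmx // mul1mx -mulmxA mulVmx // mulmx1 => ->.
by rewrite mulmx1 mulVmx.
Qed.
End TranslationLike.

(** * From subnormal series to the final construction *)

Section VirtuallyPolycyclic.
Local Open Scope group_scope.
Variable G : groupType.

Lemma finite_quotient_index (H K : set G) : subgroup H -> finite_set (quotient_set K H) -> finite_index H K.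
Proof.
move=> sH /finite_seqP [s es].
have ins g : K g -> (index (coset_set H g) s < (size s).+1)%N.
  by move=> _; rewrite ltnS index_size.
exists 'I_(size s).+1, (fun g => inord (index (coset_set H g) s)) => g h Kg Kh.
move=> /(congr1 (@nat_of_ord _)); rewrite !inordK ?ins // => e.
have mem x : K x -> coset_set H x \in s.
  by move=> Kx; have : [set` s] (coset_set H x) by rewrite -es; exists x.
have ec : coset_set H g = coset_set H h.
  by rewrite -(nth_index set0 (mem g Kg)) e nth_index //; exact: mem.
have : coset_set H h h by exists 1; [exact: subgroup1|rewrite mulg1].
by rewrite -ec => -[x Hx <-]; rewrite mulKg.
Qed.

Lemma cyclic_quotient_mod (H K : set G) : subgroup H -> cyclic_quotient K H -> cyclic_mod H K.
Proof.
move=> sH [a Ka ha]; exists a => // x Kx; have [m hm] := ha x Kx.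
have mem y : coset_set H x = coset_set H y -> H (y^-1 * x).
  move=> e; have : coset_set H x x by exists 1; [exact: subgroup1|rewrite mulg1].
  by rewrite e => -[h Hh <-]; rewrite mulKg.
case: hm => /mem h; first by exists (Posz m).
by exists (- Posz m)%R; rewrite zpowN.
Qed.

Lemma virtually_polycyclic_vpoly : virtually_polycyclic G -> vpoly [set: G].
Proof.
move=> [k [D [D0 <- DS]]].
have : forall i, (i <= k)%N -> vpoly (D i).
  elim=> [_|i IH ik]; first by rewrite D0; exact: vpoly1.
  have [n h] := DS i ik; have [sH sK HK _] := n.
  apply: (vpolyS (IH (ltnW ik)) sH sK HK (normal_inP n)).
  by case: h => [f|[_ c]]; [left; exact: finite_quotient_index|right; exact: cyclic_quotient_mod].
exact.
Qed.
End VirtuallyPolycyclic.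

Theorem theorem1p1 (R : realType) (Gamma : groupType)
    (hGamma : virtually_polycyclic Gamma) :
  exists (n : nat) (N : lieGroup R n) (rho : Gamma -> holomorph N),
    [/\ connected [set: N], simply_connected R N & nilpotent_group N] /\
    [/\ nil_affine rho, crystallographic rho & translation_like rho].
Proof.
have vp := virtually_polycyclic_vpoly hGamma.
have fg (H : set Gamma) (sH : subgroup H) : finitely_generated H.
  by have := vpoly_fg vp sH; rewrite setIT.
have [S [sS _ nS dS fS]] := vpoly_solvable vp.
have [D [sD nD fD tD]] := @tower_exists R[i] Gamma fg (ex_intro _ S (And4 sS nS dS fS)).
have [_ _ _ [A hA]] := hull_exists sD nD fD tD.
have [m m0 hm] := finite_index_expg sD fD (subgroupT Gamma).
exists (pg_dim A), (pg_lie A), (affine_hom A); split; split.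
- exact: rV_connected.
- exact: rV_simply_connected.
- exact: iterated_nilpotent (hull_iterated hA).
- exact: affine_nil_affine.
- split; first exact: affine_properly_discontinuous (hull_proper hA).
  exact: affine_cocompact (hull_cobounded hA).
- apply: (affine_translation_like (hull_iterated hA) (hull_diag hA) m0) => g.
  exact: hm.
Qed.
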